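(* Let $\ell\in\mathbb{R}$, $a>0$ and $T>0$. Let $h$ be a spectral density such that $h(0)=1$, $\widehat h\ge0$ and $\widehat h$ is supported on $[-\tfrac a2,\tfrac a2]$. Then for any spectral measures $\mu,\nu\in\mathcal{L}$ such that $h^2$ is integrable with respect to $\nu$, $$\mathbb{P}\Big(\inf_{t\in[0,T+a]}f_{\mu+\nu}(t)>\ell\Big)\le\mathbb{P}\Big(\inf_{t\in[0,T]}f_{\mu+h^2\nu}(t)>\ell\Big).$$
   Context: A spectral measure is a finite, non-negative, symmetric Borel measure on $\mathbb{R}$; $\mathcal{S}$ is the set of all spectral measures. A spectral density is the density (non-negative, even, integrable function) of an absolutely continuous spectral measure; here $h$ is taken to be its continuous version, so that $h(0)$ and the measure $h^2\nu$ (given by $d(h^2\nu)(\lambda)=h(\lambda)^2\,d\nu(\lambda)$) are well defined. $\widehat h(t)=\int_{\mathbb{R}}e^{-it\lambda}h(\lambda)\,d\lambda$. Let $$\mathcal{L}=\Big\{\rho\in\mathcal{S}:\ \exists\beta>0,\ \int_{[0,\infty)}\max\big(\log^{1+\beta}\lambda,1\big)\,d\rho(\lambda)<\infty\Big\},$$ where $\log^{1+\beta}\lambda=(\log\lambda)^{1+\beta}$ for $\lambda\ge 1$ and is read as $0$ for $\lambda<1$. For $\rho\in\mathcal{L}$, $f_\rho:\mathbb{R}\to\mathbb{R}$ is the centered stationary Gaussian process with (almost surely) continuous sample paths and covariance $\mathbb{E}[f_\rho(s)f_\rho(s+t)]=\int_{\mathbb{R}}e^{-it\lambda}\,d\rho(\lambda)$.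 *)

(* Defs.v *)
From HB Require Import structures.
From mathcomp Require Export all_boot all_order all_algebra.
From mathcomp Require Export complex.
From mathcomp Require Export all_classical all_reals all_analysis measurable_realfun.
Export Order.TTheory GRing.Theory Num.Theory.
Export numFieldNormedType.Exports.

Set Implicit Arguments.
Unset Strict Implicit.
Unset Printing Implicit Defensive.

Local Open Scope classical_set_scope.
Local Open Scope ring_scope.

Section complex_integral.
Context d (T : measurableType d) (R : realType).

Definition cintegral (mu : {measure set T -> \bar R}) (g : T -> R[i]) : R[i] :=
  Complex (\int[mu]_x complex.Re (g x)) (\int[mu]_x complex.Im (g x)).

End complex_integral.

(* e^{i x} *)
Definition cis (R : realType) (x : R) : R[i] := Complex (cos x) (sin x).

Definition fourier_measure (R : realType) (rho : {measure set R -> \bar R})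
    (t : R) : R[i] :=
  cintegral rho (fun lam : R => cis (- (t * lam))).

Definition fourier (R : realType) (h : R -> R) (t : R) : R[i] :=
  cintegral (@lebesgue_measure R)
    (fun lam : R => cis (- (t * lam)) * Complex (h lam) 0).

Definition spectral_measure (R : realType) (rho : {measure set R -> \bar R}) :=
  (rho setT < +oo)%E /\
  forall A : set R, measurable A -> rho (-%R @^-1` A) = rho A.

Definition spectral_density (R : realType) (h : R -> R) :=
  [/\ forall x, 0 <= h x,
      forall x, h (- x) = h x &
      (@lebesgue_measure R).-integrable setT (EFin \o h)].

Definition class_L (R : realType) (rho : {measure set R -> \bar R}) :=
  spectral_measure rho /\
  exists2 beta : R, 0 < beta &
    (\int[rho]_(x in `[0%R, +oo[)
       (Num.max (if 1 <= x then ln x `^ (1 + beta) else 0) 1)%:E < +oo)%E.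

Section square_weighted_measure.
Context (R : realType).
Variables (h : {mfun R >-> R}) (nu : {measure set R -> \bar R}).

Definition sq_weighted (A : set R) : \bar R :=
  (\int[nu]_(x in A) ((h x) ^+ 2)%:E)%E.

Let sq_weighted0 : sq_weighted set0 = 0%E.
Proof. by rewrite /sq_weighted integral_set0. Qed.

Let sq_weighted_ge0 A : (0 <= sq_weighted A)%E.
Proof. by apply: integral_ge0 => x _; rewrite lee_fin sqr_ge0. Qed.

Let sq_weighted_sigma_additive : semi_sigma_additive sq_weighted.
Proof.
move=> F mF tF mUF; rewrite /sq_weighted.
have mh2 : measurable_fun [set: R] (EFin \o (fun x : R => (h x) ^+ 2)).
  by apply/measurable_EFinP; exact: measurable_funX.
rewrite ge0_integral_bigcup//=.
- apply: is_cvg_ereal_nneg_natsum_cond => n _ _.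
  by apply: integral_ge0 => x _; rewrite lee_fin sqr_ge0.
- exact: measurable_funTS.
- by move=> x _; rewrite lee_fin sqr_ge0.
Qed.

HB.instance Definition _ := isMeasure.Build _ _ _ sq_weighted
  sq_weighted0 sq_weighted_ge0 sq_weighted_sigma_additive.

End square_weighted_measure.

(* [normal_prob m 0] is not the Dirac mass at [m], so the degenerate Gaussian
   law is treated separately. *)
Definition gaussian_law (R : realType) (m s : R) (A : set R) : \bar R :=
  if s == 0 then \d_m A else normal_prob m s A.

Section processes.
Context d (Omega : measurableType d) (R : realType) (P : probability Omega R).
Implicit Type f : R -> {RV P >-> R}.

Definition gaussian_process f :=
  forall (n : nat) (t c : 'I_n -> R), exists m s : R,
    forall A : set R, measurable A ->
      P [set w | A (\sum_(i < n) c i * f (t i) w)] = gaussian_law m s A.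

Definition centered_process f := forall t, ('E_P[f t] = 0)%E.

(* Equality of the finite-dimensional laws is tested on measurable boxes,
   which determine a probability measure on R^n. *)
Definition stationary_process f :=
  forall (n : nat) (t : 'I_n -> R) (s : R) (A : 'I_n -> set R),
    (forall i, measurable (A i)) ->
    P [set w | forall i, A i (f (t i + s) w)] =
    P [set w | forall i, A i (f (t i) w)].

(* [f] is a version of $f_\rho$ *)
Definition process_with_spectral_measure (rho : {measure set R -> \bar R}) f :=
  [/\ gaussian_process f, centered_process f, stationary_process f,
      {ae P, forall w, continuous (fun t : R => f t w)} &
      forall s t : R,
        Complex (fine 'E_P[f s \* f (s + t)]) 0 = fourier_measure rho t].

Definition inf_above f (T l : R) : set Omega :=
  [set w | (l%:E < ereal_inf [set (f t w)%:E | t in `[0%R, T]])%E].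

(* Since continuity of the paths holds only almost surely and [P] need not be
   complete, [inf_above f T l] need not be measurable; it always is for the
   completion of [P], to which the outer measure [mu_ext P] restricts. *)
Definition persistence f (T l : R) : \bar R := mu_ext P (inf_above f T l).

End processes.

(* Main.v *)
(* Write f_(mu + nu) = X + Y with X, Y independent, of spectral measures mu, nu.
   The function u |-> P(X >= u on [0, T]) is log-concave by the Prekopa-Leindler
   inequality, and X is stationary, so for a fixed path g the probability that
   X + g > l on [0, T + a] is at most P(X + g(. + s) > l on [0, T]) for every s
   in [0, a], hence at most the probability where g is replaced by an average of
   its translates. Take the average against the probability density
   hhat / (2 pi), which has mass h 0 = 1 by Fourier inversion: averaging Y this
   way multiplies its spectral measure by h^2.

   No Gaussian process is constructed. On finitely many points, the law of a
   Gaussian vector is a functional on test functions determined by its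
   characteristic function, realized by iterated one-dimensional Gaussian
   integrals; the average is discretized at 2^p quantiles, so that midpoint
   log-concavity suffices, and the resulting error on the covariance is absorbed
   by adding a small independent noise. *)

Require Import Defs.
From mathcomp Require Import ring lra.

Set Implicit Arguments.
Unset Strict Implicit.
Unset Printing Implicit Defensive.

Local Open Scope classical_set_scope.
Local Open Scope ring_scope.

(** * Integrals of bounded functions and densities *)

(** The spectral weight B of the discretized average and h^2 are not ordered, so neither covariance
    dominates the other. Noise of variance eps^2 in each coordinate makes their difference positive
    semidefinite: by [energy_le] the form of B - h^2 is small once B is close to h^2 in L1(nu). The
    noise costs a shift of the level. This is affordable because inf > l is an increasing union of
    events with a margin r: half of r pays for the noise, the other half turns a closed inequality
    at countably many times back into a strict bound on the infimum. The number of times is fixed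
    before p, since the error allowed in L1(nu) shrinks with it. Independence needs no product
    space: concatenating lists in [gexp] adds independent Gaussian vectors, and a frozen path is the
    base point of the inner functional. Degenerate covariances are harmless, each vector of a list
    being integrated along its own line. Stationarity enters through covariances, which only see
    differences of times. *)

Lemma squeeze_cvg0 (R : realType) (u v : nat -> R) :
  (forall n, 0 <= u n <= v n) -> v n @[n --> \oo] --> 0 -> u n @[n --> \oo] --> 0.
Proof.
move=> uv v0; apply: (@squeeze_cvgr _ _ _ _ (fun=> 0) v u _ 0) => //.
- exact: nearW.
- exact: cvg_cst.
Qed.

Lemma probability_lty d (T : measurableType d) (R : realType)
  (P : probability T R) : (P setT < +oo)%E.
Proof. by rewrite probability_setT ltry. Qed.

Lemma Rintegral_probability_cst d (T : measurableType d) (R : realType)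
  (P : probability T R) (k : R) : \int[P]_x k = k.
Proof.
have P1 : fine (P setT) = 1 by rewrite probability_setT.
by rewrite Rintegral_cst// P1 mulr1.
Qed.

Section integrals.
Context d (T : measurableType d) (R : realType).
Implicit Types (mu : {measure set T -> \bar R}) (f g : T -> R).

Lemma integrable_le_bound mu f M : (mu setT < +oo)%E -> measurable_fun setT f ->
  (forall x, `|f x| <= M) -> mu.-integrable setT (EFin \o f).
Proof.
move=> muT mf fM; apply: measurable_bounded_integrable => //.
exists M; split; first exact: num_real.
by move=> x Mx y _; apply: le_trans (fM y) _; exact: ltW.
Qed.

Lemma dominated_Rintegral mu (f_ : nat -> T -> R) f g :
  (forall n, measurable_fun setT (f_ n)) ->
  (forall x, f_ n x @[n --> \oo] --> f x) ->
  mu.-integrable setT (EFin \o g) -> (forall n x, `|f_ n x| <= g x) ->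
  \int[mu]_x f_ n x @[n --> \oo] --> \int[mu]_x f x.
Proof.
move=> mf cf ig fg.
have mlim : measurable_fun setT f.
  by apply: (measurable_fun_cvg (h := f_)) => // x _; exact: cf.
have [||||//|intf _ cvgf] := @dominated_convergence _ _ _ mu setT measurableT
  (fun n => EFin \o f_ n) (EFin \o f) (EFin \o g).
- by move=> n; exact/measurable_EFinP.
- exact/measurable_EFinP.
- by apply: (@aeW _ _ _ mu) => x _; apply: cvg_EFin; [exact: nearW|exact: cf].
- exact: ig.
- by apply: (@aeW _ _ _ mu) => x n _; rewrite /= lee_fin.
apply: fine_cvg; rewrite fineK//.
exact: integrable_fin_num.
Qed.

Lemma bounded_Rintegral_cvg mu (f_ : nat -> T -> R) f M : (mu setT < +oo)%E ->
  (forall n, measurable_fun setT (f_ n)) ->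
  (forall x, f_ n x @[n --> \oo] --> f x) -> (forall n x, `|f_ n x| <= M) ->
  \int[mu]_x f_ n x @[n --> \oo] --> \int[mu]_x f x.
Proof.
move=> muT mf cf fM; apply: (dominated_Rintegral (g := cst M)) => //.
apply: (integrable_le_bound (M := `|M|)) => //.
Qed.

Import HBNNSimple.

(** Monotone convergence along simple functions reduces the formula to level sets, where it is
    [mE]. *)
Lemma ge0_integral_density mu (m : {measure set T -> \bar R}) (k : T -> R)
    (f : T -> \bar R) :
  measurable_fun setT k -> (forall x, 0 <= k x) ->
  (forall A, measurable A -> m A = \int[mu]_(x in A) (k x)%:E)%E ->
  measurable_fun setT f -> (forall x, 0 <= f x)%E ->
  (\int[m]_x f x = \int[mu]_x (f x * (k x)%:E))%E.
Proof.
move=> mk k0 mE mf f0; pose f_ := nnsfun_approx measurableT mf.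
transitivity (limn (fun n => \int[m]_x (f_ n x)%:E)%E).
  rewrite -monotone_convergence//.
  - by apply: eq_integral => x _; apply/esym/cvg_lim => //; apply: cvg_nnsfun_approx.
  - by move=> n; exact/measurable_EFinP/measurable_funTS.
  - by move=> *; rewrite lee_fin.
  - by move=> x _ p q pq; rewrite lee_fin; exact/lefP/nd_nnsfun_approx.
transitivity (limn (fun n => \int[mu]_x ((f_ n x)%:E * (k x)%:E))%E); last first.
  rewrite -monotone_convergence//.
  - apply: eq_integral => x _; apply/cvg_lim => //.
    rewrite muleC; under eq_fun do rewrite muleC.
    by apply: cvgeZl => //; exact: cvg_nnsfun_approx.
  - move=> n; apply: emeasurable_funM; last exact/measurable_EFinP.
    exact/measurable_EFinP/measurable_funTS.
  - by move=> n x _; rewrite -EFinM lee_fin mulr_ge0.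
  - move=> x _ p q pq; rewrite -!EFinM lee_fin ler_wpM2r//.
    exact/lefP/nd_nnsfun_approx.
congr (limn _); apply/funext => n.
under eq_integral do rewrite fimfunE -fsumEFin//.
under [RHS]eq_integral.
  move=> x _; rewrite fimfunE -fsumEFin// ge0_mule_fsuml; last first.
    by move=> r; exact: nnfun_muleindic_ge0.
  over.
rewrite !ge0_integral_fsum//.
- apply: eq_fsbigr => r _; rewrite integralZl_indic_nnsfun//.
  have mr : measurable (f_ n @^-1` [set r]) by exact: measurable_funPTI.
  rewrite integral_indic// setIT mE//.
  have [r0|r0] := leP 0 r; last first.
    rewrite preimage_nnfun0// integral_set0 mule0.
    rewrite integral0_eq// => x _.
    by rewrite indicE in_set0 mulr0 mul0e.
  under [RHS]eq_integral do rewrite -EFinM -mulrA EFinM.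
  rewrite ge0_integralZl//; last 2 first.
  - apply/measurable_EFinP/measurable_funM => //.
  - by move=> x _; rewrite lee_fin mulr_ge0.
  congr (_ * _)%E; rewrite integral_mkcond/= restrict_EFin.
  apply: eq_integral => x _ /=; rewrite patchE indicE; case: ifP => _.
    by rewrite mul1r.
  by rewrite mul0r.
- move=> r; apply/measurable_EFinP/measurable_funM => //.
  by apply: measurable_funM => //; apply: measurable_indic; exact: measurable_funPTI.
- move=> r x _; apply: mule_ge0; last by rewrite lee_fin.
  exact: nnfun_muleindic_ge0.
- by move=> r; apply/measurable_EFinP/measurable_funM => //.
- by move=> r x _; exact: nnfun_muleindic_ge0.
Qed.

Section density.
Context mu (m : {measure set T -> \bar R}) (k : T -> R).
Hypotheses (mk : measurable_fun setT k) (k0 : forall x, 0 <= k x)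
  (mE : forall A, measurable A -> m A = (\int[mu]_(x in A) (k x)%:E)%E).

Lemma integrable_densityP f : measurable_fun setT f ->
  mu.-integrable setT (EFin \o (fun x => f x * k x)) ->
  m.-integrable setT (EFin \o f).
Proof.
move=> mf /integrableP[_ fi]; apply/integrableP; split; first exact/measurable_EFinP.
rewrite (ge0_integral_density mk k0 mE)//; last first.
  by apply: measurableT_comp => //; exact/measurable_EFinP.
apply: le_lt_trans fi; rewrite le_eqVlt; apply/orP; left; apply/eqP.
by apply: eq_integral => x _ /=; rewrite normrM (ger0_norm (k0 x)).
Qed.

Lemma Rintegral_density f : measurable_fun setT f ->
  \int[m]_x f x = \int[mu]_x (f x * k x).
Proof.
move=> mf; rewrite /Rintegral; congr fine; rewrite integralE [RHS]integralE.
have mEf : measurable_fun setT (EFin \o f) by exact/measurable_EFinP.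
rewrite !(ge0_integral_density mk k0 mE)//; [|exact: measurable_funeneg|exact: measurable_funepos].
congr (_ - _)%E; apply: eq_integral => x _.
- rewrite !funeposE -!EFin_max -EFinM; congr (_%:E).
  by rewrite maxr_pMl// mul0r.
- rewrite !funenegE -!EFinN -!EFin_max -EFinM; congr (_%:E).
  by rewrite maxr_pMl// mul0r mulNr.
Qed.

End density.

Lemma Rintegral_measure_add (m1 m2 : {measure set T -> \bar R}) f :
  m1.-integrable setT (EFin \o f) -> m2.-integrable setT (EFin \o f) ->
  \int[measure_add m1 m2]_x f x = \int[m1]_x f x + \int[m2]_x f x.
Proof.
move=> i1 i2; rewrite /Rintegral.
have mf : measurable_fun setT (EFin \o f) by exact: (measurable_int m1).
rewrite integral_measure_add//.
by rewrite fineD//; exact: integrable_fin_num.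
Qed.

Lemma Rintegral_sum mu (J : Type) (r : seq J) (F : J -> T -> R) :
  (forall j, mu.-integrable setT (EFin \o F j)) ->
  mu.-integrable setT (EFin \o (fun w => \sum_(j <- r) F j w)) /\
  \int[mu]_w (\sum_(j <- r) F j w) = \sum_(j <- r) \int[mu]_w F j w.
Proof.
move=> iF; elim: r => [|j r [IH1 IH2]].
  have E0 : (fun w => \sum_(j <- [::]) F j w) = (fun=> 0 : R).
    by apply/funext => w; rewrite big_nil.
  rewrite E0 big_nil; split; first exact: integrable0.
  by rewrite Rintegral_cst// mul0r.
have E1 : (fun w => \sum_(k <- j :: r) F k w) = (fun w => F j w + \sum_(k <- r) F k w).
  by apply/funext => w; rewrite big_cons.
rewrite E1 big_cons -IH2 RintegralD//; split => //.
exact: (integrableD measurableT (iF j) IH1).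
Qed.

End integrals.

(** * The normal distribution *)

Section improper_FTC.
Context (R : realType).
Local Notation leb := (@lebesgue_measure R).

Lemma Rintegral_derive (H h : R -> R) (a b : R) : a < b ->
  (forall x : R, is_derive x 1 H (h x)) -> continuous h ->
  \int[leb]_(x in `[a, b]) h x = H b - H a.
Proof.
move=> ab dH ch; rewrite /Rintegral (@continuous_FTC2 R h H a b)//.
- exact: continuous_subspaceT.
- have cH x : {for x, continuous H}.
    by apply/differentiable_continuous/derivable1_diffP; have [] := dH x.
  split.
  + by move=> x _; have [] := dH x.
  + by apply: cvg_at_right_filter; exact: cH.
  + by apply: cvg_at_left_filter; exact: cH.
- by move=> x _; rewrite derive1E; have [] := dH x.
Qed.

(** Dominated convergence along the intervals of radius n + 1 about m, on which the fundamental
    theorem leaves only boundary terms. *)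
Lemma Rintegral_derive_eq0 (m : R) (H h : R -> R) :
  (forall x : R, is_derive x 1 H (h x)) -> continuous h ->
  leb.-integrable setT (EFin \o h) ->
  H (m + n.+1%:R) @[n --> \oo] --> 0 -> H (m - n.+1%:R) @[n --> \oo] --> 0 ->
  \int[leb]_x h x = 0.
Proof.
move=> dH ch ih Hp Hm.
have mh : measurable_fun setT h by apply/measurable_EFinP; exact: measurable_int ih.
have c1 : \int[leb]_x ((h \_ `[m - n.+1%:R, m + n.+1%:R]) x) @[n --> \oo] -->
    \int[leb]_x h x.
  apply: (@dominated_Rintegral _ _ _ leb (fun n => h \_ `[m - n.+1%:R, m + n.+1%:R]) h (fun x => `|h x|)).
  - move=> n; apply/(measurable_restrictT _ _).1 => //; exact: measurable_funTS.
  - move=> x; apply: cvg_near_cst.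
    exists (Num.truncn `|x - m|) => // n /= nx.
    rewrite patchE mem_set//= in_itv/= -ler_distl.
    apply: ltW; apply: lt_le_trans (truncnS_gt _) _.
    by rewrite ler_nat ltnS.
  - exact: (integrable_norm ih).
  - by move=> n x; rewrite patchE; case: ifP => //; rewrite normr0.
have c2 : \int[leb]_x ((h \_ `[m - n.+1%:R, m + n.+1%:R]) x) @[n --> \oo] --> (0 : R).
  rewrite (_ : (fun _ => _) = fun n => H (m + n.+1%:R) - H (m - n.+1%:R)); last first.
    apply/funext => n; rewrite -Rintegral_mkcond Rintegral_derive//.
    by rewrite ltrD2l gtrN.
  by rewrite -[X in _ --> X](subr0 0); exact: cvgB.
exact: (cvg_unique _ c1 c2).
Qed.

End improper_FTC.

Section normal_moments.
Context (R : realType) (m s : R).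
Hypothesis s0 : s != 0.
Local Notation leb := (@lebesgue_measure R).
Local Notation p := (normal_pdf m s).
Local Notation N := (normal_prob m s).

Let s2_gt0 : 0 < s ^+ 2. Proof. by rewrite exprn_even_gt0. Qed.

Lemma is_derive_normal_pdf (x : R) :
  is_derive x 1 p (- ((x - m) / s ^+ 2) * p x).
Proof.
rewrite normal_pdfE//.
have -> : (fun x => normal_peak s * normal_fun m s x) =
    normal_peak s \*: (expR \o (fun x => - (x - m) ^+ 2 * (s ^+ 2 *+ 2)^-1)).
  by [].
apply: is_derive_eq; rewrite /normal_fun /GRing.scale /=.
by rewrite -mulr_natr; field; rewrite ?s0 ?pnatr_eq0 ?andbT//.
Qed.

(** With v = (x - m)^2 / (4 s^2) the two Gaussians are exp (- 2 v) and exp (- v), and 1 + v <= exp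
    v: widening s to s sqrt 2 pays for the quadratic weight. Hence functions of quadratic growth are
    integrable. *)
Lemma normal_fun_weight_le (x : R) :
  (1 + (x - m) ^+ 2) * normal_fun m s x <=
  (1 + 4 * s ^+ 2) * normal_fun m (s * Num.sqrt 2) x.
Proof.
rewrite /normal_fun exprMn sqr_sqrtr//; set u := (x - m) ^+ 2.
have u0 : 0 <= u by rewrite sqr_ge0.
set v := u / (4 * s ^+ 2).
have v0 : 0 <= v by rewrite divr_ge0// mulr_ge0// ltW.
have -> : - u / (s ^+ 2 *+ 2) = - v + - v.
  by rewrite /v -mulr_natr; field; rewrite ?s0 ?pnatr_eq0 ?andbT//.
have -> : - u / (s ^+ 2 * 2 *+ 2) = - v.
  by rewrite /v -mulr_natr; field; rewrite ?s0 ?pnatr_eq0 ?andbT//.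
have uE : u = v * (4 * s ^+ 2) by rewrite /v; field; rewrite ?s0 ?pnatr_eq0 ?andbT//.
rewrite expRD mulrA ler_wpM2r ?expR_ge0// expRN.
rewrite ler_pdivrMr ?expR_gt0//.
apply: (@le_trans _ _ ((1 + 4 * s ^+ 2) * (1 + v))).
  rewrite uE; rewrite -subr_ge0.
  have -> : (1 + 4 * s ^+ 2) * (1 + v) - (1 + v * (4 * s ^+ 2)) = v + 4 * s ^+ 2.
    by ring.
  by rewrite addr_ge0// mulr_ge0// ltW.
by rewrite ler_wpM2l ?expR_ge1Dx//; have := s2_gt0; lra.
Qed.

Let sq0 : s * Num.sqrt 2 != 0.
Proof. by rewrite mulf_neq0// sqrtr_eq0 -ltNge. Qed.

Let C := (1 + 4 * s ^+ 2) * normal_peak s / normal_peak (s * Num.sqrt 2).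

Let weight_le (x : R) :
  (1 + (x - m) ^+ 2) * p x <= C * normal_pdf m (s * Num.sqrt 2) x.
Proof.
rewrite !normal_pdfE// /C.
have k0 : normal_peak (s * Num.sqrt 2) != 0 by rewrite gt_eqF ?normal_peak_gt0.
set k := normal_peak (s * _) in k0 *; set f := normal_fun _ (s * _) x.
have -> : (1 + 4 * s ^+ 2) * normal_peak s / k * (k * f) =
  normal_peak s * ((1 + 4 * s ^+ 2) * f) by field.
rewrite mulrCA.
by rewrite ler_wpM2l ?normal_peak_ge0 ?normal_fun_weight_le.
Qed.

Lemma integrable_normal_weight (g : R -> R) K : measurable_fun setT g ->
  (forall x, `|g x| <= K * (1 + (x - m) ^+ 2)) ->
  leb.-integrable setT (EFin \o (fun x => g x * p x)).
Proof.
move=> mg gK.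
have K0 : 0 <= K.
  have := le_trans (normr_ge0 _) (gK m).
  by rewrite subrr expr0n addr0 mulr1.
apply: (@le_integrable _ _ _ leb _ measurableT _
  (EFin \o (fun x => K * C * normal_pdf m (s * Num.sqrt 2) x))).
- by apply/measurable_EFinP/measurable_funM => //; exact: measurable_normal_pdf.
- move=> x _ /=; rewrite lee_fin normrM (ger0_norm (normal_pdf_ge0 _ _ _)).
  apply: le_trans (ler_norm _); rewrite -mulrA.
  apply: le_trans (ler_wpM2r (normal_pdf_ge0 _ _ _) (gK x)) _.
  by rewrite -mulrA ler_wpM2l.
- under [X in integrable _ _ X]funext do rewrite /= EFinM.
  by apply: integrableZl => //; exact: integrable_normal_pdf.
Qed.

Lemma normal_probE (A : set R) : measurable A ->
  N A = (\int[leb]_(x in A) (p x)%:E)%E.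
Proof. by []. Qed.

Lemma normal_integrable (g : R -> R) K : measurable_fun setT g ->
  (forall x, `|g x| <= K * (1 + (x - m) ^+ 2)) -> N.-integrable setT (EFin \o g).
Proof.
move=> mg gK; apply: (@integrable_densityP _ _ _ leb N p (measurable_normal_pdf m s)
  (normal_pdf_ge0 m s) normal_probE) => //.
exact: integrable_normal_weight gK.
Qed.

Lemma normal_Rintegral (g : R -> R) : measurable_fun setT g ->
  \int[N]_x g x = \int[leb]_x (g x * p x).
Proof.
exact: (@Rintegral_density _ _ _ leb N p (measurable_normal_pdf m s)
  (normal_pdf_ge0 m s) normal_probE).
Qed.

(** Kills the boundary terms of [normal_stein]. In the wider Gaussian left by [weight_le], exp v >=
    1 + v turns the growth of t into the rate 1 / (n + 1). *)
Let tail_cvg (t : R ^nat) : (forall n : nat, n%:R <= (t n - m) ^+ 2) ->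
  (1 + (t n - m) ^+ 2) * p (t n) @[n --> \oo] --> 0.
Proof.
move=> tn.
pose B := C * normal_peak (s * Num.sqrt 2) * (4 * s ^+ 2).
apply: (@squeeze_cvg0 _ _
    (fun n : nat => B * n.+1%:R^-1 * (1 + (4 * s ^+ 2)^-1))); last first.
  rewrite -[X in _ --> X](mul0r (1 + (4 * s ^+ 2)^-1)).
  apply: cvgMl; rewrite -[X in _ --> X](mulr0 B); apply: cvgMr.
  exact: cvg_harmonic.
move=> n; rewrite mulr_ge0 ?normal_pdf_ge0 ?addr_ge0 ?sqr_ge0//=.
apply: le_trans (weight_le _) _.
rewrite normal_pdfE// /normal_fun exprMn sqr_sqrtr//.
set u := (_ - m) ^+ 2.
have un : n%:R <= u by exact: tn.
have un1 : 0 <= (n%:R : R) by [].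
have -> : - u / (s ^+ 2 * 2 *+ 2) = - (u / (4 * s ^+ 2)).
  by rewrite -mulr_natr; field; rewrite ?s0 ?pnatr_eq0 ?andbT//.
have C0 : 0 <= C.
  have := s2_gt0 => ?; rewrite /C !mulr_ge0 ?invr_ge0 ?normal_peak_ge0//; lra.
have e1 := expR_ge1Dx (u / (4 * s ^+ 2)).
have e2 : 0 < expR (u / (4 * s ^+ 2)) by exact: expR_gt0.
rewrite expRN; set E := expR _ in e1 e2 *.
suff EE : E^-1 <= (4 * s ^+ 2 + 1) / n.+1%:R.
  apply: (@le_trans _ _
    (C * (normal_peak (s * Num.sqrt 2) * ((4 * s ^+ 2 + 1) / n.+1%:R)))).
    by rewrite ler_wpM2l// ler_wpM2l ?normal_peak_ge0.
  rewrite le_eqVlt; apply/orP; left; apply/eqP; rewrite /B.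
  by field; rewrite s0 /= addrC natr1 pnatr_eq0.
rewrite -[leLHS]div1r ler_pdivrMr// mulrAC ler_pdivlMr ?ltr0n// mul1r.
have -> : n.+1%:R = n%:R + 1 :> R by rewrite -natr1.
apply: (@le_trans _ _ ((4 * s ^+ 2 + 1) * (1 + u / (4 * s ^+ 2)))); last first.
  by rewrite ler_wpM2l//; have := s2_gt0; lra.
have -> : (4 * s ^+ 2 + 1) * (1 + u / (4 * s ^+ 2)) =
  4 * s ^+ 2 + 1 + u + u / (4 * s ^+ 2).
  by field; rewrite ?s0 ?pnatr_eq0 ?andbT//.
have : 0 <= u / (4 * s ^+ 2) by rewrite divr_ge0 ?sqr_ge0//; have := s2_gt0; lra.
have := s2_gt0; lra.
Qed.

(** Stein's identity, an integration by parts: the derivative of G p is g p - G (x - m) p / s^2.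
    Mean, variance and characteristic function of the normal law all follow from it. *)
Lemma normal_stein (G g : R -> R) K :
  (forall x : R, is_derive x 1 G (g x)) -> continuous g ->
  (forall x, `|G x| <= K * (1 + `|x - m|)) -> (forall x, `|g x| <= K) ->
  \int[N]_x (G x * (x - m)) = s ^+ 2 * \int[N]_x g x.
Proof.
move=> dG cg GK gK.
have cG : continuous G.
  by move=> x; apply/differentiable_continuous/derivable1_diffP; have [] := dG x.
have K0 : 0 <= K by exact: le_trans (normr_ge0 _) (gK 0).
have cp : continuous p by exact: continuous_normal_pdf.
have mG : measurable_fun setT G by exact: continuous_measurable_fun.
have mg : measurable_fun setT g by exact: continuous_measurable_fun.
have cxm : continuous (fun x : R => x - m).
  by move=> x; apply: cvgB; [exact: cvg_id|exact: cvg_cst].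
have mxm : measurable_fun setT (fun x : R => x - m) by exact: continuous_measurable_fun.
have norm1 (x : R) : 1 + `|x| <= 2 * (1 + x ^+ 2).
  by rewrite -[x ^+ 2]real_normK ?num_real//; have := sqr_ge0 (`|x| - 1); nra.
have norm2 (x : R) : (1 + `|x|) * `|x| <= 2 * (1 + x ^+ 2).
  by rewrite -[x ^+ 2]real_normK ?num_real//; have := sqr_ge0 (`|x| - 1); nra.
have i1 : leb.-integrable setT (EFin \o (fun x => G x * (x - m) * p x)).
  apply: (integrable_normal_weight (K := K * 2)); first exact: measurable_funM.
  move=> x; rewrite normrM -mulrA.
  apply: le_trans (ler_wpM2r (normr_ge0 _) (GK x)) _.
  by rewrite -mulrA ler_wpM2l// norm2.
have i2 : leb.-integrable setT (EFin \o (fun x => g x * p x)).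
  apply: (integrable_normal_weight (K := K)) => // x.
  by apply: le_trans (gK x) _; rewrite ler_peMr// lerDl sqr_ge0.
pose h := fun x => g x * p x - (s ^+ 2)^-1 * (G x * (x - m) * p x).
have ih : leb.-integrable setT (EFin \o h).
  rewrite (_ : EFin \o h = (fun x => (g x * p x)%:E -
      (s ^+ 2)^-1%:E * (G x * (x - m) * p x)%:E)%E)//.
  by apply: integrableB => //; exact: integrableZl.
have tl (t : R ^nat) : (forall n : nat, n%:R <= (t n - m) ^+ 2) ->
    (G \* p) (t n) @[n --> \oo] --> 0.
  move=> tn; apply: norm_cvg0.
  apply: (@squeeze_cvg0 _ _
    (fun n => K * 2 * ((1 + (t n - m) ^+ 2) * p (t n)))).
  - move=> n; rewrite normr_ge0/= normrM (ger0_norm (normal_pdf_ge0 _ _ _)).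
    rewrite mulrA ler_wpM2r ?normal_pdf_ge0//.
    by apply: le_trans (GK _) _; rewrite -mulrA ler_wpM2l.
  - by rewrite -[X in _ --> X](mulr0 (K * 2)); apply: cvgMr; exact: tail_cvg.
have h0 : \int[leb]_x h x = 0.
  apply: (@Rintegral_derive_eq0 _ m (G \* p)) => //.
  - move=> x; apply: (is_derive_eq (is_deriveM (dG x) (is_derive_normal_pdf x))).
    by rewrite /h /GRing.scale/=; field.
  - by move=> x; apply: cvgB; [|apply: cvgMr];
      [apply: cvgM; [exact: cg|exact: cp]|
       apply: cvgM; [apply: cvgM; [exact: cG|exact: cxm]|exact: cp]].
  - apply: tl => n; rewrite addrAC subrr add0r -natrX ler_nat.
    by rewrite (leq_trans (leqnSn n))// expnS leq_pmulr// expn_gt0.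
  - apply: tl => n; rewrite addrAC subrr add0r sqrrN -natrX ler_nat.
    by rewrite (leq_trans (leqnSn n))// expnS leq_pmulr// expn_gt0.
have i3 : leb.-integrable setT
    (EFin \o (fun x => (s ^+ 2)^-1 * (G x * (x - m) * p x))).
  exact: (integrableZl measurableT (s ^+ 2)^-1 i1).
rewrite !normal_Rintegral//; last by apply: measurable_funM. 
move: h0; rewrite /h RintegralB//.
rewrite RintegralZl// => /eqP; rewrite subr_eq0 => /eqP ->.
by rewrite mulrA divff ?mul1r// gt_eqF.
Qed.

End normal_moments.

Section normal_characteristic.
Context (R : realType) (m s : R).
Hypothesis s0 : s != 0.
Local Notation N := (normal_prob m s).

Let norm1 (x : R) : `|x| <= 1 * (1 + x ^+ 2).
Proof.
by rewrite -[x ^+ 2]real_normK ?num_real//; have := sqr_ge0 (`|x| - 1); nra.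
Qed.

Let mxm : measurable_fun [set: R] (fun x : R => x - m).
Proof. by apply: measurable_funB. Qed.

Let N1 : fine (N setT) = 1.
Proof. by rewrite probability_setT. Qed.

Lemma normal_integrable_center : N.-integrable setT (EFin \o (fun x : R => x - m)).
Proof. by apply: (normal_integrable s0 (K := 1)). Qed.

Lemma normal_integrable_center2 :
  N.-integrable setT (EFin \o (fun x : R => (x - m) ^+ 2)).
Proof.
apply: (normal_integrable s0 (K := 1)); first exact: measurable_funX.
by move=> x; rewrite ger0_norm ?sqr_ge0// mul1r lerDr.
Qed.

Lemma normal_mean0 : \int[N]_x (x - m) = 0.
Proof.
have := @normal_stein R m s s0 (cst 1) (cst 0) 1.
under eq_Rintegral do rewrite mul1r.
rewrite /= Rintegral_cst// mul0r mulr0; apply.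
- by move=> x; exact: cvg_cst.
- by move=> x; rewrite normr1 mul1r lerDl.
- by move=> x; rewrite normr0.
Qed.

Lemma normal_variance : \int[N]_x ((x - m) ^+ 2) = s ^+ 2.
Proof.
under eq_Rintegral do rewrite expr2.
have := @normal_stein R m s s0 (fun x => x - m) (cst 1) 1.
rewrite /= Rintegral_cst// N1 !mulr1; apply.
- by move=> x; apply: is_derive_eq; rewrite subr0.
- by move=> x; exact: cvg_cst.
- by move=> x; rewrite mul1r lerDr.
- by move=> x; rewrite normr1.
Qed.

(** As a function of c the integral solves Psi' = - c s^2 Psi, by differentiation under the integral
    and Stein's identity, so Psi exp ((c s)^2 / 2) is constant. The phase b treats cosine and sine
    together. *)
Lemma normal_cos (c b : R) :
  \int[N]_x cos (c * (x - m) + b) = expR (- (c * s) ^+ 2 / 2) * cos b.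
Proof.
pose Psi c := \int[N]_x cos (c * (x - m) + b).
have clin (e : R) : continuous (fun x : R => e * (x - m) + b).
  by move=> x; apply: cvgD; [apply: cvgMr; apply: cvgB; [exact: cvg_id|exact: cvg_cst]|exact: cvg_cst].
have ccos (e : R) : continuous (fun x : R => cos (e * (x - m) + b)).
  by move=> x; apply: (continuous_comp (clin e x)); exact: continuous_cos.
have csin (e : R) : continuous (fun x : R => sin (e * (x - m) + b)).
  by move=> x; apply: (continuous_comp (clin e x)); exact: continuous_sin.
have dcos (y e : R) : is_derive e 1 (fun e => cos (e * (y - m) + b))
    (- ((y - m) * sin (e * (y - m) + b))).
  by apply: is_derive_eq; rewrite /GRing.scale/=; ring.
have d1E (y e : R) : ('D_1 (fun e : R => cos (e * (y - m) + b)) e) =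
    - ((y - m) * sin (e * (y - m) + b)).
  by have [_ ->] := dcos y e.
have icos (e : R) : N.-integrable setT (EFin \o (fun x => cos (e * (x - m) + b))).
  apply: (integrable_le_bound (M := 1)).
  - by rewrite -ge0_fin_numE// fin_num_measure.
  - exact: continuous_measurable_fun.
  - by move=> x; rewrite ler_norml cos_geN1 cos_le1.
have dPsi (e : R) : is_derive e 1 Psi (- (e * s ^+ 2 * Psi e)).
  have eI : `]e - 1, e + 1[%classic e by rewrite /= in_itv/= ltrBlDr ltrDl ltr01.
  have ub (x y : R) : `](e - 1), (e + 1)[%classic x -> [set: R] y ->
      `|partial1of2 (fun e (y : R) => cos (e * (y - m) + b)) x y| <= `|y - m|.
    move=> _ _; rewrite partial1of2E d1E normrN normrM ler_piMr//.
    by rewrite ler_norml sin_geN1 sin_le1.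
  have inorm := integrable_norm normal_integrable_center.
  have dd (x y : R) : `](e - 1), (e + 1)[%classic x -> [set: R] y ->
    derivable ((fun e (y : R) => cos (e * (y - m) + b)) ^~ y) x 1.
    by move=> _ _; have [] := dcos y x.
  have D1 := derivable_under_integral measurableT eI (fun x _ => icos x) dd
    (fun y => normr_ge0 (y - m)) inorm ub.
  have D2 := differentiation_under_integral measurableT eI (fun x _ => icos x) dd
    (fun y => normr_ge0 (y - m)) inorm ub.
  apply: DeriveDef => //; rewrite -derive1E D2.
  transitivity (- \int[N]_y (sin (e * (y - m) + b) * (y - m))).
    rewrite -[RHS]mulN1r -RintegralZl//.
      by apply: eq_Rintegral => y _; rewrite partial1of2E d1E mulN1r mulrC.
    apply: (le_integrable _ _ _ inorm) => //.
      by apply/measurable_EFinP/measurable_funM => //; exact: continuous_measurable_fun.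
    move=> y _ /=; rewrite lee_fin normrM normr_id ler_piMl//.
    by rewrite ler_norml sin_geN1 sin_le1.
  congr (- _).
  have dG (y : R) : is_derive y 1 (fun y : R => sin (e * (y - m) + b))
      (e * cos (e * (y - m) + b)).
    by apply: is_derive_eq; rewrite /GRing.scale/=; ring.
  rewrite (normal_stein s0 (K := 1 + `|e|) dG).
  - by rewrite RintegralZl//; rewrite /Psi; ring.
  - by move=> y; apply: cvgMr; exact: ccos.
  - move=> y; apply: (@le_trans _ _ 1); first by rewrite ler_norml sin_geN1 sin_le1.
    by have := normr_ge0 e; have := normr_ge0 (y - m); nra.
  - move=> y; rewrite normrM; apply: (@le_trans _ _ `|e|); last by rewrite lerDr.
    by rewrite ler_piMr// ler_norml cos_geN1 cos_le1.
pose F e := Psi e * expR ((e * s) ^+ 2 / 2).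
have F'0 (e : R) : is_derive e 1 F 0.
  have dx : is_derive e 1 (fun e => expR ((e * s) ^+ 2 / 2))
      (e * s ^+ 2 * expR ((e * s) ^+ 2 / 2)).
    by apply: is_derive_eq; rewrite /GRing.scale/=; field.
  apply: (is_derive_eq (is_deriveM (dPsi e) dx)).
  by rewrite /GRing.scale/=; ring.
have := is_derive_0_is_cst c 0 F'0.
have P0 : Psi 0 = cos b.
  rewrite /Psi; under eq_Rintegral do rewrite mul0r add0r.
  by rewrite Rintegral_cst// N1 mulr1.
rewrite /F P0 mul0r expr0n mul0r expR0 mulr1 => <-.
by rewrite mulNr expRN mulrCA mulVf ?mulr1// gt_eqF ?expR_gt0.
Qed.

End normal_characteristic.

(** * The Prekopa-Leindler inequality on the line *)

Section brunn_minkowski.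
Context (R : realType).
Local Notation leb := (@lebesgue_measure R).

Lemma measurable_fun_midpoint (m : R) :
  measurable_fun setT (fun x : R => (x + m) / 2).
Proof.
apply: continuous_measurable_fun => x; apply: cvgMl; apply: cvgD.
  exact: cvg_id.
exact: cvg_cst.
Qed.

(** Uniqueness of Lebesgue measure: half of its pushforward under the midpoint map has the right
    value on half-open intervals. *)
Lemma lebesgue_measure_midpoint (m : R) (E : set R) : measurable E ->
  leb ((fun x : R => (x + m) / 2) @^-1` E) = (2%:E * leb E)%E.
Proof.
move=> mE; pose psi (x : measurableTypeR R) : measurableTypeR R := (x + m) / 2.
have mpsi : measurable_fun setT psi by exact: measurable_fun_midpoint.
pose nu : {measure set (measurableTypeR R) -> \bar R} :=
  measure_function_pushforward__canonical__measure_function_Measure leb mpsi.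
have half0 : 0 <= 2^-1 :> R by rewrite invr_ge0.
pose M : {measure set (measurableTypeR R) -> \bar R} := mscale (NngNum half0) nu.
have -> : leb E = M E.
  apply: (@lebesgue_measure_unique R M) => // _ [[u v]] _ <- /=.
  rewrite /M /= /mscale /= /nu /= /pushforward.
  have -> : psi @^-1` `]u, v] = [set` `]2 * u - m, 2 * v - m]].
    apply/seteqP; split => x /=; rewrite /psi !in_itv/=; lra.
  rewrite !lebesgue_measure_itv/= !lte_fin.
  have -> : (2 * u - m < 2 * v - m) = (u < v) by apply/idP/idP; lra.
  case: ifP => _; last by rewrite mule0.
  by rewrite -!EFinD -EFinM; congr (_%:E); field.
by rewrite muleA -EFinM divff// mul1e.
Qed.

Lemma brunn_minkowski1 (A B C : set R) : measurable A -> measurable B ->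
  measurable C -> A !=set0 -> B !=set0 -> has_ubound A -> has_lbound B ->
  (forall x y, A x -> B y -> C ((x + y) / 2)) ->
  (leb A + leb B <= 2%:E * leb C)%E.
Proof.
move=> mA mB mC A0 B0 uA lB ABC.
have sA : has_sup A by [].
have iB : has_inf B by [].
apply/lee_addgt0Pr => e e0.
(* For k near sup A and m near inf B, the midpoint sets (A + m) / 2 and
   (k + B) / 2 lie in C and overlap in an interval of length at most e / 2. *)
have [k Ak kA] := sup_adherent (divr_gt0 e0 (@ltr0n R 2)) sA.
have [m Bm mB'] := inf_adherent (divr_gt0 e0 (@ltr0n R 2)) iB.
(* [c0] bounds (A + m) / 2 from above, and [c0 - e / 2] bounds (k + B) / 2 from below. *)
pose c0 := (sup A + inf B + e / 2) / 2.
pose C1 := C `&` `]-oo, c0]; pose C2 := C `&` `]c0, +oo[.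
have mC1 : measurable C1 by apply: measurableI.
have mC2 : measurable C2 by apply: measurableI.
have h1 : (leb A <= 2%:E * leb C1)%E.
  rewrite -(lebesgue_measure_midpoint m)//; apply: le_measure; rewrite ?inE//.
    by rewrite -[X in measurable X]setTI; apply: measurable_fun_midpoint => //; exact: measurableU.
  move=> x Ax; split; first exact: ABC.
  rewrite /= in_itv/= /c0 ler_pM2r// -addrA lerD ?(sup_ubound uA Ax)//.
  exact: ltW.
pose I : set R := [set` `[c0 - e / 2, c0]].
have mI : measurable I by exact: measurable_itv.
have h2 : (leb B <= 2%:E * leb C2 + e%:E)%E.
  have -> : e%:E = (2%:E * leb I)%E.
    rewrite lebesgue_measure_itv/= lte_fin ltrBlDr ltrDl divr_gt0//.
    by rewrite -EFinD -EFinM; congr (_%:E); field.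
  rewrite -ge0_muleDr//.
  apply: (@le_trans _ _ (2%:E * leb (C2 `|` I)))%E; last first.
    by rewrite lee_pmul2l// measureU2.
  rewrite -(lebesgue_measure_midpoint k)//; last exact: measurableU.
  apply: le_measure; rewrite ?inE//.
    by rewrite -[X in measurable X]setTI; apply: measurable_fun_midpoint => //; exact: measurableU.
  move=> y By /=; have [yc|yc] := ltP c0 ((y + k) / 2).
    by left; split; [rewrite addrC; exact: ABC|rewrite /= in_itv/= yc].
  right; rewrite /I/= in_itv/= yc andbT /c0.
  have := inf_lbound lB By; move: kA; lra.
have -> : leb C = (leb C1 + leb C2)%E.
  rewrite -measureU//.
    congr (leb _); apply/seteqP; split => [x Cx|x [] []//].
    by have [xc|xc] := leP x c0; [left|right]; split => //=; rewrite in_itv/= ?xc.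
  apply/seteqP; split => x // [[_ xc1] [_ xc2]]; move: xc1 xc2.
  by rewrite /= !in_itv/= andbT => xc; rewrite ltNge xc.
rewrite ge0_muleDr// -addeA; exact: leeD.
Qed.

End brunn_minkowski.

Section prekopa_leindler.
Context (R : realType).
Local Notation leb := (@lebesgue_measure R).
Local Notation GR := (measurableTypeR R).

Lemma measurable_superlevel d (T : measurableType d) (u : T -> R) (t : R) : measurable_fun setT u ->
  measurable [set x | t < u x].
Proof.
move=> mu; rewrite (_ : [set x | _] = u @^-1` `]t, +oo[%classic).
  by rewrite -[X in measurable X]setTI; exact: mu.
by apply/seteqP; split => x /=; rewrite in_itv/= andbT.
Qed.

Lemma measurable_subgraph (u : R -> R) : measurable_fun setT u ->
  measurable [set p : GR * GR | p.2 < u p.1].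
Proof.
move=> mu; rewrite (_ : [set p | _] = [set p : GR * GR | 0 < u p.1 - p.2]); last first.
  by apply/seteqP; split => p /=; rewrite subr_gt0.
apply: measurable_superlevel; apply: measurable_funB => //.
exact: measurableT_comp.
Qed.

(** Tonelli's theorem on the region between 0 and the graph of u. *)
Lemma layer_cake (u : R -> R) : measurable_fun setT u -> (forall x, 0 <= u x) ->
  (\int[leb]_x (u x)%:E =
   \int[leb]_(t in [set t | (0 < t)%R]) leb [set x | (t < u x)%R])%E.
Proof.
move=> mu u0.
transitivity (\int[leb]_x (\int[leb]_t (\1_[set t | 0 < t < u x] t)%:E))%E.
  apply: eq_integral => x _; rewrite integral_indic//.
    rewrite setIT (_ : [set t | _] = `]0, u x[%classic); last first.
      by apply/seteqP; split => t /=; rewrite in_itv.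
    rewrite /= lebesgue_measure_itv/= lte_fin.
    case: ltgtP (u0 x) => [_ _||<- _]//.
    by rewrite sube0.
  rewrite (_ : [set t | _] = `]0, u x[%classic); last first.
    by apply/seteqP; split => t /=; rewrite in_itv.
  exact: measurable_itv.
rewrite (@fubini_tonelli _ _ GR GR R leb leb
  (fun p : GR * GR => (\1_[set t : R | 0 < t < u p.1] p.2)%:E))//=; last first.
  rewrite (_ : (fun p => _) = (fun p : GR * GR =>
    (\1_([set p : GR * GR | 0 < p.2] `&` [set p | p.2 < u p.1]) p)%:E))//; last first.
    apply/funext => p; congr (_%:E); rewrite !indicE; congr (_%:R); congr nat_of_bool.
    apply/idP/idP; rewrite !inE /=. by move/andP.
    by case=> -> ->.
  apply/measurable_EFinP/measurable_indic/measurableI.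
    by apply: (@measurable_superlevel _ (GR * GR)%type (fun p => p.2) 0); exact: measurable_snd.
  exact: measurable_subgraph.
rewrite [RHS]integral_mkcond; apply: eq_integral => t _.
rewrite patchE; case: ifPn => [|]; rewrite ?inE /= => t0.
  under eq_integral => x _.
    rewrite (_ : \1_[set t | 0 < t < u x] t = \1_[set x | t < u x] x); last first.
      rewrite !indicE; congr (_%:R); congr nat_of_bool.
      by apply/idP/idP; rewrite !inE /= t0.
    over.
  by rewrite integral_indic ?setIT//; exact: measurable_superlevel.
apply: integral0_eq => x _; rewrite indicE memNset//= => /andP[t1].
by move: t0; rewrite notin_setE/= t1.
Qed.

(** The function of t is the measure of the horizontal sections of the subgraph, so its
    measurability is part of Tonelli's theorem. *)
Lemma measurable_distribution (u : R -> R) (D : set R) : measurable D ->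
  measurable_fun setT u -> measurable_fun D (fun t => leb [set x | (t < u x)%R]).
Proof.
move=> mD mu; apply: measurable_funTS.
rewrite (_ : (fun t => _) = fubini_G leb
    (fun p : GR * GR => (\1_[set p : GR * GR | p.2 < u p.1] p)%:E)).
  apply: measurable_fun_fubini_tonelli_G => //.
  by apply/measurable_EFinP; apply: measurable_indic; exact: measurable_subgraph.
apply/funext => t; rewrite /fubini_G.
under eq_integral do rewrite indicE.
have mt := measurable_superlevel t mu.
rewrite -[in LHS](setIT [set x | t < u x]) -(integral_indic leb measurableT mt).
by apply: eq_integral => x _; rewrite indicE; congr (_%:R%:E); congr nat_of_bool;
  apply/idP/idP; rewrite !inE.
Qed.

(** Both suprema are 1, so at every level t < 1 the superlevel sets of f and g are nonempty and
    Brunn-Minkowski applies: f x > t and g y > t force h > t at the midpoint. Levels t >= 1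
    contribute nothing. Integration over t gives an inequality between sums. *)
Lemma prekopa_leindler_sup1 (f g h : R -> R) :
  measurable_fun setT f -> measurable_fun setT g -> measurable_fun setT h ->
  (forall x, 0 <= f x <= 1) -> (forall x, 0 <= g x <= 1) -> (forall x, 0 <= h x) ->
  (forall t, t < 1 -> exists x, t < f x) -> (forall t, t < 1 -> exists x, t < g x) ->
  (forall t, 0 < t -> has_ubound [set x | t < f x]) ->
  (forall t, 0 < t -> has_lbound [set x | t < g x]) ->
  (forall x y, f x * g y <= h ((x + y) / 2) ^+ 2) ->
  (\int[leb]_x (f x)%:E + \int[leb]_x (g x)%:E <= 2%:E * \int[leb]_x (h x)%:E)%E.
Proof.
move=> mf mg mh f01 g01 h0 supf supg bf bg fgh.
rewrite !layer_cake//; [|by move=> x; case/andP: (g01 x)|by move=> x; case/andP: (f01 x)].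
have mD : measurable [set t : R | 0 < t] by exact: (measurable_superlevel 0 (@measurable_id _ R setT)).
rewrite -ge0_integralD//; [|exact: measurable_distribution..].
rewrite -ge0_integralZl//; last exact: measurable_distribution.
apply: ge0_le_integral => //.
- by move=> t _; apply: adde_ge0.
- by apply: emeasurable_funD; exact: measurable_distribution.
- by apply: measurable_funeM; exact: measurable_distribution.
move=> t /= t0; have [t1|t1] := ltP t 1; last first.
  rewrite (_ : [set x | t < f x] = set0); last first.
    by apply/seteqP; split => x //=; case/andP: (f01 x); lra.
  rewrite (_ : [set x | t < g x] = set0); last first.
    by apply/seteqP; split => x //=; case/andP: (g01 x); lra.
  by rewrite measure0 adde0 mule_ge0.
apply: brunn_minkowski1; try exact: measurable_superlevel.
- by have [x xP] := supf _ t1; exists x.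
- by have [x xP] := supg _ t1; exists x.
- exact: bf.
- exact: bg.
move=> x y /= fx gy; rewrite ltNge; apply/negP => hle.
have := fgh x y; apply/negP; rewrite -ltNge.
apply: (@le_lt_trans _ _ (t ^+ 2)); first by rewrite lerXn2r ?nnegrE ?h0//; exact: ltW.
rewrite expr2 ltr_pM//; exact: ltW.
Qed.

End prekopa_leindler.

Section gaussian_prekopa_leindler.
Context (R : realType).
Local Notation leb := (@lebesgue_measure R).
Local Notation p := (normal_pdf (0 : R) 1).
Local Notation gauss := (normal_prob (0 : R) 1).

Let pE (x : R) : p x = normal_peak 1 * expR (- x ^+ 2 / 2).
Proof. by rewrite normal_pdfE ?oner_neq0// /normal_fun subr0 expr1n. Qed.

Let p_midpoint (x y : R) : p x * p y <= p ((x + y) / 2) ^+ 2.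
Proof.
rewrite !pE exprMn mulrACA -expr2 ler_wpM2l ?sqr_ge0// -expRD -expRM_natl.
by rewrite ler_expR; have := sqr_ge0 (x - y); rewrite !expr2 /=; lra.
Qed.

Let p_level_bounded (t : R) : 0 < t -> exists M, forall x, t < p x -> `|x| <= M.
Proof.
move=> t0; have k0 : 0 < normal_peak (1 : R) by rewrite normal_peak_gt0 ?oner_neq0.
(* With q = [normal_peak 1 / t], the bound 1 + x^2 / 2 < q and |x| <= 1 / 2 + x^2 / 2 give |x| <= 1
   + 2 q, without a square root. *)
exists (1 + 2 * (normal_peak 1 / t)) => x; rewrite pE => tx.
have e1 := expR_ge1Dx (x ^+ 2 / 2).
have e2 := expR_gt0 (x ^+ 2 / 2).
have : t * (1 + x ^+ 2 / 2) < normal_peak 1.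
  apply: (@le_lt_trans _ _ (t * expR (x ^+ 2 / 2))); first by rewrite ler_pM2l.
  by move: tx; rewrite mulNr expRN ltr_pdivlMr.
rewrite mulrC -ltr_pdivlMr// => h1.
rewrite leNgt; apply/negP => h2.
have x0 := normr_ge0 x.
move: h1 h2 x0 (divr_gt0 k0 t0); rewrite -(real_normK (num_real x)).
move: `|x| (_ / t) => y q h1 h2 y0 q0.
by move: h1 (sqr_ge0 (y - 1)); rewrite !expr2; lra.
Qed.

(* The Gaussian weight makes the superlevel sets bounded, as needed for the
   one-dimensional Brunn-Minkowski inequality. *)
Section level_normalization.
Variables (f : R -> R).
Hypotheses (mf : measurable_fun setT f) (f01 : forall x, 0 <= f x <= 1).
Let F x := f x * p x.
Let alpha := sup (range F).

Let F_le x : F x <= p x.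
Proof. by rewrite ler_piMl ?normal_pdf_ge0//; case/andP: (f01 x). Qed.

Let F_ge0 x : 0 <= F x.
Proof. by rewrite mulr_ge0 ?normal_pdf_ge0//; case/andP: (f01 x). Qed.

Let supF : has_sup (range F).
Proof.
split; first by exists (F 0); exists 0.
exists (normal_peak 1) => _ [x _ <-]; apply: le_trans (F_le x) _.
by rewrite normal_pdf_ub ?oner_neq0.
Qed.

(** The divisor is the supremum of F, finite because f <= 1 and positive because the integral is; it
    produces the supremum 1 that [prekopa_leindler_sup1] requires. *)
Lemma gaussian_level_normalization : 0 < \int[gauss]_x f x ->
  exists2 a, 0 < a &
  [/\ forall x, 0 <= F x / a <= 1,
      forall t, t < 1 -> exists x, t < F x / a,
      forall t, 0 < t -> has_ubound [set x | t < F x / a] &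
      forall t, 0 < t -> has_lbound [set x | t < F x / a] ].
Proof.
have i0 := oner_neq0 R; move=> f0.
have a0 : 0 < alpha.
  rewrite ltNge; apply/negP => ale; move: f0.
  rewrite normal_Rintegral//; rewrite (_ : (fun x => _) = cst 0).
    by rewrite Rintegral_cst// mul0r ltxx.
  apply/funext => x; apply/eqP; rewrite eq_le F_ge0 andbT.
  by apply: le_trans ale; apply: sup_ubound; [case: supF|exists x].
have bnd t : 0 < t -> exists M, forall x, t < F x / alpha -> `|x| <= M.
  move=> t0; have [M HM] := p_level_bounded (mulr_gt0 t0 a0).
  by exists M => x; rewrite ltr_pdivlMr// => /lt_le_trans => /(_ _ (F_le x)); exact: HM.
exists alpha => //; split.
- move=> x; rewrite divr_ge0 ?(ltW a0)//= ler_pdivrMr// mul1r.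
  by apply: sup_ubound; [case: supF|exists x].
- move=> t t1; have e0 : 0 < alpha * (1 - t) by rewrite mulr_gt0// subr_gt0.
  have [_ [x _ <-] h] := sup_adherent e0 supF.
  exists x; rewrite ltr_pdivlMr//; move: h; rewrite -/alpha; lra.
- by move=> t /bnd[M HM]; exists M => x /= /HM; rewrite ler_norml => /andP[].
- by move=> t /bnd[M HM]; exists (- M) => x /= /HM; rewrite ler_norml => /andP[].
Qed.

End level_normalization.

(** The Gaussian density is itself midpoint log-concave, so it can be absorbed into f, g and h.
    After normalization of the suprema, the inequality between sums becomes one between products by
    the arithmetic-geometric mean inequality. *)
Lemma gaussian_prekopa_leindler (f g h : R -> R) :
  measurable_fun setT f -> measurable_fun setT g -> measurable_fun setT h ->
  (forall x, 0 <= f x <= 1) -> (forall x, 0 <= g x <= 1) ->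
  (forall x, 0 <= h x <= 1) ->
  (forall x y, f x * g y <= h ((x + y) / 2) ^+ 2) ->
  \int[gauss]_x f x * \int[gauss]_x g x <= (\int[gauss]_x h x) ^+ 2.
Proof.
move=> mf mg mh f01 g01 h01 fgh.
have i0 := oner_neq0 R.
have mp : measurable_fun setT p by exact: measurable_normal_pdf.
have I0 (u : R -> R) : (forall x, 0 <= u x <= 1) -> 0 <= \int[gauss]_x u x.
  by move=> u01; apply: Rintegral_ge0 => x _; case/andP: (u01 x).
have [f0|] := ltP 0 (\int[gauss]_x f x); last first.
  move=> f0; have -> : \int[gauss]_x f x = 0 by apply/eqP; rewrite eq_le f0 I0.
  by rewrite mul0r sqr_ge0.
have [g0|] := ltP 0 (\int[gauss]_x g x); last first.
  move=> g0; have -> : \int[gauss]_x g x = 0 by apply/eqP; rewrite eq_le g0 I0.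
  by rewrite mulr0 sqr_ge0.
have [a a0 [F01 Fsup Fu Fl]] := gaussian_level_normalization mf f01 f0.
have [b b0 [G01 Gsup Gu Gl]] := gaussian_level_normalization mg g01 g0.
have iu (u : R -> R) (c : R) : measurable_fun setT u -> (forall x, 0 <= u x <= 1) ->
    (\int[leb]_x (u x * p x / c)%:E)%E = (\int[gauss]_x u x / c)%:E.
  move=> mu u01; rewrite normal_Rintegral//.
  have iup : leb.-integrable setT (EFin \o (fun x => u x * p x)).
    apply: (integrable_normal_weight i0 (K := 1)) => // x.
    case/andP: (u01 x) => u0 u1; rewrite ger0_norm// mul1r (le_trans u1)//.
    by rewrite lerDl sqr_ge0.
  rewrite -RintegralZr// /Rintegral fineK//.
  apply: (integrable_fin_num measurableT).
  rewrite (_ : (fun x => _) = (fun x => (u x * p x)%:E * c^-1%:E)%E)//.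
  exact: integrableZr.
(* Since r^2 = a b, the midpoint condition survives the normalization. *)
set r := Num.sqrt a * Num.sqrt b.
have r0 : 0 < r by rewrite mulr_gt0// sqrtr_gt0.
have := prekopa_leindler_sup1 (f := fun x => f x * p x / a)
  (g := fun x => g x * p x / b) (h := fun x => h x * p x / r) _ _ _ F01 G01 _
  Fsup Gsup Fu Gl.
rewrite !iu// -EFinD -EFinM lee_fin => PL.
have {PL} : \int[gauss]_x f x / a + \int[gauss]_x g x / b <= 2 * (\int[gauss]_x h x / r).
  have mup (u : R -> R) (c : R) : measurable_fun setT u ->
      measurable_fun setT (fun x => u x * p x / c).
    by move=> mu; apply: measurable_funM => //; apply: measurable_funM.
  apply: PL; [exact: mup|exact: mup|exact: mup| |].
  - move=> x; rewrite divr_ge0 ?(ltW r0)// mulr_ge0 ?normal_pdf_ge0//.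
    by case/andP: (h01 x).
  - move=> x y; rewrite !exprMn exprVn /r exprMn !sqr_sqrtr ?(ltW a0) ?(ltW b0)//.
    have -> : f x * p x / a * (g y * p y / b) = f x * g y * (p x * p y) / (a * b).
      by field; rewrite !gt_eqF.
    rewrite ler_pM2r ?invr_gt0 ?mulr_gt0// ler_pM//.
    + by apply: mulr_ge0; [case/andP: (f01 x)|case/andP: (g01 y)].
    + by rewrite mulr_ge0// normal_pdf_ge0.
move: (\int[gauss]_x f x) (\int[gauss]_x g x) (\int[gauss]_x h x) f0 g0 (I0 _ h01).
move=> I J K If Jf K0.
rewrite /r -{1}(sqr_sqrtr (ltW a0)) -{1}(sqr_sqrtr (ltW b0)).
move: (Num.sqrt a) (Num.sqrt b) (sqrtr_gt0 a) (sqrtr_gt0 b).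
rewrite a0 b0 => u v u0 v0 H.
have H1 : I * (v / u) + J * (u / v) <= 2 * K.
  have -> : I * (v / u) + J * (u / v) = (I / u ^+ 2 + J / v ^+ 2) * (u * v).
    by field; rewrite !gt_eqF.
  have -> : 2 * K = 2 * (K / (u * v)) * (u * v) by field; rewrite !gt_eqF.
  by rewrite ler_pM2r// mulr_gt0.
have q0 : 0 < v / u by rewrite divr_gt0.
have q1 : 0 < u / v by rewrite divr_gt0.
have qE : (v / u) * (u / v) = 1 by field; rewrite !gt_eqF.
have H2 : (I * (v / u) + J * (u / v)) ^+ 2 <= (2 * K) ^+ 2.
  have S0 : 0 <= I * (v / u) + J * (u / v).
    by apply: addr_ge0; apply: mulr_ge0; exact: ltW.
  by rewrite lerXn2r// nnegrE// mulr_ge0.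
(* The arithmetic-geometric mean inequality; the weights v / u and u / v have product 1. *)
have H3 : 4 * (I * J) * ((v / u) * (u / v)) <= (I * (v / u) + J * (u / v)) ^+ 2.
  by have := sqr_ge0 (I * (v / u) - J * (u / v)); rewrite !expr2; lra.
by move: H2 H3; rewrite qE !expr2; lra.
Qed.

End gaussian_prekopa_leindler.

(** * Test functions generated by trigonometric polynomials *)

Section trigonometric_limits.
Context (R : realType) (I : finType).
Implicit Types (x c a : I -> R) (phi psi : (I -> R) -> R).

Definition dot c x : R := \sum_i c i * x i.

Lemma dotDr c x y : dot c (fun i => x i + y i) = dot c x + dot c y.
Proof. by rewrite /dot -big_split; apply: eq_bigr => i _; rewrite mulrDr. Qed.

Lemma dotDl c d x : dot (fun i => c i + d i) x = dot c x + dot d x.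
Proof. by rewrite /dot -big_split; apply: eq_bigr => i _; rewrite mulrDl. Qed.

Lemma dotZr c k x : dot c (fun i => k * x i) = k * dot c x.
Proof. by rewrite /dot mulr_sumr; apply: eq_bigr => i _; rewrite mulrCA. Qed.

Lemma dotZl c k x : dot (fun i => k * c i) x = k * dot c x.
Proof. by rewrite /dot mulr_sumr; apply: eq_bigr => i _; rewrite mulrA. Qed.

Lemma dot0 x : dot (fun=> 0) x = 0.
Proof. by rewrite /dot big1// => i _; rewrite mul0r. Qed.

Lemma dot_delta j x : dot (fun i => (i == j)%:R) x = x j.
Proof.
rewrite /dot (bigD1 j)//= eqxx mul1r big1 ?addr0// => i /negbTE ->.
by rewrite mul0r.
Qed.

(* A functional that is linear and continuous for bounded pointwise convergence
   is determined on this class by its characteristic function. *)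
Inductive trigl : ((I -> R) -> R) -> Prop :=
| trigl_cos c b : trigl (fun x => cos (dot c x + b))
| trigl_lin k phi psi : trigl phi -> trigl psi ->
    trigl (fun x => k * phi x + psi x)
| trigl_lim (phi_ : nat -> (I -> R) -> R) phi M : (forall n, trigl (phi_ n)) ->
    (forall n x, `|phi_ n x| <= M) ->
    (forall x, phi_ n x @[n --> \oo] --> phi x) -> trigl phi.

Lemma eq_trigl phi psi : phi =1 psi -> trigl phi -> trigl psi.
Proof. by move=> /funext ->. Qed.

Lemma trigl_cst k : trigl (fun=> k).
Proof.
apply: (@eq_trigl (fun x => k * cos (dot (fun=> 0) x + 0) +
  cos (dot (fun=> 0) x + pi / 2))).
  by move=> x; rewrite dot0 addr0 add0r cos0 cos_pihalf mulr1 addr0.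
by apply: trigl_lin; exact: trigl_cos.
Qed.

Lemma trigl_sin c b : trigl (fun x => sin (dot c x + b)).
Proof.
apply: (@eq_trigl (fun x => cos (dot c x + (b - pi / 2)))); last exact: trigl_cos.
by move=> x; rewrite addrA cosB cos_pihalf sin_pihalf mulr0 mulr1 add0r.
Qed.

Lemma triglZ k phi : trigl phi -> trigl (fun x => k * phi x).
Proof.
move=> tphi; apply: (@eq_trigl (fun x => k * phi x + 0)).
  by move=> x; rewrite addr0.
by apply: trigl_lin => //; exact: trigl_cst.
Qed.

Lemma triglD phi psi : trigl phi -> trigl psi -> trigl (fun x => phi x + psi x).
Proof.
move=> tphi tpsi; apply: (@eq_trigl (fun x => 1 * phi x + psi x)).
  by move=> x; rewrite mul1r.
exact: trigl_lin.
Qed.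

Lemma trigl_bounded phi : trigl phi -> exists M, forall x, `|phi x| <= M.
Proof.
elim=> [c b|k p q _ [M HM] _ [N HN]|p_ p M _ _ bM cv].
- by exists 1 => x; rewrite ler_norml cos_geN1 cos_le1.
- exists (`|k| * M + N) => x; apply: le_trans (ler_normD _ _) _.
  by rewrite lerD// normrM ler_wpM2l.
- exists M => x; have /(cvg_norm) c1 := cv x.
  by apply: (cvgr_to_le c1); exact: nearW.
Qed.

Lemma trigl_measurable d (T : measurableType d) (X : T -> I -> R) phi :
  trigl phi -> (forall i, measurable_fun setT (fun w => X w i)) ->
  measurable_fun setT (fun w => phi (X w)).
Proof.
move=> + mX; elim=> [c b|k p q _ mp _ mq|p_ p M _ mp _ cv].
- apply: measurableT_comp; first by apply: continuous_measurable_fun; exact: continuous_cos.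
  apply: measurable_funD => //; rewrite /dot.
  by apply: measurable_sum => i; exact: measurable_funM.
- by apply: measurable_funD => //; exact: measurable_funM.
- apply: (measurable_fun_cvg (h := fun n w => p_ n (X w))) => // w _; exact: cv.
Qed.

(** The base case is the product-to-sum formula. The bound carried by [trigl_lim] is what allows a
    limit to be multiplied by another bounded function. *)
Lemma triglM phi psi : trigl phi -> trigl psi -> trigl (fun x => phi x * psi x).
Proof.
move=> tphi tpsi; elim: tphi => [c b|k p q _ tp _ tq|p_ p M _ tp bM cv].
- elim: tpsi => [d e|k p q _ tp _ tq|p_ p M _ tp bM cv].
  + apply: (@eq_trigl (fun x => 2^-1 * cos (dot (fun i => c i + d i) x + (b + e)) +
      2^-1 * cos (dot (fun i => c i + (- 1) * d i) x + (b - e)))).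
      move=> x; rewrite !dotDl dotZl mulN1r.
      have -> : dot c x + dot d x + (b + e) = (dot c x + b) + (dot d x + e) by ring.
      have -> : dot c x - dot d x + (b - e) = (dot c x + b) - (dot d x + e) by ring.
      by rewrite cosD cosB; field.
    by apply: triglD; apply: triglZ; exact: trigl_cos.
  + apply: (@eq_trigl (fun x => k * (cos (dot c x + b) * p x) +
      cos (dot c x + b) * q x)); first by move=> x; ring.
    exact: trigl_lin.
  + apply: (@trigl_lim (fun n x => cos (dot c x + b) * p_ n x) _ M) => //.
      move=> n x; rewrite normrM -[M]mul1r ler_pM//.
      by rewrite ler_norml cos_geN1 cos_le1.
    by move=> x; apply: cvgMr; exact: cv.
- apply: (@eq_trigl (fun x => k * (p x * psi x) + q x * psi x)).
    by move=> x; ring.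
  exact: trigl_lin.
- have [N HN] := trigl_bounded tpsi.
  apply: (@trigl_lim (fun n x => p_ n x * psi x) _ (M * N)) => //.
    by move=> n x; rewrite normrM ler_pM.
  by move=> x; apply: cvgMl; exact: cv.
Qed.

Lemma trigl_prod (J : Type) (s : seq J) (F : J -> (I -> R) -> R) :
  (forall j, trigl (F j)) -> trigl (fun x => \prod_(j <- s) F j x).
Proof.
move=> tF; elim: s => [|j s IH].
  by apply: (eq_trigl _ (trigl_cst 1)) => x; rewrite big_nil.
by apply: (eq_trigl _ (triglM (tF j) IH)) => x; rewrite big_cons.
Qed.

End trigonometric_limits.

(** * Indicators of half-spaces and orthants as test functions *)

Section sign.
Context (R : realType).

(* The iterates of this polynomial converge to the sign on [-1, 1]; applied to a
   sine, they make indicators of half-spaces limits of trigonometric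
   polynomials. *)
Definition sgn_step (t : R) : R := (3 * t - t ^+ 3) / 2.

Lemma sgn_stepN t : sgn_step (- t) = - sgn_step t.
Proof. by rewrite /sgn_step; field. Qed.

Lemma sgn_step_itv t : 0 <= t <= 1 -> t <= sgn_step t <= 1.
Proof.
case/andP=> t0 t1; apply/andP; split; rewrite -subr_ge0.
  have -> : sgn_step t - t = t * (1 - t) * (1 + t) / 2 by rewrite /sgn_step; field.
  by rewrite !mulr_ge0//; lra.
have -> : 1 - sgn_step t = (1 - t) ^+ 2 * (2 + t) / 2 by rewrite /sgn_step; field.
by rewrite !mulr_ge0 ?sqr_ge0//; lra.
Qed.

Lemma iter_sgn_stepN n t : iter n sgn_step (- t) = - iter n sgn_step t.
Proof. by elim: n => //= n ->; rewrite sgn_stepN. Qed.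

Lemma iter_sgn_step_itv n t : 0 <= t <= 1 -> t <= iter n sgn_step t <= 1.
Proof.
move=> t01; elim: n => [|n /andP[IH1 IH2]] /=; first by rewrite lexx; case/andP: t01.
case/andP: t01 => t0 _.
have /sgn_step_itv/andP[h1 h2] : 0 <= iter n sgn_step t <= 1.
  by rewrite IH2 (le_trans t0 IH1).
by rewrite h2 (le_trans IH1 h1).
Qed.

Lemma iter_sgn_step_norm n t : `|t| <= 1 -> `|iter n sgn_step t| <= 1.
Proof.
wlog t0 : t / 0 <= t => [H|] t1.
  have [/H->//|/ltW t0] := leP 0 t.
  by rewrite -[t]opprK iter_sgn_stepN normrN; apply: H; rewrite ?oppr_ge0 ?normrN.
move: t1; rewrite ger0_norm// => t1.
have /andP[h1 h2] : t <= iter n sgn_step t <= 1 by apply: iter_sgn_step_itv; rewrite t0.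
by rewrite ger0_norm// (le_trans t0).
Qed.

Lemma iter_sgn_step_cvg (t : R) : `|t| <= 1 ->
  iter n sgn_step t @[n --> \oo] --> Num.sg t.
Proof.
wlog t0 : t / 0 <= t => [H|] t1.
  have [t0|/ltW t0] := leP 0 t; first exact: H.
  rewrite -[t]opprK sgrN; under eq_fun do rewrite iter_sgn_stepN.
  by apply: cvgN; apply: H; rewrite ?oppr_ge0 ?normrN.
move: t1; rewrite ger0_norm// => t1.
have [->|tn0] := eqVneq t 0.
  rewrite sgr0 (_ : (fun n => _) = cst 0); first exact: cvg_cst.
  by apply/funext; elim => //= n ->; rewrite /sgn_step expr0n mulr0 subr0 mul0r.
have {}t0 : 0 < t by rewrite lt_neqAle eq_sym tn0.
rewrite gtr0_sg//.
(* The iterates v stay above t, and the gap 1 - v is multiplied by (1 - v) (2 + v) / 2 <= 1 - t / 2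
   at each step. *)
have key n : 0 <= 1 - iter n sgn_step t <= (1 - t / 2) ^+ n.
  elim: n => [|n /andP[IH1 IH2]] /=; first by rewrite expr0; lra.
  have /andP[h1 h2] : t <= iter n sgn_step t <= 1.
    by apply: iter_sgn_step_itv; rewrite (ltW t0).
  move: (iter n sgn_step t) h1 h2 IH1 IH2 => v h1 h2 IH1 IH2.
  have -> : 1 - sgn_step v = (1 - v) * ((1 - v) * (2 + v) / 2).
    by rewrite /sgn_step; field.
  have w0 : 0 <= (1 - v) * (2 + v) / 2 by rewrite !mulr_ge0//; lra.
  rewrite mulr_ge0//= exprSr; apply: ler_pM => //.
  by nra.
apply/subr_cvg0; rewrite -[X in _ --> X]oppr0.
under eq_fun do rewrite -opprB.
apply: cvgN; apply: (squeeze_cvg0 key); apply: cvg_expr.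
by rewrite ger0_norm; lra.
Qed.

End sign.

Section orthant.
Context (R : realType) (I : finType).
Implicit Types (x c a u : I -> R) (phi psi : (I -> R) -> R).

Lemma trigl_iter_sgn_step n phi : trigl phi -> trigl (fun x => iter n (@sgn_step R) (phi x)).
Proof.
move=> tphi; elim: n => //= n IH; rewrite /sgn_step.
apply: (@eq_trigl _ _ (fun x => 3 / 2 * iter n (@sgn_step R) (phi x) +
  - 2^-1 * (iter n (@sgn_step R) (phi x) *
    (iter n (@sgn_step R) (phi x) * iter n (@sgn_step R) (phi x))))).
  by move=> x; rewrite /sgn_step; field.
by apply: triglD; apply: triglZ => //; apply: triglM => //; apply: triglM.
Qed.

Lemma trigl_sg_sin c b : trigl (fun x => Num.sg (sin (dot c x + b))).
Proof.
have sin1 (y : R) : `|sin y| <= 1 by rewrite ler_norml sin_geN1 sin_le1.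
apply: (@trigl_lim _ _ (fun n x => iter n (@sgn_step R) (sin (dot c x + b))) _ 1).
- by move=> n; apply: trigl_iter_sgn_step; exact: trigl_sin.
- by move=> n x; exact: iter_sgn_step_norm.
- by move=> x; exact: iter_sgn_step_cvg.
Qed.

Lemma sg_sin_near0 (y : R) : `|y| < pi -> Num.sg (sin y) = Num.sg y.
Proof.
wlog y0 : y / 0 <= y => [H|] yp.
  have [y0|/ltW y0] := leP 0 y; first exact: H.
  by rewrite -[y]opprK sinN sgrN [in RHS]sgrN H ?oppr_ge0 ?normrN.
have [->|yn0] := eqVneq y 0; first by rewrite sin0.
have {}y0 : 0 < y by rewrite lt_neqAle eq_sym yn0.
rewrite !gtr0_sg//; apply: sin_gt0_pi => //; rewrite ?y0 /=.
by move: yp; rewrite gtr0_norm.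
Qed.

(** The factor 1 / (n + 1) eventually brings x j - b into the interval between - pi and pi, where
    the sine has the sign of its argument. *)
Lemma trigl_halfspace (j : I) (b : R) : trigl (fun x => (b <= x j)%R%:R).
Proof.
have tsg : trigl (fun x => Num.sg (x j - b)).
  apply: (@trigl_lim _ _ (fun n x =>
    Num.sg (sin (dot (fun i => n.+1%:R^-1 * (i == j)%:R) x + - (n.+1%:R^-1 * b)))) _ 1).
  - by move=> n; exact: trigl_sg_sin.
  - by move=> n x; rewrite normr_sg; case: (_ != _).
  - move=> x; apply: cvg_near_cst; near=> n.
    rewrite dotZl dot_delta -mulrBr sg_sin_near0.
      by rewrite sgrM gtr0_sg ?mul1r// invr_gt0.
    rewrite normrM gtr0_norm ?invr_gt0// mulrC ltr_pdivrMr//.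
    apply: (@lt_le_trans _ _ n.+1%:R).
      apply: lt_le_trans (truncnS_gt _) _; rewrite ler_nat ltnS.
      by near: n; exists (Num.truncn `|x j - b|).
    by rewrite ler_peMl//; have := pi_ge2 R; lra.
(* The indicator of y >= 0 is 1 + (sg y - sg y^2) / 2, with the right value 1 at y = 0. *)
apply: (@eq_trigl _ _ (fun x => 1 + 2^-1 * (Num.sg (x j - b) +
    (- 1) * (Num.sg (x j - b) * Num.sg (x j - b))))).
  move=> x; rewrite -subr_ge0; move: (x j - b) => y.
  have [y0|y0|->] := ltrgt0P y; last by rewrite sgr0/=; lra.
  - by rewrite gtr0_sg//=; lra.
  - by rewrite ltr0_sg//=; lra.
apply: triglD; first exact: trigl_cst.
by apply/triglZ/triglD => //; apply/triglZ/triglM.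
Unshelve. all: by end_near. Qed.

Definition orthant u x : R := [forall i, u i <= x i]%R%:R.

Lemma orthant_itv u x : 0 <= orthant u x <= 1.
Proof. by rewrite /orthant; case: [forall _, _]; rewrite lexx ler01. Qed.

Lemma trigl_orthant u : trigl (orthant u).
Proof.
apply: (@eq_trigl _ _ (fun x => \prod_(i <- enum I) (u i <= x i)%R%:R)).
  move=> x; rewrite /orthant big_enum/=; case: (boolP [forall i, u i <= x i]) => [/forallP h|/forallPn[i hi]].
    by rewrite big1// => i _; rewrite h.
  by rewrite (bigD1 i)//= (negbTE hi) mul0r.
by apply: trigl_prod => i; exact: trigl_halfspace.
Qed.

End orthant.

(** * Gaussian expectations *)

Section law_functionals.
Context (R : realType) (I : finType).
Implicit Types (x c a u : I -> R) (phi psi : (I -> R) -> R).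
Local Notation gauss := (normal_prob (0 : R) 1).

(** Stands for integration against a law on R^I, seen only through the test functions [trigl]. *)
Definition law_functional (L : ((I -> R) -> R) -> R) :=
  (forall k phi psi, trigl phi -> trigl psi ->
     L (fun x => k * phi x + psi x) = k * L phi + L psi) /\
  (forall (phi_ : nat -> (I -> R) -> R) phi M, (forall n, trigl (phi_ n)) ->
     (forall n x, `|phi_ n x| <= M) ->
     (forall x, phi_ n x @[n --> \oo] --> phi x) ->
     L (phi_ n) @[n --> \oo] --> L phi).

(** Plays the part of the uniqueness theorem for characteristic functions, by induction on the
    construction of phi. *)
Lemma law_functional_unique L L' phi :
  law_functional L -> law_functional L' ->
  (forall c b, L (fun x => cos (dot c x + b)) = L' (fun x => cos (dot c x + b))) ->
  trigl phi -> L phi = L' phi.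
Proof.
move=> [lL cL] [lL' cL'] LL'; elim=> [c b|k p q tp Lp tq Lq|p_ p M tp Lp bM cv].
- exact: LL'.
- by rewrite lL// lL'// Lp Lq.
- have c1 := cL _ _ _ tp bM cv; have c2 := cL' _ _ _ tp bM cv.
  have E : (fun n => L (p_ n)) = (fun n => L' (p_ n)) by apply/funext => n; exact: Lp.
  by move: c1; rewrite /= E => c1; exact: (cvg_unique _ c1 c2).
Qed.

Lemma trigl_integrable d (T : measurableType d) (P : probability T R)
    (X : T -> I -> R) phi :
  (forall i, measurable_fun setT (fun w => X w i)) -> trigl phi ->
  P.-integrable setT (EFin \o (fun w => phi (X w))).
Proof.
move=> mX tphi; have [M HM] := trigl_bounded tphi.
apply: (integrable_le_bound (M := M)) => //.
  exact: probability_lty.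
exact: trigl_measurable.
Qed.

Lemma random_vector_law_functional d (T : measurableType d) (P : probability T R)
    (X : T -> I -> R) : (forall i, measurable_fun setT (fun w => X w i)) ->
  law_functional (fun phi => \int[P]_w phi (X w)).
Proof.
move=> mX; split=> [k p q tp tq|p_ p M tp bM cv].
  have ip := trigl_integrable P mX tp; have iq := trigl_integrable P mX tq.
  rewrite RintegralD//; last exact: (trigl_integrable P mX (triglZ k tp)).
  by rewrite RintegralZl.
apply: (@bounded_Rintegral_cvg _ _ _ P (fun n w => p_ n (X w)) (fun w => p (X w)) M).
- exact: probability_lty.
- by move=> n; exact: trigl_measurable.
- by move=> w; exact: cv.
- by move=> n w; exact: bM.
Qed.

(** Convolution with the law of Z a, for Z standard normal; this law is carried by the line spanned
    by a. *)
Definition smooth a phi x := \int[gauss]_z phi (fun i => x i + z * a i).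

Lemma measurable_line x a i : measurable_fun [set: measurableTypeR R] (fun z : R => x i + z * a i).
Proof. by apply: measurable_funD => //; exact: measurable_funM. Qed.

Lemma smooth_integrable a phi x : trigl phi ->
  gauss.-integrable setT (EFin \o (fun z : R => phi (fun i => x i + z * a i))).
Proof. by move=> tphi; apply: trigl_integrable => // i; exact: measurable_line. Qed.

Lemma smooth_functional a x : law_functional (fun phi => smooth a phi x).
Proof. by apply: random_vector_law_functional => i; exact: measurable_line. Qed.

Lemma smooth_cos a c b x :
  smooth a (fun x => cos (dot c x + b)) x =
  expR (- (dot c a) ^+ 2 / 2) * cos (dot c x + b).
Proof.
have := normal_cos 0 (oner_neq0 R) (dot c a) (dot c x + b); rewrite mulr1 => <-.
apply: eq_Rintegral => z _; rewrite dotDr dotZr subr0; congr cos; ring.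
Qed.

Lemma smooth_bound a phi M x : (forall y, `|phi y| <= M) -> trigl phi ->
  `|smooth a phi x| <= M.
Proof.
move=> bM tphi; have iphi := smooth_integrable a x tphi.
apply: (le_trans (le_normr_Rintegral measurableT iphi)).
have -> : M = \int[gauss]_z M.
  by rewrite Rintegral_probability_cst.
apply: le_Rintegral => //.
- exact: integrable_norm.
- by apply: (integrable_le_bound (M := `|M|)) => //; exact: probability_lty.
Qed.

(** Cosines are eigenfunctions of [smooth a], and [smooth a] commutes with linear combinations and
    bounded limits. *)
Lemma trigl_smooth a phi : trigl phi -> trigl (smooth a phi).
Proof.
elim=> [c b|k p q tp Lp tq Lq|p_ p M tp Lp bM cv].
- rewrite (_ : smooth _ _ = fun x => expR (- (dot c a) ^+ 2 / 2) * cos (dot c x + b)).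
    by apply: triglZ; exact: trigl_cos.
  by apply/funext => x; exact: smooth_cos.
- rewrite (_ : smooth _ _ = fun x => k * smooth a p x + smooth a q x).
    exact: trigl_lin.
  by apply/funext => x; have [-> //] := smooth_functional a x.
- apply: (@trigl_lim _ _ (fun n => smooth a (p_ n)) _ M) => //.
    by move=> n x; exact: smooth_bound.
  by move=> x; have [_] := smooth_functional a x; apply; eassumption.
Qed.

Lemma smooth_le a phi psi x : trigl phi -> trigl psi ->
  (forall y, phi y <= psi y) -> smooth a phi x <= smooth a psi x.
Proof.
move=> tphi tpsi le; apply: le_Rintegral => //; exact: smooth_integrable.
Qed.

(* [gexp V phi x] is the expectation of [phi (x + \sum_(a <- V) Z_a * a)] for
   independent standard normal variables [Z_a]. *)
Definition gexp (V : seq (I -> R)) phi := foldr smooth phi V.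

(** The covariance form of the Gaussian vector that [gexp V] integrates: the variance of its pairing
    with c. *)
Definition gform (V : seq (I -> R)) c := \sum_(a <- V) dot c a ^+ 2.

Lemma gexp_cat V W phi : gexp (V ++ W) phi = gexp V (gexp W phi).
Proof. by rewrite /gexp foldr_cat. Qed.

Lemma gform_cat V W c : gform (V ++ W) c = gform V c + gform W c.
Proof. by rewrite /gform big_cat. Qed.

Lemma trigl_gexp V phi : trigl phi -> trigl (gexp V phi).
Proof. by move=> tphi; elim: V => //= a V; exact: trigl_smooth. Qed.

Lemma gexp_functional V x : law_functional (fun phi => gexp V phi x).
Proof.
elim: V x => [|a V IH] x /=; first by split => // p_ p M _ _; exact.
split=> [k p q tp tq|p_ p M tp bM cv].
  rewrite (_ : gexp V _ = fun y => k * gexp V p y + gexp V q y); last first.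
    by apply/funext => y; have [-> //] := IH y.
  by have [-> //] := smooth_functional a x; exact: trigl_gexp.
have [_] := smooth_functional a x; apply.
- by move=> n; exact: trigl_gexp.
- move=> n y; have : forall y, `|gexp V (p_ n) y| <= M; last exact.
  elim: {IH} V => //= b V IH {}y; apply: smooth_bound => //; exact: trigl_gexp.
- by move=> y; have [_] := IH y; apply; eassumption.
Qed.

Lemma gexp_cos V c b x : gexp V (fun x => cos (dot c x + b)) x =
  expR (- gform V c / 2) * cos (dot c x + b).
Proof.
elim: V x => [|a V IH] x /=.
  by rewrite /gform big_nil oppr0 mul0r expR0 mul1r.
rewrite (_ : gexp V _ = fun x => expR (- gform V c / 2) * cos (dot c x + b)); last first.
  exact/funext.
have [+ _] := smooth_functional a x.
move=> /(_ (expR (- gform V c / 2)) _ (fun=> 0) (trigl_cos c b) (trigl_cst _ 0)).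
rewrite smooth_cos (_ : (fun x => _ + 0) =
  fun x => expR (- gform V c / 2) * cos (dot c x + b)); last first.
  by apply/funext => y; rewrite addr0.
move=> ->; rewrite /smooth Rintegral_cst// mul0r addr0 mulrA -expRD.
by congr (expR _ * _); rewrite /gform big_cons; field.
Qed.

Lemma gexp_cst V k x : gexp V (fun=> k) x = k.
Proof.
have := gexp_cos V (fun=> 0) 0 x.
rewrite dot0 addr0 cos0 mulr1 /gform big1 => [|a _]; last by rewrite dot0 expr0n.
rewrite oppr0 mul0r expR0 (_ : (fun x => _) = fun=> 1) => [h|]; last first.
  by apply/funext => y; rewrite dot0 addr0 cos0.
have [+ _] := gexp_functional V x.
move=> /(_ (k - 1) _ _ (trigl_cst _ 1) (trigl_cst _ 1)).
by rewrite h mulr1 subrK.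
Qed.

Lemma gexpD V phi psi x : trigl phi -> trigl psi ->
  gexp V (fun x => phi x + psi x) x = gexp V phi x + gexp V psi x.
Proof.
move=> tp tq; have [+ _] := gexp_functional V x.
move=> /(_ 1 _ _ tp tq); rewrite mul1r => <-; congr (gexp V _ x).
by apply/funext => y; rewrite mul1r.
Qed.

Lemma gexp_sum V (J : Type) (s : seq J) (F : J -> (I -> R) -> R) x :
  (forall j, trigl (F j)) ->
  gexp V (fun x => \sum_(j <- s) F j x) x = \sum_(j <- s) gexp V (F j) x.
Proof.
move=> tF; have ts s' : trigl (fun x => \sum_(j <- s') F j x).
  elim: s' => [|j s' IH].
    by apply: (eq_trigl _ (trigl_cst _ 0)) => y; rewrite big_nil.
  by apply: (eq_trigl _ (triglD (tF j) IH)) => y; rewrite big_cons.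
elim: s => [|j s IH].
  rewrite big_nil -[RHS](gexp_cst V 0 x); congr (gexp V _ x).
  by apply/funext => y; rewrite big_nil.
rewrite big_cons -IH -gexpD//; congr (gexp V _ x).
by apply/funext => y; rewrite big_cons.
Qed.

Lemma gexp_le V phi psi x : trigl phi -> trigl psi ->
  (forall y, phi y <= psi y) -> gexp V phi x <= gexp V psi x.
Proof.
move=> tphi tpsi le; elim: V x => //= a V IH x.
by apply: smooth_le => //; exact: trigl_gexp.
Qed.

Lemma gexp_itv V phi x : trigl phi -> (forall y, 0 <= phi y <= 1) ->
  0 <= gexp V phi x <= 1.
Proof.
move=> tphi phi01; apply/andP; split.
  rewrite -[leLHS](gexp_cst V 0 x); apply: gexp_le => // [|y]; first exact: trigl_cst.
  by case/andP: (phi01 y).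
rewrite -[leRHS](gexp_cst V 1 x); apply: gexp_le => // [|y]; first exact: trigl_cst.
by case/andP: (phi01 y).
Qed.

(** By [gexp_cos] the form determines the characteristic function. This allows a list to be
    exchanged for any other with the same covariance. *)
Lemma gexp_unique V W phi : gform V =1 gform W -> trigl phi ->
  gexp V phi =1 gexp W phi.
Proof.
move=> VW tphi x; apply: (@law_functional_unique (fun phi => gexp V phi x)
  (fun phi => gexp W phi x)) => //; [exact: gexp_functional..|].
by move=> c b; rewrite !gexp_cos VW.
Qed.

(** An orthant is convex, which settles the empty list. Each further vector adds one real variable
    z, in which the one-dimensional inequality is applied: the midpoint of x + z a and y + w a is
    that of x and y, moved by (z + w) / 2 along a. *)
Lemma gexp_log_concave V u x y :
  gexp V (orthant u) x * gexp V (orthant u) y <=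
  gexp V (orthant u) (fun i => (x i + y i) / 2) ^+ 2.
Proof.
elim: V x y => [|a V IH] x y /=.
  rewrite /orthant; case: (boolP [forall i, u i <= x i]) => [/forallP ux|_]; last first.
    by rewrite mul0r sqr_ge0.
  case: (boolP [forall i, u i <= y i]) => [/forallP uy|_]; last by rewrite mulr0 sqr_ge0.
  suff -> : [forall i, u i <= (x i + y i) / 2] by rewrite expr1n mulr1.
  by apply/forallP => i; have := ux i; have := uy i; lra.
have mline v : measurable_fun setT (fun z : R => gexp V (orthant u) (fun i => v i + z * a i)).
  apply: (trigl_measurable (X := fun (z : R) i => v i + z * a i)).
    by apply: trigl_gexp; exact: trigl_orthant.
  by move=> i; exact: measurable_line.
have itv v : 0 <= gexp V (orthant u) v <= 1.
  by apply: gexp_itv; [exact: trigl_orthant|exact: orthant_itv].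
apply: (@gaussian_prekopa_leindler R (fun z => gexp V (orthant u) (fun i => x i + z * a i))
  (fun z => gexp V (orthant u) (fun i => y i + z * a i))
  (fun z => gexp V (orthant u) (fun i => (x i + y i) / 2 + z * a i))) => //.
move=> z w; apply: le_trans (IH _ _) _; rewrite le_eqVlt; apply/orP; left; apply/eqP.
by congr (gexp V _ _ ^+ 2); apply/funext => i; field.
Qed.

(** An average of 2^(p+1) points is the midpoint of two averages of 2^p points, and e^2 <= A B <=
    D^2 gives e <= D. *)
Lemma gexp_average V u (e : R) p (y : nat -> I -> R) : 0 <= e ->
  (forall j, (j < 2 ^ p)%N -> e <= gexp V (orthant u) (y j)) ->
  e <= gexp V (orthant u) (fun i => (\sum_(0 <= j < 2 ^ p) y j i) / (2 ^ p)%:R).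
Proof.
move=> e0; elim: p y => [|p IH] y ey.
  rewrite expn0 (_ : (fun i => _) = y 0%N) ?ey//.
  by apply/funext => i; rewrite big_nat1 divr1.
have lt2 j : (j < 2 ^ p -> j < 2 ^ p.+1)%N.
  by move=> jp; rewrite expnS mul2n -addnn ltn_addr.
have h1 := IH y (fun j jp => ey j (lt2 j jp)).
have h2 := IH (fun j => y (2 ^ p + j)%N).
(* The proof term turns [j < 2 ^ p] into [2 ^ p + j < 2 ^ p.+1]. *)
have {}h2 := h2 (fun j jp => ey (2 ^ p + j)%N (etrans (congr1 (leq _)
  (etrans (expnS 2 p) (etrans (mul2n _) (esym (addnn _))))) (etrans (ltn_add2l _ _ _) jp))).
have := gexp_log_concave V u _ _.
move=> /(_ (fun i => (\sum_(0 <= j < 2 ^ p) y j i) / (2 ^ p)%:R)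
  (fun i => (\sum_(0 <= j < 2 ^ p) y (2 ^ p + j)%N i) / (2 ^ p)%:R)).
set A := gexp V (orthant u) _ in h1 *; set B := gexp V (orthant u) _ in h2 *.
rewrite (_ : (fun i => (_ + _) / 2) =
    (fun i => (\sum_(0 <= j < 2 ^ p.+1) y j i) / (2 ^ p.+1)%:R)); last first.
  apply/funext => i; rewrite expnS mul2n -addnn.
  have E2 : \sum_((2 ^ p)%N <= j < (2 ^ p + 2 ^ p)%N) y j i =
      \sum_(0 <= j < (2 ^ p)%N) y (2 ^ p + j)%N i.
    rewrite -{1}[(2 ^ p)%N]add0n big_addn addnK.
    by apply: eq_bigr => j _; rewrite addnC.
  have -> : \sum_(0 <= j < (2 ^ p + 2 ^ p)%N) y j i =
      \sum_(0 <= j < (2 ^ p)%N) y j i + \sum_(0 <= j < (2 ^ p)%N) y (2 ^ p + j)%N i.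
    by rewrite (big_cat_nat (n := (2 ^ p)%N)) ?leq_addr//= E2.
  rewrite natrD.
  have p0 : (2 ^ p)%:R != 0 :> R by rewrite pnatr_eq0 expn_eq0.
  by move: ((2 ^ p)%:R : R) p0 => q p0; field; rewrite -mulr2n mulrn_eq0 p0 .
set D := gexp V (orthant u) _ => ABD.
have /andP[D0 _] : 0 <= D <= 1.
  by apply: gexp_itv; [exact: trigl_orthant|exact: orthant_itv].
rewrite -(@ler_pXn2r _ 2)// ?nnegrE//; apply: le_trans ABD.
by rewrite expr2 ler_pM.
Qed.

End law_functionals.

Section linear_image.
Context (R : realType) (I J : finType) (A : J -> I -> R).
Local Notation img := (fun (x : I -> R) (j : J) => dot (A j) x).

Lemma dot_img c x : dot c (img x) = dot (fun i => \sum_j c j * A j i) x.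
Proof.
rewrite /dot; under eq_bigr do rewrite mulr_sumr.
rewrite exchange_big/=; apply: eq_bigr => i _; rewrite mulr_suml.
by apply: eq_bigr => j _; rewrite mulrA.
Qed.

Lemma trigl_img phi : trigl phi -> trigl (fun x : I -> R => phi (img x)).
Proof.
elim=> [c b|k p q tp Lp tq Lq|p_ p M tp Lp bM cv].
- rewrite (_ : (fun x => _) = (fun x => cos (dot (fun i => \sum_j c j * A j i) x + b))).
    exact: trigl_cos.
  by apply/funext => x; rewrite dot_img.
- exact: trigl_lin.
- by apply: (@trigl_lim _ _ (fun n x => p_ n (img x)) _ M) => // x; exact: cv.
Qed.

(** A linear map sends x + sum Z_a a to the sum of the images with the same coefficients Z_a. *)
Lemma gexp_img V phi x :
  gexp V (fun x => phi (img x)) x = gexp (map (fun x => img x) V) phi (img x).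
Proof.
elim: V x => //= a V IH x; rewrite /smooth; apply: eq_Rintegral => z _.
rewrite IH; congr (gexp _ _ _); apply/funext => j.
by rewrite dotDr dotZr.
Qed.

Lemma gform_img V c :
  gform (map (fun x => img x) V) c = gform V (fun i => \sum_j c j * A j i).
Proof. by rewrite /gform big_map; apply: eq_bigr => a _; rewrite dot_img. Qed.

End linear_image.

(** * Chebyshev bounds and the effect of a small noise *)

Section tails.
Context (R : realType) (I : finType).
Implicit Types (x c a u : I -> R) (V : seq (I -> R)).
Local Notation gauss := (normal_prob (0 : R) 1).
Local Notation delta i := (fun k => (k == i)%:R : R).

(** Chebyshev's inequality for sqrt q times a standard normal variable, whose variance is q. *)
Lemma gauss_chebyshev (p : R -> bool) (r q : R) : 0 <= q ->
  measurable_fun setT (fun z => (p z)%:R : R) ->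
  (forall z, p z -> r <= (z * Num.sqrt q) ^+ 2) -> 0 < r ->
  \int[gauss]_z (p z)%:R <= q / r.
Proof.
move=> q0 mp pr r0; have n0 := oner_neq0 R.
have i2 := normal_integrable_center2 (0 : R) n0.
have v2 := normal_variance (0 : R) n0.
have -> : q / r = \int[gauss]_z (q / r * (z - 0) ^+ 2).
  by rewrite RintegralZl// v2 expr1n mulr1.
apply: le_Rintegral => //.
- apply: (integrable_le_bound (M := 1)) => //; first exact: probability_lty.
  by move=> z; case: (p z); rewrite ?normr1 ?normr0.
- exact: (integrableZl measurableT (q / r) i2).
- move=> z _; rewrite subr0; case: (boolP (p z)) => [/pr h|_]; last first.
    by rewrite /= mulr_ge0 ?sqr_ge0// divr_ge0// ltW.
  by rewrite mulrAC ler_pdivlMr// mul1r (le_trans h)// exprMn sqr_sqrtr// mulrC.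
Qed.

Lemma gform_ge0 V c : 0 <= gform V c.
Proof. by apply: sumr_ge0 => a _; rewrite sqr_ge0. Qed.

(** Coordinate i is a one-dimensional Gaussian of variance [gform V (delta i)], so by [gexp_unique]
    a single vector indexed by [unit] replaces the whole image list. *)
Lemma gexp_coordinate V (i : I) (psi : (unit -> R) -> R) x : trigl psi ->
  gexp V (fun w => psi (fun=> w i)) x =
  \int[gauss]_z psi (fun=> x i + z * Num.sqrt (gform V (delta i))).
Proof.
move=> tpsi; have E (w : I -> R) : (fun _ : unit => w i) = (fun j => dot (delta i) w).
  by apply/funext => j; rewrite dot_delta.
rewrite (_ : (fun w => _) = (fun w => psi (fun j => dot (delta i) w))); last first.
  by apply/funext => w; congr psi; exact: E.
rewrite (gexp_img (fun _ : unit => delta i)).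
rewrite (@gexp_unique _ _ _ [:: (fun _ : unit => Num.sqrt (gform V (delta i)))])//.
  by rewrite /= /smooth; apply: eq_Rintegral => z _; rewrite dot_delta.
move=> c; rewrite gform_img /gform big_seq1.
rewrite /dot (big_pred1 tt)/=; last by case.
rewrite exprMn sqr_sqrtr ?gform_ge0// /gform mulr_sumr; apply: eq_bigr => a _.
rewrite -exprMn; congr (_ ^+ 2); rewrite /dot mulr_sumr; apply: eq_bigr => j _.
by rewrite (big_pred1 tt)/= ?mulrA//; case.
Qed.

Lemma gexp_lower_tail V i (b : R) x : b < x i ->
  gexp V (fun w => 1 - (b <= w i)%R%:R) x <= gform V (delta i) / (x i - b) ^+ 2.
Proof.
move=> bx; have tpsi : trigl (fun w : unit -> R => 1 - (b <= w tt)%R%:R).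
  apply: (@eq_trigl _ _ (fun w => (- 1) * (b <= w tt)%R%:R + 1)).
    by move=> w; rewrite mulN1r addrC.
  by apply: triglD; [apply: triglZ; exact: trigl_halfspace|exact: trigl_cst].
rewrite (gexp_coordinate _ _ _ tpsi).
have E z : 1 - (b <= x i + z * Num.sqrt (gform V (delta i)))%R%:R =
    (~~ (b <= x i + z * Num.sqrt (gform V (delta i)))%R)%:R :> R.
  by case: (_ <= _)%R; rewrite ?subrr ?subr0.
under eq_Rintegral do rewrite E.
apply: gauss_chebyshev; first exact: gform_ge0.
- under [X in measurable_fun _ X]funext do rewrite -E.
  apply: (trigl_measurable (X := fun z (_ : unit) => _) tpsi) => j.
  by apply: measurable_funD => //; exact: measurable_funM.
- move=> z; rewrite -ltNge => h.
  by rewrite -[leRHS]sqrrN lerXn2r ?nnegrE; lra.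
- by rewrite exprn_gt0// subr_gt0.
Qed.

Lemma gexp_upper_tail V i (b : R) x : x i < b ->
  gexp V (fun w => (b <= w i)%R%:R) x <= gform V (delta i) / (b - x i) ^+ 2.
Proof.
move=> bx; have tpsi : trigl (fun w : unit -> R => (b <= w tt)%R%:R).
  exact: trigl_halfspace.
rewrite (gexp_coordinate _ _ _ tpsi).
apply: gauss_chebyshev; first exact: gform_ge0.
- apply: (trigl_measurable (X := fun z (_ : unit) => _) tpsi) => j.
  by apply: measurable_funD => //; exact: measurable_funM.
- by move=> z h; rewrite lerXn2r ?nnegrE; lra.
- by rewrite exprn_gt0// subr_gt0.
Qed.

End tails.

Section comparison.
Context (R : realType) (I : finType).
Implicit Types (x c a u : I -> R) (V W N D : seq (I -> R)).
Local Notation delta i := (fun k => (k == i)%:R : R).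

Lemma gform_sum_ge0 V (e : R) : 0 <= \sum_i gform V (delta i) / e ^+ 2.
Proof. by apply: sumr_ge0 => i _; rewrite divr_ge0 ?gform_ge0 ?sqr_ge0. Qed.

(** If x lies in the orthant at u, leaving the orthant at u - e requires the noise to lower some
    coordinate by more than e: union bound over the coordinates. *)
Lemma orthant_le_noise N u (e : R) x : 0 < e ->
  orthant u x <= gexp N (orthant (fun i => u i - e)) x +
    \sum_i gform N (delta i) / e ^+ 2.
Proof.
move=> e0; have tor := trigl_orthant (fun i => u i - e).
have [G0 _] : 0 <= gexp N (orthant (fun i => u i - e)) x /\ True.
  by split=> //; have /andP[] := gexp_itv N x tor (orthant_itv _).
rewrite {1}/orthant; case: (boolP [forall i, u i <= x i]) => [/forallP ux|_]; last first.
  by rewrite addr_ge0// gform_sum_ge0.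
have tl i : trigl (fun w : I -> R => 1 - (u i - e <= w i)%R%:R).
  apply: (@eq_trigl _ _ (fun w => (- 1) * (u i - e <= w i)%R%:R + 1)).
    by move=> w; rewrite mulN1r addrC.
  by apply: triglD; [apply: triglZ; exact: trigl_halfspace|exact: trigl_cst].
have ts : trigl (fun w : I -> R => \sum_(i <- enum I) (1 - (u i - e <= w i)%R%:R)).
  elim: (enum I) => [|j s IH].
    by apply: (eq_trigl _ (trigl_cst _ 0)) => y; rewrite big_nil.
  by apply: (eq_trigl _ (triglD (tl j) IH)) => y; rewrite big_cons.
apply: (@le_trans _ _ (gexp N (fun w => orthant (fun i => u i - e) w +
    \sum_(i <- enum I) (1 - (u i - e <= w i)%R%:R)) x)).
  rewrite -[leLHS](gexp_cst N 1 x); apply: gexp_le; [exact: trigl_cst|exact: triglD|].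
  move=> w; rewrite big_enum/= /orthant.
  have s0 (P : pred I) : 0 <= \sum_(i | P i) (1 - (u i - e <= w i)%R%:R) :> R.
    by apply: sumr_ge0 => i _; case: (u i - e <= w i)%R; rewrite ?subrr ?subr0.
  case: (boolP [forall i, u i - e <= w i]) => [_|/forallPn[i hi]].
    by rewrite lerDl s0.
  by rewrite (bigD1 i)//= (negbTE hi) subr0 add0r lerDl s0.
rewrite gexpD// lerD2l gexp_sum// big_enum/=; apply: ler_sum => i _.
apply: le_trans (gexp_lower_tail _ _) _.
  by have := ux i; lra.
rewrite ler_wpM2l ?gform_ge0// lef_pV2 ?posrE ?exprn_gt0//; last first.
  by have := ux i; lra.
by rewrite lerXn2r ?nnegrE; have := ux i; lra.
Qed.

(** If some coordinate of x is below u - 2 e, the noise has to lift that single coordinate by more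
    than e. *)
Lemma noise_le_orthant D u (e : R) x : 0 < e ->
  gexp D (orthant (fun i => u i - e)) x <= orthant (fun i => u i - 2 * e) x +
    \sum_i gform D (delta i) / e ^+ 2.
Proof.
move=> e0; have tor := trigl_orthant (fun i => u i - e).
have /andP[_ G1] := gexp_itv D x tor (orthant_itv _).
rewrite [X in _ <= X + _]/orthant.
case: (boolP [forall i, u i - 2 * e <= x i]) => [_|/forallPn[i hi]].
  by rewrite (le_trans G1)// lerDl gform_sum_ge0.
move: hi; rewrite -ltNge => hi; rewrite add0r.
apply: (@le_trans _ _ (gform D (delta i) / e ^+ 2)); last first.
  rewrite [leRHS](bigD1 i)//= lerDl; apply: sumr_ge0 => j _.
  by rewrite divr_ge0 ?gform_ge0 ?sqr_ge0.
apply: (@le_trans _ _ (gexp D (fun w => (u i - e <= w i)%R%:R) x)).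
  apply: gexp_le => //; first exact: trigl_halfspace.
  move=> w; rewrite /orthant; case: (boolP [forall i, _]) => // /forallP/(_ i) h.
  by rewrite h.
apply: le_trans (gexp_upper_tail _ _) _; first lra.
rewrite ler_wpM2l ?gform_ge0// lef_pV2 ?posrE ?exprn_gt0//; last lra.
by rewrite lerXn2r ?nnegrE; lra.
Qed.

(* The equality of the forms says that the vector of V plus the noise N has the
   law of the vector of W plus the noise D. *)
Lemma gexp_orthant_compare V W N D u (e : R) : 0 < e ->
  (forall c, gform V c + gform N c = gform W c + gform D c) ->
  gexp V (orthant u) (fun=> 0) <=
  gexp W (orthant (fun i => u i - 2 * e)) (fun=> 0) +
    \sum_i (gform N (delta i) + gform D (delta i)) / e ^+ 2.
Proof.
move=> e0 VW; have tor v : trigl (orthant v : (I -> R) -> R) by exact: trigl_orthant.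
have -> : \sum_i (gform N (delta i) + gform D (delta i)) / e ^+ 2 =
    \sum_i gform D (delta i) / e ^+ 2 + \sum_i gform N (delta i) / e ^+ 2.
  by rewrite -big_split; apply: eq_bigr => i _ /=; rewrite mulrDl addrC.
set kN := \sum_i gform N _ / _; set kD := \sum_i gform D _ / _.
apply: (@le_trans _ _ (gexp (V ++ N) (orthant (fun i => u i - e)) (fun=> 0) + kN)).
  rewrite gexp_cat -(gexp_cst V kN (fun=> 0)) -gexpD//; last 2 first.
  - exact: trigl_gexp.
  - exact: trigl_cst.
  apply: gexp_le => //; first by apply: triglD; [exact: trigl_gexp|exact: trigl_cst].
  by move=> y; exact: orthant_le_noise.
rewrite (@gexp_unique _ _ _ (W ++ D))//; last by move=> c; rewrite !gform_cat.
rewrite addrA lerD2r gexp_cat -(gexp_cst W kD (fun=> 0)) -gexpD//; last exact: trigl_cst.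
apply: gexp_le; [exact: trigl_gexp|by apply: triglD => //; exact: trigl_cst|].
by move=> y; exact: noise_le_orthant.
Qed.

End comparison.

(** * Gaussian vectors with a prescribed covariance *)

Section positive_semidefinite.
Context (R : realType) (I : finType).
Implicit Types (c a : I -> R) (K : I -> I -> R).
Local Notation delta i := (fun k => (k == i)%:R : R).

Definition qform K c := \sum_i \sum_j c i * c j * K i j.

Lemma qform_shift K c i (t : R) : (forall i j, K i j = K j i) ->
  qform K (fun k => c k + t * (k == i)%:R) =
  qform K c + 2 * t * dot (K i) c + t ^+ 2 * K i i.
Proof.
move=> sK; rewrite /qform.
pose d k : R := (k == i)%:R.
have dsum (F : I -> R) : \sum_k d k * F k = F i.
  rewrite (bigD1 i)//= /d eqxx mul1r big1 ?addr0// => k /negbTE ->.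
  by rewrite mul0r.
transitivity (\sum_k \sum_j c k * c j * K k j +
   t * (\sum_k d k * \sum_j c j * K k j) + t * (\sum_j d j * \sum_k c k * K k j) +
   t ^+ 2 * (\sum_k d k * \sum_j d j * K k j)).
  have -> : \sum_j d j * \sum_k c k * K k j = \sum_k \sum_j d j * (c k * K k j).
    rewrite exchange_big; apply: eq_bigr => j _; rewrite mulr_sumr//.
  rewrite !mulr_sumr -!big_split; apply: eq_bigr => k _ /=.
  rewrite !mulr_sumr -!big_split; apply: eq_bigr => j _ /=.
  rewrite -/(d k) -/(d j); ring.
rewrite !dsum; under [X in _ + t * X + _]eq_bigr do rewrite sK.
have -> : dot (K i) c = \sum_k c k * K i k.
  by apply: eq_bigr => k _; rewrite mulrC.
ring.
Qed.

Lemma qform_delta K i : qform K (delta i) = K i i.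
Proof.
rewrite /qform (bigD1 i)//= [X in _ + X]big1 ?addr0 => [|j /negbTE ->]; last first.
  by rewrite big1// => k _; rewrite !mul0r.
rewrite (bigD1 i)//= big1 ?addr0 => [|j /negbTE ->].
  by rewrite eqxx !mul1r.
by rewrite mulr0 mul0r.
Qed.

(** Cholesky decomposition, by induction on a list s that contains all nonzero rows. A zero diagonal
    entry forces a zero row; otherwise a rank-one form is split off. *)
Lemma psd_gform_support (s : seq I) K : (forall i j, K i j = K j i) ->
  (forall c, 0 <= qform K c) -> (forall i j, i \notin s -> K i j = 0) ->
  exists V, gform V =1 qform K.
Proof.
elim: s K => [|i s IH] K sK pK K0.
  exists [::] => c; rewrite /gform big_nil /qform big1// => i _.
  by rewrite big1// => j _; rewrite K0// mulr0.
have k0 : 0 <= K i i by rewrite -qform_delta.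
have [ki|ki] := eqVneq (K i i) 0.
  have b0 c : dot (K i) c = 0.
    apply/eqP/negPn/negP => bn0.
    (* With K i i = 0 the form is affine in t; this value of t would make it equal to - 1. *)
    have := pK (fun k => c k + (- (qform K c + 1) / (2 * dot (K i) c)) * (k == i)%:R).
    rewrite qform_shift// ki mulr0 addr0.
    have -> : 2 * (- (qform K c + 1) / (2 * dot (K i) c)) * dot (K i) c =
      - (qform K c + 1) by field.
    lra.
  apply: (IH _ sK pK _) => j l js; have [->|ji] := eqVneq j i; last first.
    by rewrite K0// inE negb_or ji.
  have := b0 (delta l); rewrite /dot (bigD1 l)//= eqxx mulr1 big1 ?addr0//.
  by move=> k /negbTE ->; rewrite mulr0.
have {ki}k0 : 0 < K i i by rewrite lt_neqAle eq_sym ki.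
(* The Schur complement K' of the entry (i, i) vanishes on row i. *)
pose a j := K i j / Num.sqrt (K i i).
pose K' j l := K j l - a j * a l.
have dota c : dot c a ^+ 2 = dot (K i) c ^+ 2 / K i i.
  rewrite -[X in _ / X](sqr_sqrtr (ltW k0)) -exprVn -exprMn; congr (_ ^+ 2).
  by rewrite /dot mulr_suml; apply: eq_bigr => j _; rewrite /a; ring.
have K'E c : qform K' c = qform K c - dot c a ^+ 2.
  rewrite /qform expr2 {1}/dot mulr_suml -sumrB; apply: eq_bigr => j _.
  by rewrite mulr_sumr -sumrB; apply: eq_bigr => l _; rewrite /K'; ring.
have [V VE] : exists V, gform V =1 qform K'.
  apply: IH.
  - by move=> j l; rewrite /K' sK mulrC.
  - move=> c; rewrite K'E dota.
    (* This t minimizes the form of K along coordinate i, and the minimum is the form of K'. *)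
    have := pK (fun k => c k + (- dot (K i) c / K i i) * (k == i)%:R).
    rewrite qform_shift//; congr (_ <= _); field; lra.
  - move=> j l js; rewrite /K'; have [->|ji] := eqVneq j i.
      rewrite /a; have h := sqr_sqrtr (ltW k0).
      have h2 : Num.sqrt (K i i) != 0 by rewrite gt_eqF// sqrtr_gt0.
      by move: h h2; move: (Num.sqrt _) => r h h2; rewrite -h; field.
    have K0j m : K j m = 0 by rewrite K0// inE negb_or ji.
    by rewrite /a K0j sK K0j !mul0r subr0.
exists (a :: V) => c; rewrite /gform big_cons -/(gform V c) VE K'E; ring.
Qed.

Lemma psd_gform K : (forall i j, K i j = K j i) ->
  (forall c, 0 <= qform K c) -> exists V, gform V =1 qform K.
Proof.
move=> sK pK; apply: (@psd_gform_support (enum I)) => // i j.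
by rewrite mem_enum.
Qed.

End positive_semidefinite.

(** * Fourier inversion *)

Section approximate_identity.
Context (R : realType) (h : R -> R).
Hypotheses (ch : continuous h) (h0 : forall x, 0 <= h x)
  (ih : (@lebesgue_measure R).-integrable setT (EFin \o h)).
Local Notation leb := (@lebesgue_measure R).

Let mh : measurable_fun setT h.
Proof. exact: continuous_measurable_fun. Qed.

Lemma normal_peakV (s : R) : 0 < s -> normal_peak s^-1 = s * normal_peak 1.
Proof.
move=> s0; rewrite /normal_peak expr1n mul1r -mulrnAr sqrtrM ?sqr_ge0//.
by rewrite sqrtr_sqr invfM gtr0_norm ?invr_gt0// invrK.
Qed.

(** The width is 1 / s, so the peak is of order s; the bound exp v >= v gains a factor s^-2 at
    distance d from x0. *)
Lemma normal_pdf_far (x0 s d x : R) : 0 < s -> 0 < d -> d <= `|x - x0| ->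
  normal_pdf x0 s^-1 x <= 2 * normal_peak 1 / d ^+ 2 / s.
Proof.
move=> s0 d0 dx; have sn0 : s != 0 by rewrite gt_eqF.
rewrite normal_pdfE ?invr_eq0// normal_peakV// /normal_fun.
have -> : - (x - x0) ^+ 2 / (s^-1 ^+ 2 *+ 2) = - ((s * (x - x0)) ^+ 2 / 2).
  by rewrite -mulr_natr; field.
rewrite expRN; set v := _ / 2.
have v0 : (s * d) ^+ 2 / 2 <= v.
  rewrite ler_pM2r// !exprMn ler_pM2l ?exprn_gt0//.
  by rewrite -[leRHS]real_normK ?num_real// lerXn2r ?nnegrE// ltW.
have sd0 : 0 < (s * d) ^+ 2 / 2 by rewrite divr_gt0// exprn_gt0// mulr_gt0.
apply: (@le_trans _ _ (s * normal_peak 1 * ((s * d) ^+ 2 / 2)^-1)).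
  rewrite ler_wpM2l ?mulr_ge0 ?normal_peak_ge0 ?(ltW s0)//.
  rewrite lef_pV2 ?posrE ?expR_gt0// (le_trans v0)//.
  by apply: le_trans (expR_ge1Dx _); rewrite lerDr.
rewrite le_eqVlt; apply/orP; left; apply/eqP; field.
by rewrite sn0 gt_eqF.
Qed.

Lemma integrable_mul_normal_pdf (x0 s : R) : s != 0 ->
  leb.-integrable setT (EFin \o (fun x => h x * normal_pdf x0 s x)).
Proof.
move=> s0; apply: (@le_integrable _ _ _ leb _ measurableT _
  (EFin \o (fun x => normal_peak s * h x))).
- by apply/measurable_EFinP; apply: measurable_funM => //; exact: measurable_normal_pdf.
- move=> x _ /=; rewrite lee_fin !normrM mulrC ler_wpM2r//.
  by rewrite !ger0_norm ?normal_pdf_ge0 ?normal_peak_ge0// normal_pdf_ub.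
- exact: (integrableZl measurableT (normal_peak s) ih).
Qed.

(** Near x0 continuity of h is used. Far from x0, h is integrable against a uniformly small density,
    and the constant h x0 is handled by Chebyshev's inequality. *)
Lemma normal_approximate_identity (x0 : R) :
  \int[leb]_x (h x * normal_pdf x0 n.+1%:R^-1 x) @[n --> \oo] --> h x0.
Proof.
have sn0 n : (n.+1%:R : R)^-1 != 0 by rewrite invr_eq0 pnatr_eq0.
have sgt0 n : 0 < n.+1%:R :> R by rewrite ltr0n.
pose p n := normal_pdf x0 n.+1%:R^-1.
have mp n : measurable_fun setT (p n) by exact: measurable_normal_pdf.
have p0 n x : 0 <= p n x by exact: normal_pdf_ge0.
have ip n : leb.-integrable setT (EFin \o p n) by exact: integrable_normal_pdf.
have ip1 n : \int[leb]_x p n x = 1 by rewrite /Rintegral integral_normal_pdf.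
have ihp n : leb.-integrable setT (EFin \o (fun x => h x * p n x)) := integrable_mul_normal_pdf x0 (sn0 n).
have ZE (f : R -> R) (r : R) : leb.-integrable setT (EFin \o f) ->
    \int[leb]_x (r * f x) = r * \int[leb]_x f x.
  by move=> intf; exact: RintegralZl.
have ixp n : leb.-integrable setT (EFin \o (fun x => (x - x0) ^+ 2 * p n x)).
  apply: (integrable_normal_weight (sn0 n) (K := 1)) => [|x].
    by apply: measurable_funX; exact: measurable_funB.
  by rewrite ger0_norm ?sqr_ge0// mul1r lerDr.
have vp n : \int[leb]_x ((x - x0) ^+ 2 * p n x) = n.+1%:R^-1 ^+ 2.
  rewrite -(normal_variance x0 (sn0 n)) normal_Rintegral//.
  by apply: measurable_funX; exact: measurable_funB.
pose H := \int[leb]_x h x.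
have H0 : 0 <= H by apply: Rintegral_ge0.
have key e : 0 < e -> exists C, forall n,
    `|\int[leb]_x (h x * p n x) - h x0| <= e + C / n.+1%:R.
  move=> e0; have /cvgrPdist_le/(_ _ e0)[d /= d0 hd] := @ch x0.
  pose k := 2 * normal_peak 1 / d ^+ 2 : R.
  exists (k * H + h x0 / d ^+ 2) => n.
  have ie : leb.-integrable setT (EFin \o (fun x => h x0 * p n x)).
    exact: (integrableZl measurableT (h x0) (ip n)).
  have i1 : leb.-integrable setT (EFin \o (fun x => e * p n x)).
    exact: (integrableZl measurableT e (ip n)).
  have i2 : leb.-integrable setT (EFin \o (fun x => k / n.+1%:R * h x)).
    exact: (integrableZl measurableT (k / n.+1%:R) ih).
  have i3 : leb.-integrable setT
      (EFin \o (fun x => h x0 / d ^+ 2 * ((x - x0) ^+ 2 * p n x))).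
    exact: (integrableZl measurableT (h x0 / d ^+ 2) (ixp n)).
  have -> : \int[leb]_x (h x * p n x) - h x0 =
      \int[leb]_x (h x * p n x - h x0 * p n x).
    by rewrite RintegralB// (ZE _ _ (ip n)) ip1 mulr1.
  have idiff : leb.-integrable setT (EFin \o (fun x => h x * p n x - h x0 * p n x)).
    rewrite (_ : EFin \o _ = (fun x => (h x * p n x)%:E - (h x0 * p n x)%:E)%E)//.
    exact: (integrableB measurableT (ihp n) ie).
  apply: (le_trans (le_normr_Rintegral measurableT idiff)).
  (* Instead of splitting the domain, one majorant holds everywhere: its first term serves near x0,
     the other two serve at distance at least d. *)
  apply: (@le_trans _ _ (\int[leb]_x (e * p n x + (k / n.+1%:R * h x +
      h x0 / d ^+ 2 * ((x - x0) ^+ 2 * p n x))))).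
    apply: le_Rintegral => //.
    - exact: integrable_norm idiff.
    - rewrite (_ : EFin \o _ = (fun x => (e * p n x)%:E + ((k / n.+1%:R * h x)%:E +
        (h x0 / d ^+ 2 * ((x - x0) ^+ 2 * p n x))%:E))%E)//.
      exact: (integrableD measurableT i1 (integrableD measurableT i2 i3)).
    - move=> x _; rewrite -mulrBl normrM (ger0_norm (p0 n x)).
      have [xd|dx] := ltP `|x0 - x| d.
        apply: (@le_trans _ _ (e * p n x)).
          by rewrite ler_wpM2r// distrC hd.
        rewrite lerDl; apply: addr_ge0; first by rewrite !mulr_ge0// ?invr_ge0 ?normal_peak_ge0 ?sqr_ge0.
        apply: mulr_ge0; [by apply: divr_ge0; rewrite ?sqr_ge0|by apply: mulr_ge0; rewrite ?sqr_ge0].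
      rewrite -[leLHS]add0r; apply: lerD; first by rewrite mulr_ge0// ltW.
      apply: (@le_trans _ _ (h x * p n x + h x0 * p n x)).
        rewrite -mulrDl ler_wpM2r// (le_trans (ler_normB _ _))//.
        by rewrite !ger0_norm.
      apply: lerD.
        rewrite mulrC ler_wpM2r//; apply: normal_pdf_far => //.
        by rewrite distrC.
      rewrite mulrA ler_wpM2r// -mulrA ler_peMr//.
      rewrite mulrC ler_pdivlMr ?exprn_gt0// mul1r.
      by rewrite -[leRHS]real_normK ?num_real// distrC lerXn2r ?nnegrE// ltW.
  rewrite RintegralD//; last first.
    rewrite (_ : EFin \o _ = (fun x => ((k / n.+1%:R * h x)%:E +
        (h x0 / d ^+ 2 * ((x - x0) ^+ 2 * p n x))%:E))%E)//.
    exact: (integrableD measurableT i2 i3).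
  rewrite RintegralD// (ZE _ _ (ip n)) (ZE _ _ ih) (ZE _ _ (ixp n)) ip1 vp mulr1 lerD2l mulrDl lerD//.
    by rewrite -/H mulrAC.
  rewrite ler_wpM2l ?divr_ge0 ?sqr_ge0// expr2 ler_piMr ?invr_ge0//.
  by rewrite invf_le1// ler1n.
apply/cvgrPdist_le => e e0.
have [C HC] := key _ (divr_gt0 e0 (@ltr0n R 2)).
have C0 : C / n.+1%:R @[n --> \oo] --> (0 : R).
  by rewrite -[X in _ --> X](mulr0 C); apply: cvgMr; exact: cvg_harmonic.
have /cvgrPdist_le/(_ _ (divr_gt0 e0 (@ltr0n R 2))) := C0.
apply: filterS => n; rewrite sub0r normrN => Cn.
rewrite distrC; apply: le_trans (HC n) _.
by rewrite [leRHS](splitr e) lerD2l; exact: le_trans (ler_norm _) Cn.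
Qed.

End approximate_identity.

Section cosine_transform.
Context (R : realType) (h : R -> R).
Hypotheses (ch : continuous h) (h0 : forall x, 0 <= h x)
  (ih : (@lebesgue_measure R).-integrable setT (EFin \o h)).
Local Notation leb := (@lebesgue_measure R).
Local Notation GR := (measurableTypeR R).

Definition cos_transform (t : R) : R := \int[leb]_x (cos (t * x) * h x).
Local Notation ft := cos_transform.

Lemma continuous_cos_affine (c b : R) : continuous (fun x : R => cos (c * x + b)).
Proof.
move=> x; apply: (@continuous_comp _ _ _ (fun x : R => c * x + b) cos).
  by apply: cvgD; [apply: cvgMr; exact: cvg_id|exact: cvg_cst].
exact: continuous_cos.
Qed.

Let mh : measurable_fun setT h.
Proof. exact: continuous_measurable_fun. Qed.

Let mcos (c b : R) : measurable_fun [set: R] (fun x : R => cos (c * x + b)).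
Proof. by apply: continuous_measurable_fun; exact: continuous_cos_affine. Qed.

Let cosn (y : R) : `|cos y| <= 1.
Proof. by rewrite ler_norml cos_geN1 cos_le1. Qed.

Lemma integrable_cos_mul (t : R) :
  leb.-integrable setT (EFin \o (fun x => cos (t * x) * h x)).
Proof.
apply: (@le_integrable _ _ _ leb _ measurableT _ (EFin \o h)) => //.
- apply/measurable_EFinP; apply: measurable_funM => //.
  by have := mcos t 0; under eq_fun do rewrite addr0.
- by move=> x _ /=; rewrite lee_fin normrM ler_piMl.
Qed.

Lemma continuous_cos_transform : continuous ft.
Proof.
move=> t; have tI : t \in [set` `]t - 1, t + 1[].
  by rewrite inE/= in_itv/= ltrBlDr ltrDl ltr01.
apply: (@continuity_under_integral R _ _ leb (fun t x => cos (t * x) * h x)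
  setT measurableT (t - 1) (t + 1) _ _ h) => //.
- by move=> s _; exact: integrable_cos_mul.
- apply: (@aeW _ _ _ leb) => x _ s _; apply: cvgMl.
  have := @continuous_cos_affine x 0 s.
  by under eq_fun do rewrite addr0 mulrC.
- move=> s _; apply: (@aeW _ _ _ leb) => x _.
  by rewrite normrM (ger0_norm (h0 x)) ler_piMl.
Qed.

Lemma cos_transform_bound t : `|ft t| <= \int[leb]_x h x.
Proof.
apply: le_trans (le_normr_Rintegral measurableT (integrable_cos_mul t)) _.
apply: le_Rintegral => //.
- exact: integrable_norm (integrable_cos_mul t).
- by move=> x _; rewrite normrM (ger0_norm (h0 x)) ler_piMl.
Qed.

Section fubini.
Variables (c b s : R).
Hypothesis s0 : s != 0.
Local Notation N := (normal_prob (0 : R) s).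

(** The product-to-sum formula leaves the frequencies c + x and c - x, whose Gaussian averages, as
    functions of x, are bumps of width 1 / s at - c and c. *)
Lemma normal_cos_mul (x : R) :
  \int[N]_t (cos (t * x) * cos (c * t + b)) =
  2^-1 * cos b * (normal_fun c s^-1 x + normal_fun (- c) s^-1 x).
Proof.
have icos (e : R) : N.-integrable setT (EFin \o (fun t : R => cos (e * (t - 0) + b))).
  apply: (integrable_le_bound (M := 1)) => //; first exact: probability_lty.
  by under eq_fun do rewrite subr0; exact: mcos.
transitivity (\int[N]_t (2^-1 * cos ((c + x) * (t - 0) + b) +
    2^-1 * cos ((c - x) * (t - 0) + b))).
  apply: eq_Rintegral => t _; rewrite subr0.
  have -> : (c + x) * t + b = (c * t + b) + (t * x) by ring.
  have -> : (c - x) * t + b = (c * t + b) - (t * x) by ring.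
  by move: (c * t + b) (t * x) => u v; rewrite cosD cosB; field.
have iZ (e : R) : N.-integrable setT (EFin \o (fun t : R => 2^-1 * cos (e * (t - 0) + b))).
  exact: (integrableZl measurableT 2^-1 (icos e)).
rewrite RintegralD//.
rewrite (RintegralZl _ measurableT (icos (c + x))) (RintegralZl _ measurableT (icos (c - x))).
rewrite !normal_cos// /normal_fun.
have -> : - (x - c) ^+ 2 / (s^-1 ^+ 2 *+ 2) = - ((c - x) * s) ^+ 2 / 2.
  by rewrite -mulr_natr; field.
have -> : - (x - - c) ^+ 2 / (s^-1 ^+ 2 *+ 2) = - ((c + x) * s) ^+ 2 / 2.
  by rewrite -mulr_natr; field.
ring.
Qed.

Let F (p : GR * GR) : R := cos (p.1 * p.2) * h p.2 * cos (c * p.1 + b).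

Let mF : measurable_fun setT F.
Proof.
have m1 : measurable_fun setT (fun p : GR * GR => (p.1 : R)) by exact: measurable_fst.
have m2 : measurable_fun setT (fun p : GR * GR => (p.2 : R)) by exact: measurable_snd.
have mc : measurable_fun setT (cos : R -> R).
  by apply: continuous_measurable_fun; exact: continuous_cos.
apply: measurable_funM; first apply: measurable_funM.
- by apply: (measurableT_comp mc); exact: measurable_funM.
- exact: (measurableT_comp mh).
- by apply: (measurableT_comp mc); apply: measurable_funD => //; exact: measurable_funM.
Qed.

Let mFt t : measurable_fun [set: R] (fun x => F (t, x)).
Proof.
rewrite /F/=; apply: measurable_funM => //; apply: measurable_funM => //.
by have := mcos t 0; under eq_fun do rewrite addr0.
Qed.

Let iF : (N \x leb)%E.-integrable setT (EFin \o F).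
Proof.
apply/integrable12ltyP; first exact/measurable_EFinP.
apply: (@le_lt_trans _ _ (\int[N]_t (\int[leb]_x (h x)%:E)))%E; last first.
  rewrite integral_cst//= [X in (_ * X)%E](@probability_setT _ _ _ N) mule1.
  have /integrableP[_] := ih; congr (_ < _)%E.
  by apply: eq_integral => x _ /=; rewrite ger0_norm.
apply: ge0_le_integral => //.
- by move=> t _; apply: integral_ge0.
- apply: (@measurable_fun_fubini_tonelli_F _ _ _ _ _ leb (fun p => `|(EFin \o F) p|%E)) => //.
  by apply: measurableT_comp => //; exact/measurable_EFinP.
move=> t _; apply: ge0_le_integral => //=.
- apply/measurable_EFinP; apply: measurableT_comp => //; exact: mFt.
- exact/measurable_EFinP.
- move=> x _; rewrite lee_fin /F/= !normrM (ger0_norm (h0 x)).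
  by rewrite mulrAC ler_piMl// mulr_ile1.
Qed.

(** Fubini moves the Gaussian weight from t to x, where [normal_cos_mul] evaluates it. *)
Lemma normal_cos_transform :
  \int[N]_t (ft t * cos (c * t + b)) =
  2^-1 * cos b / normal_peak s^-1 *
  (\int[leb]_x (h x * normal_pdf c s^-1 x) +
   \int[leb]_x (h x * normal_pdf (- c) s^-1 x)).
Proof.
have s'0 : s^-1 != 0 by rewrite invr_eq0.
have k0 : normal_peak s^-1 != 0 by rewrite gt_eqF// normal_peak_gt0.
have ip e := integrable_mul_normal_pdf ch ih e s'0.
have intx t : leb.-integrable setT (EFin \o (fun x => F (t, x))).
  apply: (@le_integrable _ _ _ leb _ measurableT _ (EFin \o h)) => //.
    by apply/measurable_EFinP; exact: mFt.
  move=> x _; rewrite lee_fin /F/= !normrM.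
  by rewrite mulrAC ler_piMl// mulr_ile1.
have intt x : N.-integrable setT (EFin \o (fun t => cos (t * x) * cos (c * t + b))).
  apply: (integrable_le_bound (M := 1)); first exact: probability_lty.
    apply: measurable_funM; last exact: mcos.
    by have := mcos x 0; under eq_fun do rewrite addr0 mulrC.
  by move=> t; rewrite /= normrM mulr_ile1.
have := Fubini iF; rewrite /=.
under eq_integral => t _.
  rewrite (_ : \int[leb]_x _ = (ft t * cos (c * t + b))%:E)%E; last first.
    rewrite /cos_transform -RintegralZr//; last exact: integrable_cos_mul.
    by rewrite /Rintegral fineK//; exact: (integrable_fin_num measurableT (intx t)).
  over.
under [X in _ = X]eq_integral => x _.
  rewrite (_ : \int[N]_t _ = (h x * (2^-1 * cos b *
      (normal_fun c s^-1 x + normal_fun (- c) s^-1 x)))%:E)%E; last first.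
    rewrite -normal_cos_mul -RintegralZl// /Rintegral fineK.
      by apply: eq_integral => t _; congr (_%:E); rewrite /F/=; ring.
    by apply: (integrable_fin_num measurableT); exact: (integrableZl measurableT (h x) (intt x)).
  over.
move=> E; rewrite /Rintegral E -/(Rintegral leb setT _).
transitivity (\int[leb]_x (2^-1 * cos b / normal_peak s^-1 *
    (h x * normal_pdf c s^-1 x + h x * normal_pdf (- c) s^-1 x))).
  by apply: eq_Rintegral => x _; rewrite !normal_pdfE//; field.
rewrite RintegralZl ?RintegralD//.
exact: (integrableD measurableT (ip c) (ip (- c))).
Qed.

End fubini.

(** The phase b keeps the cosine and sine parts of the inversion formula in one statement; evenness
    of h merges the values at c and - c. *)
Lemma cos_transform_inversion (A c b : R) : (forall x, h (- x) = h x) ->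
  (forall t, A < `|t| -> ft t = 0) ->
  \int[leb]_(t in `[- A, A]) (ft t * cos (c * t + b)) = 2 * pi * h c * cos b.
Proof.
move=> hev ft0.
have sn0 n : (n.+1%:R : R) != 0 by rewrite pnatr_eq0.
have sgt0 n : 0 < n.+1%:R :> R by rewrite ltr0n.
have mft : measurable_fun setT ft.
  exact: continuous_measurable_fun continuous_cos_transform.
have outA t : t \notin [set` `[- A, A]] -> ft t = 0.
  rewrite notin_setE/= in_itv/= -ler_norml => /negP; rewrite -ltNge; exact: ft0.
pose g t := ft t * cos (c * t + b).
have mg : measurable_fun setT g by apply: measurable_funM => //; exact: mcos.
have -> : \int[leb]_(t in `[- A, A]) g t = \int[leb]_t g t.
  rewrite Rintegral_mkcond; apply: eq_Rintegral => t _; rewrite patchE.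
  by case: ifPn => // /outA fz; rewrite /g fz mul0r.
have ig : leb.-integrable setT (EFin \o g).
  apply: (@le_integrable _ _ _ leb _ measurableT _
    (EFin \o (fun t => (\int[leb]_x h x) * \1_[set` `[- A, A]] t))).
  - exact/measurable_EFinP.
  - move=> t _; rewrite /= lee_fin /g normrM indicE.
    case: (boolP (t \in _)) => [_|/outA ->]; last by rewrite normr0 mul0r.
    rewrite mulr1; apply: le_trans (ler_norm _).
    by rewrite -[leRHS]mulr1 ler_pM ?cos_transform_bound.
  - exact: (integrableZl measurableT (\int[leb]_x h x)
      (integrable_indic_itv (- A) A true false)).
(* The Gaussian convergence factor of J turns, by Fubini, into an approximate
   identity of width 1 / (n + 1) applied to h at c and at - c. *)
pose J n := \int[leb]_t (g t * normal_fun 0 n.+1%:R t).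
have J1 : J n @[n --> \oo] --> \int[leb]_t g t.
  apply: (@dominated_Rintegral _ _ _ leb (fun n t => g t * normal_fun 0 n.+1%:R t) g
    (fun t => `|g t|)).
  - by move=> n; apply: measurable_funM => //; exact: measurable_normal_fun.
  - move=> t; rewrite -[X in _ --> X]mulr1; apply: cvgMr.
    apply/subr_cvg0; rewrite -[X in _ --> X]oppr0.
    under eq_fun do rewrite -opprB.
    apply: cvgN; apply: (@squeeze_cvg0 _ _ (fun n : nat => t ^+ 2 * n.+1%:R^-1)).
      move=> n; rewrite /normal_fun subr0.
      have n1 : 1 <= n.+1%:R :> R by rewrite ler1n.
      have v0 : 0 <= t ^+ 2 / (n.+1%:R ^+ 2 *+ 2).
        by rewrite divr_ge0 ?sqr_ge0// mulrn_wge0// sqr_ge0.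
      rewrite mulNr subr_ge0 -[X in expR _ <= X]expR0 ler_expR oppr_le0 v0/=.
      apply: (@le_trans _ _ (t ^+ 2 / (n.+1%:R ^+ 2 *+ 2))).
        rewrite lerBlDr -lerBlDl; exact: expR_ge1Dx.
      have : t ^+ 2 / (n.+1%:R ^+ 2 *+ 2) <= t ^+ 2 / n.+1%:R.
        have d0 : 0 < n.+1%:R ^+ 2 *+ 2 :> R by rewrite mulrn_wgt0// exprn_gt0.
        rewrite ler_wpM2l ?sqr_ge0// lef_pV2 ?posrE ?ltr0n//.
        by rewrite expr2 mulr2n; move: (n.+1%:R : R) n1 => m n1; nra.
      by [].
    rewrite -[X in _ --> X](mulr0 (t ^+ 2)); apply: cvgMr; exact: cvg_harmonic.
  - exact: integrable_norm ig.
  - move=> n t; have nf1 : normal_fun 0 n.+1%:R t <= 1.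
      rewrite /normal_fun -[leRHS]expR0 ler_expR mulNr oppr_le0.
      by apply: divr_ge0; rewrite ?sqr_ge0// mulrn_wge0// sqr_ge0.
    by rewrite normrM ler_piMr// ger0_norm ?normal_fun_ge0.
have J2 n : J n = 2 * pi * (2^-1 * cos b *
  (\int[leb]_x (h x * normal_pdf c n.+1%:R^-1 x) +
   \int[leb]_x (h x * normal_pdf (- c) n.+1%:R^-1 x))).
  have kn0 : normal_peak (n.+1%:R : R) != 0 by rewrite gt_eqF// normal_peak_gt0.
  have -> : J n = (normal_peak n.+1%:R)^-1 * \int[normal_prob 0 n.+1%:R]_t g t.
    have gb t : `|g t| <= \int[leb]_x h x.
      by rewrite normrM -[leRHS]mulr1 ler_pM ?cos_transform_bound.
    have igp : leb.-integrable setT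
        (EFin \o (fun t => g t * normal_pdf 0 n.+1%:R t)).
      apply: (integrable_normal_weight (sn0 n) (K := \int[leb]_x h x)) => // t.
      apply: le_trans (gb t) _; rewrite ler_peMr ?lerDl ?sqr_ge0//.
      exact: le_trans (normr_ge0 _) (gb 0).
    rewrite normal_Rintegral// -(RintegralZl _ measurableT igp).
    by apply: eq_Rintegral => t _; rewrite normal_pdfE//; field.
  rewrite normal_cos_transform// normal_peakV//.
  have -> : normal_peak (n.+1%:R : R) = n.+1%:R^-1 * normal_peak 1.
    have n1V : 0 < (n.+1%:R : R)^-1 by rewrite invr_gt0.
    by have := normal_peakV n1V; rewrite invrK.
  (* The peaks at the widths n + 1 and 1 / (n + 1) multiply to the square of [normal_peak 1],
     whatever n is; this produces the factor 2 pi. *)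
  have k2 : (normal_peak (1 : R))^-2 = 2 * pi.
    have p0 : 0 <= pi *+ 2 :> R by rewrite mulrn_wge0// pi_ge0.
    by rewrite /normal_peak expr1n mul1r exprVn invrK (sqr_sqrtr p0) mulr_natl.
  have q0 : normal_peak (1 : R) != 0 by rewrite gt_eqF// normal_peak_gt0// oner_neq0.
  move: (_ + _) (sn0 n) (cos b) => I n0 cb.
  rewrite -k2; move: (n.+1%:R : R) (normal_peak (1 : R)) n0 q0 => m k m0 k0 {kn0 k2}.
  by field; rewrite m0 k0.
have J3 : J n @[n --> \oo] --> 2 * pi * (2^-1 * cos b * (h c + h (- c))).
  under eq_fun do rewrite J2.
  apply: cvgMr; apply: cvgMr; apply: cvgD; exact: normal_approximate_identity.
rewrite (cvg_unique _ J1 J3)// hev; by field.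
Qed.

End cosine_transform.

(** * Quantiles *)

Section quantiles.
Context (R : realType).
Local Notation leb := (@lebesgue_measure R).

Lemma continuous_integrable_itv (f : R -> R) (u v : R) (bu bv : bool) : continuous f ->
  leb.-integrable [set` Interval (BSide bu u) (BSide bv v)] (EFin \o f).
Proof.
move=> cf; apply: (@integrableS _ _ _ leb `[u, v]) => //.
- by apply: subset_itv; rewrite bnd_simp; case: bu bv => -[].
- apply: continuous_compact_integrable; first exact: segment_compact.
  exact: continuous_subspaceT.
Qed.

(** Quantiles give equal weights to the points, as [gexp_average] needs. On each piece g varies by
    at most L times the length, and the lengths add up to 2 A. The points do not depend on g, so
    they serve all frequencies at once. *)
Lemma quantile_points (k : R -> R) (A : R) (M : nat) : 0 < A -> (0 < M)%N ->
  continuous k -> (forall x, 0 <= k x) -> \int[leb]_(t in `[- A, A]) k t = 1 ->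
  exists x : nat -> R, (forall j, - A <= x j <= A) /\
    forall (g : R -> R) L, continuous g -> (forall u v, `|g u - g v| <= L * `|u - v|) ->
    `|\int[leb]_(t in `[- A, A]) (k t * g t) -
       (\sum_(0 <= j < M) g (x j)) / M%:R| <= L * (2 * A) / M%:R.
Proof.
move=> A0 M0 ck k0 k1.
have M0' : 0 < M%:R :> R by rewrite ltr0n.
pose S (f : R -> R) (x : R) := \int[leb]_(t in `[- A, x]) f t.
have SB (f : R -> R) u v : continuous f -> - A <= u -> u <= v ->
    S f v - S f u = \int[leb]_(t in `]u, v]) f t.
  move=> cf Au uv; apply: Rintegral_itvB; rewrite ?bnd_simp//.
  exact: continuous_integrable_itv.
have S0 (f : R -> R) : S f (- A) = 0 by rewrite /S set_itv1 Rintegral_set1.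
have Smono u v : - A <= u -> u <= v -> S k u <= S k v.
  by move=> Au uv; rewrite -subr_ge0 SB//; apply: Rintegral_ge0.
(* Where k vanishes quantiles are not unique, so the endpoints j = 0 and j = M are pinned to - A and
   A for the telescoping sum. Indices beyond M get the dummy value A. *)
have ex j : exists y, [/\ - A <= y <= A, (j <= M)%N -> S k y = j%:R / M%:R,
    j = 0%N -> y = - A & j = M -> y = A].
  have AA : - A <= A by lra.
  have [->|j0] := eqVneq j 0%N.
    exists (- A); rewrite lexx AA S0 mul0r; split => // M0''.
    by move: M0; rewrite -M0''.
  have [->|jM] := eqVneq j M.
    exists A; rewrite lexx AA; split => //; first by rewrite divff ?gt_eqF.
    by move=> M0''; move: M0; rewrite M0''.
  have [jleM|Mj] := leqP j M; last first.
    exists A; rewrite lexx AA; split => //.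
    + by move=> jj; move: j0; rewrite jj eqxx.
  have [||y] := @IVT R (S k) (- A) A (j%:R / M%:R) AA.
  - exact: (parameterized_integral_continuous AA (continuous_integrable_itv _ _ true false ck)).
  - rewrite S0 (k1 : S k A = 1) minEle maxEle ler01 divr_ge0//=.
    by rewrite ler_pdivrMr// mul1r ler_nat.
  rewrite in_itv/= => yA Sy; exists y; split => //.
  + by move=> jj; move: j0; rewrite jj eqxx.
  + by move=> jj; move: jM; rewrite jj eqxx.
(* Each interval ]y j, y (j + 1)] carries mass 1 / M. *)
have [y yP] := choice ex.
have yA j : - A <= y j <= A by have [] := yP j.
have ySE j : (j <= M)%N -> S k (y j) = j%:R / M%:R by have [] := yP j.
have y0 : y 0%N = - A by have [_ _ + _] := yP 0%N; exact.
have yM : y M = A by have [_ _ _ +] := yP M; exact.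
exists y; split => // g L cg gL.
have L0 : 0 <= L.
  by have := gL 1 0; rewrite subr0 normr1 mulr1; apply: le_trans.
have ylt j : (j < M)%N -> y j <= y j.+1.
  move=> jM; rewrite leNgt; apply/negP => ylt.
  have := Smono _ _ (proj1 (andP (yA j.+1))) (ltW ylt).
  rewrite !ySE//; last exact: ltnW.
  by rewrite ler_pM2r ?invr_gt0// ler_nat ltnn.
have ckg : continuous (fun t => k t * g t).
  by move=> t; apply: cvgM; [exact: ck|exact: cg].
have inc j : (j < M)%N ->
    `|S (fun t => k t * g t) (y j.+1) - S (fun t => k t * g t) (y j) - g (y j) / M%:R| <=
    L * (y j.+1 - y j) / M%:R.
  move=> jM; have /andP[Ay _] := yA j.
  have yy := ylt _ jM.
  have mass : \int[leb]_(t in `]y j, y j.+1]) k t = M%:R^-1.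
    rewrite -SB// !ySE//; last exact: ltnW.
    by rewrite -mulrBl -natr1 addrAC subrr add0r mul1r.
  have ik : leb.-integrable `]y j, y j.+1] (EFin \o k) by exact: continuous_integrable_itv.
  have ikg : leb.-integrable `]y j, y j.+1] (EFin \o (fun t => k t * g t)).
    exact: continuous_integrable_itv.
  have ZE (f : R -> R) (r : R) : leb.-integrable `]y j, y j.+1] (EFin \o f) ->
      \int[leb]_(t in `]y j, y j.+1]) (r * f t) = r * \int[leb]_(t in `]y j, y j.+1]) f t.
    by move=> intf; exact: RintegralZl.
  rewrite SB// -mass -!(ZE _ _ ik).
  have ckc c : continuous (fun t => c * k t).
    by move=> t; apply: cvgMr; exact: ck.
  rewrite -RintegralB//; last exact: continuous_integrable_itv (ckc _).
  have cd : continuous (fun t => k t * g t - g (y j) * k t).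
    by move=> t; apply: cvgB; [exact: ckg|exact: ckc].
  apply: (le_trans (le_normr_Rintegral _ (continuous_integrable_itv _ _ false false cd))) => //.
  apply: le_Rintegral => //.
  - exact: integrable_norm (continuous_integrable_itv _ _ false false cd).
  - exact: continuous_integrable_itv (ckc _).
  - move=> t; rewrite /= in_itv/= => /andP[t1 t2].
    have -> : k t * g t - g (y j) * k t = (g t - g (y j)) * k t by ring.
    rewrite normrM (ger0_norm (k0 t)) ler_wpM2r//.
    apply: le_trans (gL _ _) _; rewrite ler_wpM2l// ger0_norm; last by rewrite subr_ge0 ltW.
    by rewrite lerD2r.
have -> : \int[leb]_(t in `[- A, A]) (k t * g t) =
    \sum_(0 <= j < M) (S (fun t => k t * g t) (y j.+1) - S (fun t => k t * g t) (y j)).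
  by rewrite telescope_sumr// yM y0 S0 subr0.
rewrite mulr_suml -sumrB.
apply: le_trans (ler_norm_sum _ _ _) _.
have -> : L * (2 * A) / M%:R = \sum_(0 <= j < M) L * (y j.+1 - y j) / M%:R.
  rewrite -mulr_suml -mulr_sumr telescope_sumr// yM y0; congr (_ * _ / _); ring.
rewrite !big_nat; apply: ler_sum => j /andP[_ jM]; exact: inc.
Qed.

End quantiles.

(** * Finite-dimensional laws of a Gaussian process *)

(* [normal_prob] is a measure on [measurableTypeR R], whose display differs from
   that of the canonical measurable structure on [R]. *)
Section law.
Context d (T : measurableType d) (R : realType) (P : probability T R)
  (Y : T -> measurableTypeR R) (mu : {measure set (measurableTypeR R) -> \bar R}).
Hypotheses (mY : measurable_fun setT Y)
  (YE : forall A : set (measurableTypeR R), measurable A -> P [set w | A (Y w)] = mu A).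

Lemma ge0_integral_law (f : measurableTypeR R -> \bar R) : measurable_fun setT f ->
  (forall x, 0 <= f x)%E -> (\int[P]_w f (Y w) = \int[mu]_x f x)%E.
Proof.
move=> mf f0; transitivity (\int[pushforward P Y]_x f x)%E.
  by rewrite ge0_integral_pushforward// preimage_setT.
by apply: eq_measure_integral => A mA _; exact: YE.
Qed.

Lemma Rintegral_law (f : measurableTypeR R -> R) : measurable_fun setT f ->
  \int[P]_w f (Y w) = \int[mu]_x f x.
Proof.
move=> mf; rewrite /Rintegral; congr fine; rewrite integralE [RHS]integralE.
have mEf : measurable_fun setT (EFin \o f) by exact/measurable_EFinP.
rewrite -!ge0_integral_law//; last 2 first.
- exact: measurable_funeneg.
- exact: measurable_funepos.
by congr (_ - _)%E; apply: eq_integral => w _; rewrite ?funeposE ?funenegE.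
Qed.

Lemma integrable_law (f : measurableTypeR R -> R) : mu.-integrable setT (EFin \o f) ->
  P.-integrable setT (EFin \o (fun w => f (Y w))).
Proof.
move=> /integrableP[mf fi]; apply/integrableP; split.
  exact: (measurableT_comp mf mY).
by rewrite (ge0_integral_law (f := fun x => `|(EFin \o f) x|%E))//; exact: measurableT_comp.
Qed.

End law.

Section gaussian_variable.
Context d (T : measurableType d) (R : realType) (P : probability T R)
  (Y : T -> measurableTypeR R) (m s : R).
Hypotheses (mY : measurable_fun setT Y)
  (YE : forall A : set (measurableTypeR R), measurable A -> P [set w | A (Y w)] = gaussian_law m s A).

Let D : {measure set (measurableTypeR R) -> \bar R} := \d_(m : measurableTypeR R).

Let N : {measure set (measurableTypeR R) -> \bar R} := normal_prob m s.

Let dirac_law : s = 0 -> forall A : set (measurableTypeR R), measurable A -> P [set w | A (Y w)] = \d_m A.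
Proof. by move=> s0 A mA; rewrite YE// /gaussian_law s0 eqxx. Qed.

Let normal_law : s != 0 -> forall A : set (measurableTypeR R), measurable A ->
  P [set w | A (Y w)] = normal_prob m s A.
Proof. by move=> s0 A mA; rewrite YE// /gaussian_law (negbTE s0). Qed.

Let Rintegral_dirac (f : measurableTypeR R -> R) : measurable_fun setT f ->
  \int[D]_x f x = f m.
Proof.
move=> mf; rewrite /Rintegral integral_dirac//; last exact/measurable_EFinP.
by rewrite diracT mul1e.
Qed.

Lemma gaussian_integrable (f : R -> R) (K : R) : measurable_fun setT f ->
  (forall x, `|f x| <= K * (1 + (x - m) ^+ 2)) ->
  P.-integrable setT (EFin \o (fun w => f (Y w))).
Proof.
move=> mf fK; have [s0|s0] := eqVneq s 0.
  apply: (@integrable_law _ _ _ P Y D mY (dirac_law s0) f).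
  apply/integrableP; split; first exact/measurable_EFinP.
  rewrite integral_dirac//; last by apply: measurableT_comp => //; exact/measurable_EFinP.
  by rewrite diracT mul1e/= ltry.
exact: (@integrable_law _ _ _ P Y N mY (normal_law s0) f (normal_integrable s0 mf fK)).
Qed.

Lemma gaussian_mean : \int[P]_w Y w = m.
Proof.
have mid : measurable_fun setT (fun x : R => x) by exact: measurable_id.
have [s0|s0] := eqVneq s 0.
  by rewrite (@Rintegral_law _ _ _ P Y D mY (dirac_law s0) _ mid) Rintegral_dirac.
rewrite (@Rintegral_law _ _ _ P Y N mY (normal_law s0) _ mid).
have i1 := normal_integrable_center m s0.
have := normal_mean0 m s0.
transitivity (\int[normal_prob m s]_x ((x - m) + m)).
  by apply: eq_Rintegral => x _; rewrite subrK.
rewrite RintegralD//; last first.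
  by apply: (integrable_le_bound (M := `|m|)) => //; exact: probability_lty.
by rewrite normal_mean0// add0r Rintegral_probability_cst.
Qed.

Hypothesis m0 : m = 0.

Lemma gaussian_variance : \int[P]_w (Y w ^+ 2) = s ^+ 2.
Proof.
have msq : measurable_fun setT (fun x : R => x ^+ 2) by exact: measurable_funX.
have [s0|s0] := eqVneq s 0.
  by rewrite (@Rintegral_law _ _ _ P Y D mY (dirac_law s0) _ msq) Rintegral_dirac// m0 s0.
rewrite (@Rintegral_law _ _ _ P Y N mY (normal_law s0) _ msq) -(normal_variance m s0).
by apply: eq_Rintegral => x _; rewrite m0 subr0.
Qed.

Lemma gaussian_cos b : \int[P]_w cos (Y w + b) = expR (- s ^+ 2 / 2) * cos b.
Proof.
have mc : measurable_fun setT (fun x : R => cos (x + b)).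
  apply: continuous_measurable_fun => x.
  apply: (@continuous_comp _ _ _ (fun x : R => x + b) cos).
    by apply: cvgD; [exact: cvg_id|exact: cvg_cst].
  exact: continuous_cos.
have [s0|s0] := eqVneq s 0.
  rewrite (@Rintegral_law _ _ _ P Y D mY (dirac_law s0) _ mc) Rintegral_dirac// m0 s0 expr0n.
  by rewrite oppr0 mul0r expR0 mul1r add0r.
rewrite (@Rintegral_law _ _ _ P Y N mY (normal_law s0) _ mc).
have := normal_cos m s0 1 b; rewrite mul1r => <-.
by apply: eq_Rintegral => x _; rewrite m0 subr0 mul1r.
Qed.

End gaussian_variable.

Section gaussian_process_law.
Context d (T : measurableType d) (R : realType) (P : probability T R)
  (f : R -> {RV P >-> R}) (rho : {measure set R -> \bar R}).
Hypothesis hf : process_with_spectral_measure rho f.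

Let gf : gaussian_process f. Proof. by case: hf. Qed.
Let cf : centered_process f. Proof. by case: hf. Qed.

Definition covariance_kernel (u : R) : R := \int[rho]_lam cos (u * lam).

Lemma process_covariance (s t : R) :
  \int[P]_w (f s w * f t w) = covariance_kernel (t - s).
Proof.
have [_ _ _ _ /(_ s (t - s))] := hf.
rewrite addrC subrK => -[+ _]; rewrite /fourier_measure => E.
rewrite /covariance_kernel.
transitivity (\int[rho]_lam cos (- ((t - s) * lam))); last first.
  by apply: eq_Rintegral => x _; rewrite cosN.
by rewrite -E /Rintegral unlock.
Qed.

Lemma linear_combination_law (I : finType) (t c : I -> R) :
  exists m s : R, forall A : set R, measurable A ->
    P [set w | A (dot c (fun i => f (t i) w))] = gaussian_law m s A.
Proof.
have [m [s E]] := gf (t \o enum_val : 'I_#|I| -> R) (c \o enum_val).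
exists m, s => A mA; rewrite -E//; congr (P _); apply/seteqP.
have sumE w : dot c (fun i => f (t i) w) =
    \sum_(i < #|I|) (c \o enum_val) i * f ((t \o enum_val) i) w.
  by rewrite /dot (big_enum_val (fun i => c i * f (t i) w)).
by split => w /=; rewrite sumE.
Qed.

Lemma process_variable_law (t : R) : exists m s : R, forall A : set R, measurable A ->
    P [set w | A (f t w)] = gaussian_law m s A.
Proof.
have [m [s E]] := linear_combination_law (fun _ : unit => t) (fun=> 1).
exists m, s => A mA; rewrite -E//; congr (P _); apply/seteqP.
have sumE w : dot (fun _ : unit => 1) (fun=> f t w) = f t w.
  by rewrite /dot (big_pred1 tt)/= ?mul1r//; case.
by split => w /=; rewrite sumE.
Qed.

Let mfT (t : R) : measurable_fun setT (f t).
Proof. exact: measurable_funP. Qed.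

Let weight1 (m x : R) : `|x| <= (1 + `|m|) * (1 + (x - m) ^+ 2).
Proof.
have h1 : `|x| <= `|x - m| + `|m| by rewrite -{1}(subrK m x) ler_normD.
apply: le_trans h1 _; rewrite -[(x - m) ^+ 2]real_normK ?num_real//.
have := normr_ge0 m; have := normr_ge0 (x - m).
move: `|x - m| `|m| => u v u0 v0.
have : u <= 1 + u ^+ 2 by have := sqr_ge0 (u - 1); rewrite !expr2; nra.
by have := sqr_ge0 u => h2 h3; nra.
Qed.

Let weight2 (m x : R) : `|x ^+ 2| <= (2 + 2 * m ^+ 2) * (1 + (x - m) ^+ 2).
Proof.
rewrite ger0_norm ?sqr_ge0//.
have -> : x ^+ 2 = (x - m + m) ^+ 2 by rewrite subrK.
move: (x - m) => u.
have := sqr_ge0 (u - m); have := sqr_ge0 (u * m); rewrite !expr2; nra.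
Qed.

Lemma process_integrable t : P.-integrable setT (EFin \o f t).
Proof.
have [m [s E]] := process_variable_law t.
apply: (@gaussian_integrable _ _ _ P (f t) m s (mfT t) E (fun x => x) (1 + `|m|)) => //.
Qed.

Lemma process_integrable_sqr t : P.-integrable setT (EFin \o (fun w => f t w ^+ 2)).
Proof.
have [m [s E]] := process_variable_law t.
apply: (@gaussian_integrable _ _ _ P (f t) m s (mfT t) E (fun x => x ^+ 2)
  (2 + 2 * m ^+ 2)) => //.
Qed.

Lemma process_integrable_mul s t : P.-integrable setT (EFin \o (fun w => f s w * f t w)).
Proof.
apply: (@le_integrable _ _ _ P _ measurableT _
  (EFin \o (fun w => f s w ^+ 2 + f t w ^+ 2))).
- by apply/measurable_EFinP; exact: measurable_funM.
- move=> w _ /=; rewrite lee_fin [X in _ <= X]ger0_norm ?addr_ge0 ?sqr_ge0//.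
  rewrite ler_norml; have := sqr_ge0 (f s w + f t w); have := sqr_ge0 (f s w - f t w).
  by have := sqr_ge0 (f s w); have := sqr_ge0 (f t w); rewrite !expr2; lra.
- exact: (integrableD measurableT (process_integrable_sqr s) (process_integrable_sqr t)).
Qed.

(** The parameters of the Gaussian law are not given: m = 0 comes from centering, and s^2 is
    identified by expanding the second moment. *)
Lemma process_cos (I : finType) (t c : I -> R) b :
  \int[P]_w cos (dot c (fun i => f (t i) w) + b) =
  expR (- qform (fun i j => covariance_kernel (t j - t i)) c / 2) * cos b.
Proof.
pose Y w := dot c (fun i => f (t i) w).
have mY : measurable_fun setT Y.
  by apply: measurable_sum => i; exact: measurable_funM.
have [m [s E]] := linear_combination_law t c.
have iY i : P.-integrable setT (EFin \o (fun w => c i * f (t i) w)).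
  exact: (integrableZl measurableT (c i) (process_integrable (t i))).
have m0 : m = 0.
  rewrite -(@gaussian_mean _ _ _ P Y m s mY E) /Y /dot.
  have [_ ->] := Rintegral_sum (index_enum I) iY.
  apply: big1 => i _; rewrite (RintegralZl _ measurableT (process_integrable (t i))).
  have := cf (t i); rewrite unlock => E0.
  by rewrite /Rintegral E0 mulr0.
rewrite (@gaussian_cos _ _ _ P Y m s mY E m0); congr (expR (- _ / 2) * _).
rewrite -(@gaussian_variance _ _ _ P Y m s mY E m0).
have iK i j : P.-integrable setT (EFin \o (fun w => c i * c j * (f (t i) w * f (t j) w))).
  exact: (integrableZl measurableT (c i * c j) (process_integrable_mul (t i) (t j))).
transitivity (\int[P]_w (\sum_i \sum_j c i * c j * (f (t i) w * f (t j) w))).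
  apply: eq_Rintegral => w _; rewrite expr2 /Y /dot mulr_suml; apply: eq_bigr => i _.
  by rewrite mulr_sumr; apply: eq_bigr => j _; ring.
have iKi i := proj1 (Rintegral_sum (index_enum I) (iK i)).
have [_ ->] := Rintegral_sum (index_enum I) iKi.
apply: eq_bigr => i _; have [_ ->] := Rintegral_sum (index_enum I) (iK i).
apply: eq_bigr => j _.
by rewrite (RintegralZl _ measurableT (process_integrable_mul (t i) (t j))) process_covariance.
Qed.

End gaussian_process_law.

(** * Spectral forms *)

Section energy.
Context (R : realType).
Implicit Types (I J : finType).

(* The squared modulus of \sum_i c_i e^(i t_i lam). *)
Definition energy I (t c : I -> R) (lam : R) : R :=
  dot c (fun i => cos (t i * lam)) ^+ 2 + dot c (fun i => sin (t i * lam)) ^+ 2.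

Lemma energy_ge0 I (t c : I -> R) lam : 0 <= energy t c lam.
Proof. by rewrite addr_ge0 ?sqr_ge0. Qed.

Lemma energyE I (t c : I -> R) lam :
  energy t c lam = \sum_i \sum_j c i * c j * cos ((t j - t i) * lam).
Proof.
rewrite /energy /dot !expr2 !mulr_suml -big_split; apply: eq_bigr => i _ /=.
rewrite !mulr_sumr -big_split; apply: eq_bigr => j _ /=.
by rewrite mulrBl cosB; ring.
Qed.

(** Cauchy-Schwarz against the constant vector, from the double sum of the squares (v i - v j)^2. *)
Lemma sqr_dot_le I (c u : I -> R) : (forall i, `|u i| <= 1) ->
  dot c u ^+ 2 <= #|I|%:R * \sum_i c i ^+ 2 * u i ^+ 2.
Proof.
move=> u1; set v := fun i => c i * u i.
have -> : \sum_i c i ^+ 2 * u i ^+ 2 = \sum_i v i ^+ 2.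
  by apply: eq_bigr => i _; rewrite exprMn.
have -> : dot c u = \sum_i v i by [].
have : 0 <= \sum_i \sum_j (v i - v j) ^+ 2.
  by apply: sumr_ge0 => i _; apply: sumr_ge0 => j _; rewrite sqr_ge0.
have -> : \sum_i \sum_j (v i - v j) ^+ 2 =
    2 * (#|I|%:R * \sum_i v i ^+ 2) - 2 * (\sum_i v i) ^+ 2.
  transitivity (\sum_i \sum_j (v i ^+ 2 + v j ^+ 2 - 2 * (v i * v j))).
    by apply: eq_bigr => i _; apply: eq_bigr => j _; ring.
  under eq_bigr do rewrite sumrB big_split/= sumr_const.
  rewrite sumrB big_split/= sumr_const.
  have -> : \sum_i v i ^+ 2 *+ #|I| = #|I|%:R * \sum_i v i ^+ 2.
    by rewrite mulr_sumr; apply: eq_bigr => i _; rewrite mulr_natl.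
  have -> : \sum_i \sum_j 2 * (v i * v j) = 2 * (\sum_i v i) ^+ 2.
    rewrite expr2 mulr_suml mulr_sumr; apply: eq_bigr => i _.
    by rewrite mulr_sumr mulr_sumr.
  by rewrite -mulr_natl; ring.
by rewrite subr_ge0 ler_pM2l.
Qed.

Lemma energy_le I (t c : I -> R) lam :
  energy t c lam <= #|I|%:R * \sum_i c i ^+ 2.
Proof.
have c1 i : `|cos (t i * lam)| <= 1 by rewrite ler_norml cos_geN1 cos_le1.
have s1 i : `|sin (t i * lam)| <= 1 by rewrite ler_norml sin_geN1 sin_le1.
apply: le_trans (lerD (sqr_dot_le c c1) (sqr_dot_le c s1)) _.
rewrite -mulrDr -big_split ler_wpM2l//=; apply: ler_sum => i _.
by rewrite -mulrDr cos2Dsin2 mulr1.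
Qed.

(** Exponential sums multiply, hence so do their squared moduli. This is how averaging over
    translations acts on a spectral measure. *)
Lemma energy_prod I J (t c : I -> R) (x e : J -> R) lam :
  energy (fun p : I * J => t p.1 + x p.2) (fun p => c p.1 * e p.2) lam =
  energy t c lam * energy x e lam.
Proof.
rewrite /energy.
have pairE (F : I -> R) (G : J -> R) :
    \sum_(p : I * J) (c p.1 * e p.2) * (F p.1 * G p.2) = dot c F * dot e G.
  rewrite /dot mulr_suml.
  under [RHS]eq_bigr do rewrite mulr_sumr.
  by rewrite pair_big/=; apply: eq_bigr => -[i j] _ /=; ring.
have -> : dot (fun p : I * J => c p.1 * e p.2)
    (fun p => cos ((t p.1 + x p.2) * lam)) =
    dot c (fun i => cos (t i * lam)) * dot e (fun j => cos (x j * lam)) -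
    dot c (fun i => sin (t i * lam)) * dot e (fun j => sin (x j * lam)).
  rewrite -!pairE -sumrB; apply: eq_bigr => p _.
  by rewrite mulrDl cosD; ring.
have -> : dot (fun p : I * J => c p.1 * e p.2)
    (fun p => sin ((t p.1 + x p.2) * lam)) =
    dot c (fun i => sin (t i * lam)) * dot e (fun j => cos (x j * lam)) +
    dot c (fun i => cos (t i * lam)) * dot e (fun j => sin (x j * lam)).
  rewrite -!pairE -big_split; apply: eq_bigr => p _ /=.
  by rewrite mulrDl sinD; ring.
ring.
Qed.

Lemma measurable_energy I (t c : I -> R) : measurable_fun setT (energy t c).
Proof.
have mlin (b : R) : measurable_fun [set: R] (fun x : R => b * x).
  exact: measurable_funM.
have mc (b : R) : measurable_fun [set: R] (fun x : R => cos (b * x)).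
  by apply: measurableT_comp => //; apply: continuous_measurable_fun; exact: continuous_cos.
have ms (b : R) : measurable_fun [set: R] (fun x : R => sin (b * x)).
  by apply: measurableT_comp => //; apply: continuous_measurable_fun; exact: continuous_sin.
by apply: measurable_funD; apply: measurable_funX; apply: measurable_sum => i;
  apply: measurable_funM.
Qed.

End energy.

Section spectral_form.
Context (R : realType) (nu : {measure set R -> \bar R}) (w : R -> R).
Hypothesis iw : nu.-integrable setT (EFin \o w).

Lemma integrable_bounded_mul (g : R -> R) M : measurable_fun setT g ->
  (forall x, `|g x| <= M) -> nu.-integrable setT (EFin \o (fun x => g x * w x)).
Proof.
move=> mg gM.
have mw : measurable_fun setT w by apply/measurable_EFinP; exact: measurable_int iw.
apply: (@le_integrable _ _ _ nu _ measurableT _ (EFin \o (fun x => M * w x))).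
- by apply/measurable_EFinP; exact: measurable_funM.
- move=> x _ /=; rewrite lee_fin !normrM ler_wpM2r//.
  by apply: le_trans (gM x) _; exact: ler_norm.
- exact: (integrableZl measurableT M iw).
Qed.

(** A non-negative weight w thus gives a positive semidefinite kernel, and a weight small in L1(nu)
    gives a small form. *)
Lemma qform_spectral (I : finType) (t c : I -> R) :
  qform (fun i j => \int[nu]_lam (cos ((t j - t i) * lam) * w lam)) c =
  \int[nu]_lam (energy t c lam * w lam).
Proof.
have ic i j : nu.-integrable setT (EFin \o (fun lam => cos ((t j - t i) * lam) * w lam)).
  apply: (integrable_bounded_mul (M := 1)).
    apply: continuous_measurable_fun => x.
    apply: (@continuous_comp _ _ _ (fun x : R => (t j - t i) * x) cos).
      by apply: cvgMr; exact: cvg_id.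
    exact: continuous_cos.
  by move=> x; rewrite ler_norml cos_geN1 cos_le1.
have icc i j : nu.-integrable setT (EFin \o (fun lam =>
    c i * c j * (cos ((t j - t i) * lam) * w lam))).
  exact: (integrableZl measurableT (c i * c j) (ic i j)).
transitivity (\int[nu]_lam (\sum_i \sum_j c i * c j * (cos ((t j - t i) * lam) * w lam))).
  have ici i := proj1 (Rintegral_sum (index_enum I) (icc i)).
  have [_ ->] := Rintegral_sum (index_enum I) ici.
  apply: eq_bigr => i _; have [_ ->] := Rintegral_sum (index_enum I) (icc i).
  by apply: eq_bigr => j _; rewrite (RintegralZl _ measurableT (ic i j)).
apply: eq_Rintegral => lam _; rewrite energyE mulr_suml; apply: eq_bigr => i _.
by rewrite mulr_suml; apply: eq_bigr => j _; ring.
Qed.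

Lemma spectral_kernel_sym (I : finType) (t : I -> R) i j :
  \int[nu]_lam (cos ((t j - t i) * lam) * w lam) =
  \int[nu]_lam (cos ((t i - t j) * lam) * w lam).
Proof. by apply: eq_Rintegral => x _; rewrite -cosN -mulNr opprB. Qed.

End spectral_form.

Section process_functional.
Context d (T : measurableType d) (R : realType) (P : probability T R)
  (f : R -> {RV P >-> R}) (rho : {measure set R -> \bar R}).
Hypothesis hf : process_with_spectral_measure rho f.

(** The bridge from processes to iterated integrals: both sides are law functionals with the same
    characteristic function. *)
Lemma process_gexp (I : finType) (t : I -> R) V phi :
  gform V =1 qform (fun i j => covariance_kernel rho (t j - t i)) -> trigl phi ->
  \int[P]_w phi (fun i => f (t i) w) = gexp V phi (fun=> 0).
Proof.
move=> VE tphi.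
apply: (@law_functional_unique _ _ (fun phi => \int[P]_w phi (fun i => f (t i) w))
  (fun phi => gexp V phi (fun=> 0))) => //.
- by apply: random_vector_law_functional => i; exact: measurable_funP.
- exact: gexp_functional.
- move=> c b; rewrite (process_cos hf) gexp_cos VE; congr (_ * cos _).
  by rewrite -[LHS]add0r; congr (_ + _); rewrite /dot big1// => i _; rewrite mulr0.
Qed.

Lemma measurable_process_orthant (I : finType) (t u : I -> R) :
  measurable [set w | forall i, u i <= f (t i) w].
Proof.
rewrite (_ : [set w | _] = \big[setI/setT]_(i in I) [set w | u i <= f (t i) w]).
  apply: bigsetI_measurable => i _.
  rewrite (_ : [set w | _] = f (t i) @^-1` `[u i, +oo[%classic).
    by rewrite -[X in measurable X]setTI; exact: measurable_funP.
  by apply/seteqP; split => w /=; rewrite in_itv/= andbT.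
rewrite -bigcap_seq; apply/seteqP; split => [w h i _|w h i]; first exact: h.
by apply: h; rewrite /= mem_index_enum.
Qed.

Lemma process_orthant (I : finType) (t u : I -> R) V :
  gform V =1 qform (fun i j => covariance_kernel rho (t j - t i)) ->
  P [set w | forall i, u i <= f (t i) w] = (gexp V (orthant u) (fun=> 0))%:E.
Proof.
move=> VE; rewrite -(process_gexp VE); last exact: trigl_orthant.
have mO := measurable_process_orthant t u.
rewrite -(setIT [set w | _]) -(integral_indic P measurableT mO).
rewrite /Rintegral fineK; last first.
  apply: (integrable_fin_num measurableT).
  apply: (trigl_integrable P (X := fun w i => f (t i) w)); last exact: trigl_orthant.
  by move=> i; exact: measurable_funP.
apply: eq_integral => w _; rewrite /orthant indicE; congr (_%:R%:E); congr nat_of_bool.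
by apply/idP/forallP; rewrite inE.
Qed.

End process_functional.

(** * Averaging over translations on a finite grid *)

Section grid_average.
Context (R : realType) (mu nu : {measure set R -> \bar R}).
Hypotheses (muF : (mu setT < +oo)%E) (nuF : (nu setT < +oo)%E).
Context (I : finType) (p : nat) (t : I -> R) (x : 'I_(2 ^ p) -> R).
Local Notation J := 'I_(2 ^ p).

Let tau (q : I * J) := t q.1 + x q.2.

Definition spectral_kernel (L : finType) (rho : {measure set R -> \bar R})
    (w : R -> R) (s : L -> R) i j : R :=
  \int[rho]_lam (cos ((s j - s i) * lam) * w lam).

Lemma integrable_cst1 (rho : {measure set R -> \bar R}) : (rho setT < +oo)%E ->
  rho.-integrable setT (EFin \o (fun=> 1 : R)).
Proof.
by move=> rF; apply: (integrable_le_bound (M := 1)) => // y; rewrite normr1.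
Qed.

Lemma spectral_gform (L : finType) (s : L -> R) (rho : {measure set R -> \bar R})
    (w : R -> R) : rho.-integrable setT (EFin \o w) -> (forall lam, 0 <= w lam) ->
  exists V, forall c, gform V c = \int[rho]_lam (energy s c lam * w lam).
Proof.
move=> iw w0; have [|c|V VE] := @psd_gform R L (spectral_kernel rho w s).
- by move=> i j; rewrite /spectral_kernel (spectral_kernel_sym _ _ s).
- rewrite (qform_spectral iw); apply: Rintegral_ge0 => lam _.
  by rewrite mulr_ge0// energy_ge0.
- by exists V => c; rewrite VE (qform_spectral iw).
Qed.

(** Together with [aver], the rows of a linear map from R^(I x J) to R^I in the form [gexp_img]
    expects: keep the times translated by x k, or average over all translations. *)
Let restr (k : J) (i : I) (q : I * J) : R := (q == (i, k))%:R.

Let dot_restr k i (y : I * J -> R) : dot (restr k i) y = y (i, k).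
Proof. by rewrite /restr dot_delta. Qed.

Let aver (i : I) (q : I * J) : R := (i == q.1)%:R / (2 ^ p)%:R.

Let dot_aver i (y : I * J -> R) :
  dot (aver i) y = (\sum_k y (i, k)) / (2 ^ p)%:R.
Proof.
rewrite /dot /aver.
transitivity (\sum_j \sum_k (i == j)%:R / (2 ^ p)%:R * y (j, k)).
  by rewrite pair_big; apply: eq_bigr => -[].
rewrite (bigD1 i)//= eqxx [X in _ + X]big1 ?addr0 => [|j /negbTE]; last first.
  by rewrite eq_sym => ->; rewrite big1// => k _; rewrite mul0r mul0r.
by rewrite -mulr_sumr div1r mulrC.
Qed.

Lemma gexp_grid_le (Vmu : seq (I * J -> R)) (W : seq (I -> R)) (l : R) (y : I * J -> R) :
  (forall c, gform Vmu c = \int[mu]_lam (energy tau c lam * 1)) ->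
  (forall c, gform W c = \int[mu]_lam (energy t c lam * 1)) ->
  gexp Vmu (orthant (fun=> l)) y <= gexp W (orthant (fun=> l)) (fun i => dot (aver i) y).
Proof.
move=> VmuE WE.
have tIJ : trigl (orthant (fun=> l) : (I * J -> R) -> R) by exact: trigl_orthant.
have tI : trigl (orthant (fun=> l) : (I -> R) -> R) by exact: trigl_orthant.
have /andP[e0 _] := gexp_itv Vmu y tIJ (orthant_itv _).
(* [gexp_average] takes a sequence on nat; the value 0 beyond 2^p is never read. *)
pose yj (j : nat) (i : I) : R := if insub j is Some k then y (i, k) else 0.
have yjE (k : J) : yj k = fun i => y (i, k) by rewrite /yj valK.
have -> : (fun i => dot (aver i) y) =
    (fun i => (\sum_(0 <= j < (2 ^ p)%N) yj j i) / (2 ^ p)%:R).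
  apply/funext => i; rewrite dot_aver; congr (_ / _); rewrite big_mkord.
  by apply: eq_bigr => k _; rewrite yjE.
apply: gexp_average => // j jp; rewrite (yjE (Ordinal jp)); set k := Ordinal jp.
have -> : (fun i => y (i, k)) = (fun i => dot (restr k i) y).
  by apply/funext => i; rewrite dot_restr.
(* Stationarity: the energy depends only on differences of times, so the translation x k drops
   out. *)
rewrite (@gexp_unique _ _ W (map (fun y i => dot (restr k i) y) Vmu))//; last first.
  move=> c; rewrite gform_img VmuE WE; apply: eq_Rintegral => lam _.
  congr (_ * 1).
  have CE (g : I * J -> R) : dot (fun q => \sum_i c i * restr k i q) g =
      dot c (fun i => g (i, k)).
    by rewrite -(dot_img (restr k) c g); congr (dot c _); apply/funext => i; rewrite dot_restr.
  transitivity (energy (fun i => t i + x k) c lam); last by rewrite /energy !CE.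
  rewrite !energyE; apply: eq_bigr => i _; apply: eq_bigr => m _.
  by congr (_ * cos (_ * _)); ring.
rewrite -(gexp_img (restr k)).
apply: gexp_le => //; first exact: trigl_img.
move=> z; rewrite /orthant; case: (boolP [forall q, l <= z q]) => [/forallP h|_]; last first.
  by case: [forall _, _].
suff -> : [forall i, l <= dot (restr k i) z] by [].
by apply/forallP => i; rewrite dot_restr.
Qed.

Lemma gform_aver (Vnu : seq (I * J -> R)) c :
  (forall c, gform Vnu c = \int[nu]_lam (energy tau c lam * 1)) ->
  gform (map (fun y i => dot (aver i) y) Vnu) c =
  \int[nu]_lam (energy t c lam * energy x (fun=> (2 ^ p)%:R^-1) lam).
Proof.
move=> VnuE; rewrite gform_img VnuE; apply: eq_Rintegral => lam _.
rewrite mulr1 -energy_prod; congr (energy _ _ _); apply/funext => q.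
rewrite /aver (bigD1 q.1)//= eqxx div1r big1 ?addr0// => i /negbTE ->.
by rewrite mul0r mulr0.
Qed.

End grid_average.

(** * The finite-dimensional inequality *)

Section comparison.
Context (R : realType) (mu nu : {measure set R -> \bar R}).
Hypotheses (muF : (mu setT < +oo)%E) (nuF : (nu setT < +oo)%E).
Context (h : {mfun R >-> R}).
Hypothesis h2nu : nu.-integrable setT (fun x : R => ((h x) ^+ 2)%:E).
Context d1 (Omega1 : measurableType d1) (P1 : probability Omega1 R)
  (f1 : R -> {RV P1 >-> R}).
Hypothesis hf1 : process_with_spectral_measure (measure_add mu nu) f1.
Context d2 (Omega2 : measurableType d2) (P2 : probability Omega2 R)
  (f2 : R -> {RV P2 >-> R}).
Hypothesis hf2 : process_with_spectral_measure (measure_add mu (sq_weighted h nu)) f2.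

Let i1 (rho : {measure set R -> \bar R}) : (rho setT < +oo)%E ->
  rho.-integrable setT (EFin \o (fun=> 1 : R)) := @integrable_cst1 R rho.

Let mcos (u : R) : measurable_fun [set: R] (fun x : R => cos (u * x)).
Proof.
apply: measurableT_comp; last exact: measurable_funM.
by apply: continuous_measurable_fun; exact: continuous_cos.
Qed.

Let cos1 (u x : R) : `|cos (u * x)| <= 1.
Proof. by rewrite ler_norml cos_geN1 cos_le1. Qed.

Let icos (rho : {measure set R -> \bar R}) u : (rho setT < +oo)%E ->
  rho.-integrable setT (EFin \o (fun x => cos (u * x))).
Proof. by move=> rF; apply: (integrable_le_bound (M := 1)). Qed.

Let h2 (x : R) := h x ^+ 2.

Let mh2 : measurable_fun [set: R] h2.
Proof. by apply: measurable_funX; exact: measurable_funP. Qed.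

Let sqE (A : set R) : measurable A ->
  sq_weighted h nu A = (\int[nu]_(x in A) (h2 x)%:E)%E.
Proof. by []. Qed.

Lemma covariance_kernel_add u :
  covariance_kernel (measure_add mu nu) u =
  \int[mu]_lam (cos (u * lam) * 1) + \int[nu]_lam (cos (u * lam) * 1).
Proof.
rewrite /covariance_kernel Rintegral_measure_add; [|exact: icos..].
by congr (_ + _); apply: eq_Rintegral => x _; rewrite mulr1.
Qed.

Lemma covariance_kernel_sq_weighted u :
  covariance_kernel (measure_add mu (sq_weighted h nu)) u =
  \int[mu]_lam (cos (u * lam) * 1) + \int[nu]_lam (cos (u * lam) * h2 lam).
Proof.
have isq : (sq_weighted h nu : {measure set R -> \bar R}).-integrable setT
    (EFin \o (fun x => cos (u * x))).
  apply: (integrable_densityP (k := h2) mh2 _ sqE) => //.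
    by move=> x; exact: sqr_ge0.
  exact: (integrable_bounded_mul h2nu (M := 1)).
rewrite /covariance_kernel Rintegral_measure_add//; last exact: icos.
congr (_ + _); first by apply: eq_Rintegral => x _; rewrite mulr1.
by apply: (Rintegral_density (k := h2) mh2 _ sqE) => // x; exact: sqr_ge0.
Qed.

Lemma qformD (I : finType) (K K' : I -> I -> R) c :
  qform (fun i j => K i j + K' i j) c = qform K c + qform K' c.
Proof.
rewrite /qform -big_split; apply: eq_bigr => i _; rewrite -big_split.
by apply: eq_bigr => j _; rewrite /= mulrDr.
Qed.

Section finite_dimensional.
Context (I : finType) (p : nat) (t : I -> R) (x : 'I_(2 ^ p) -> R).
Local Notation J := 'I_(2 ^ p).
Let tau (q : I * J) := t q.1 + x q.2.
(* Averaging over the translations x multiplies the spectral measure by B, which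
   is meant to be close to h ^+ 2. *)
Let B := energy x (fun=> (2 ^ p)%:R^-1).
Let w lam := B lam - h2 lam.

Let iB : nu.-integrable setT (EFin \o B).
Proof.
apply: (integrable_le_bound (M := #|J|%:R * \sum_(j : J) (2 ^ p)%:R^-1 ^+ 2)) => //.
  exact: measurable_energy.
by move=> y; rewrite ger0_norm ?energy_ge0// energy_le.
Qed.

Let iw : nu.-integrable setT (EFin \o w).
Proof. exact: (integrableB measurableT iB h2nu). Qed.

Let normE (c : I -> R) lam : `|energy t c lam| <= #|I|%:R * \sum_i c i ^+ 2.
Proof. by rewrite ger0_norm ?energy_ge0// energy_le. Qed.

(** Independent noise of standard deviation e in every coordinate. *)
Let scaled_delta (e : R) := [seq (fun k => e * (k == i)%:R : R) | i : I].

Let gform_scaled_delta e c : gform (scaled_delta e) c = e ^+ 2 * \sum_i c i ^+ 2.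
Proof.
rewrite /gform big_image/= mulr_sumr; apply: eq_bigr => i _.
rewrite dotZr exprMn; congr (_ * _ ^+ 2).
rewrite /dot (bigD1 i)//= eqxx mulr1 big1 ?addr0// => j /negbTE ->.
by rewrite mulr0.
Qed.

(** The averaged vector has weight B where the target has h^2, with one noise added on each side.
    The constant 3 counts variances per coordinate: eps^2 for [scaled_delta eps], and at most 2
    eps^2 for D, namely eps^2 plus the form of B - h^2. *)
Lemma finite_dim_le (l s e eps : R) : 0 < e ->
  #|I|%:R * \int[nu]_lam `|w lam| <= eps ^+ 2 ->
  (P1 [set v | forall q : I * J, (l <= f1 (tau q + s) v)%R] <=
   P2 [set v | forall i : I, (l - 2 * e <= f2 (t i) v)%R] +
   (#|I|%:R * (3 * eps ^+ 2 / e ^+ 2))%:E)%E.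
Proof.
move=> e0 weps.
have [Vmu VmuE] := spectral_gform tau (i1 muF) (fun=> ler01).
have [Vnu VnuE] := spectral_gform tau (i1 nuF) (fun=> ler01).
have [W WE] := spectral_gform t (i1 muF) (fun=> ler01).
have [H HE] := spectral_gform t (h2nu : nu.-integrable setT (EFin \o h2))
  (fun lam => sqr_ge0 (h lam)).
have P1E : P1 [set v | forall q : I * J, (l <= f1 (tau q + s) v)%R] =
    (gexp (Vnu ++ Vmu) (orthant (fun=> l)) (fun=> 0))%:E.
  have VE : gform (Vnu ++ Vmu) =1 qform (fun q r =>
      covariance_kernel (measure_add mu nu) ((tau r + s) - (tau q + s))).
    move=> c.
    rewrite gform_cat VmuE VnuE -(qform_spectral (i1 muF)) -(qform_spectral (i1 nuF)).
    rewrite addrC -qformD; congr (qform _ c).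
    apply/funext => q; apply/funext => r; rewrite covariance_kernel_add.
    by rewrite (_ : tau r + s - (tau q + s) = tau r - tau q)//; ring.
  exact: (process_orthant hf1 (t := fun q => tau q + s) (fun=> l) VE).
have P2E : P2 [set v | forall i : I, (l - 2 * e <= f2 (t i) v)%R] =
    (gexp (W ++ H) (orthant (fun=> l - 2 * e)) (fun=> 0))%:E.
  apply: (process_orthant hf2 (t := t) (fun=> l - 2 * e)) => c.
  rewrite gform_cat WE HE -(qform_spectral (i1 muF)).
  rewrite -(qform_spectral (h2nu : nu.-integrable setT (EFin \o h2))).
  rewrite -qformD; congr (qform _ c).
  by apply/funext => q; apply/funext => r; rewrite covariance_kernel_sq_weighted.
pose A (y : I * J -> R) i := dot (fun q : I * J => (i == q.1)%:R / (2 ^ p)%:R) y.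
pose V := map A Vnu ++ W.
have tI (b : R) : trigl (orthant (fun=> b) : (I -> R) -> R) by exact: trigl_orthant.
have tIJ : trigl (orthant (fun=> l) : (I * J -> R) -> R) by exact: trigl_orthant.
(* [Vmu] is the inner list, so the nu part is frozen as its base point and [gexp_grid_le] applies
   pointwise. *)
have step1 : gexp (Vnu ++ Vmu) (orthant (fun=> l)) (fun=> 0) <=
    gexp V (orthant (fun=> l)) (fun=> 0).
  rewrite !gexp_cat.
  have -> : gexp (map A Vnu) (gexp W (orthant (fun=> l))) (fun=> 0) =
      gexp Vnu (fun y => gexp W (orthant (fun=> l)) (A y)) (fun=> 0).
    rewrite (gexp_img (fun i (q : I * J) => (i == q.1)%:R / (2 ^ p)%:R)); congr (gexp _ _ _).
    by apply/funext => i; rewrite /dot big1// => q _; rewrite mulr0.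
  apply: gexp_le; first exact: trigl_gexp.
    apply: (trigl_img (fun i (q : I * J) => (i == q.1)%:R / (2 ^ p)%:R)).
    exact: trigl_gexp.
  by move=> y; exact: (gexp_grid_le l y VmuE WE).
(* The weight w has no sign; the diagonal eps^2 dominates its form, as [small] shows, so that D
   exists. *)
pose KD i j := spectral_kernel nu w t i j + eps ^+ 2 * (i == j)%:R.
have qKD c : qform KD c = \int[nu]_lam (energy t c lam * w lam) + eps ^+ 2 * \sum_i c i ^+ 2.
  rewrite /KD qformD (qform_spectral iw); congr (_ + _).
  rewrite /qform mulr_sumr; apply: eq_bigr => i _.
  rewrite (bigD1 i)//= eqxx/= mulr1 big1 ?addr0 => [|j]; first by ring.
  by rewrite eq_sym => /negbTE ->; rewrite !mulr0.
have iew c : nu.-integrable setT (EFin \o (fun lam => energy t c lam * w lam)).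
  exact: (integrable_bounded_mul iw (measurable_energy t c) (normE c)).
have inw : nu.-integrable setT (EFin \o (fun lam => `|w lam|)) by exact: integrable_norm iw.
have small c : `|\int[nu]_lam (energy t c lam * w lam)| <= eps ^+ 2 * \sum_i c i ^+ 2.
  apply: le_trans (le_normr_Rintegral measurableT (iew c)) _.
  apply: (@le_trans _ _ (\int[nu]_lam (#|I|%:R * (\sum_i c i ^+ 2) * `|w lam|))).
    apply: le_Rintegral => //; first exact: integrable_norm (iew c).
      exact: (integrableZl measurableT (#|I|%:R * (\sum_i c i ^+ 2)) inw).
    by move=> lam _; rewrite normrM ler_wpM2r// normE.
  rewrite (RintegralZl _ measurableT inw) mulrAC ler_wpM2r//.
  by apply: sumr_ge0 => i _; exact: sqr_ge0.
have [D DE] : exists D, gform D =1 qform KD.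
  apply: psd_gform.
    by move=> i j; rewrite /KD /spectral_kernel (spectral_kernel_sym _ _ t) eq_sym.
  move=> c; rewrite qKD; have := small c; rewrite ler_norml => /andP[+ _]; lra.
have key : gexp V (orthant (fun=> l)) (fun=> 0) <=
  gexp (W ++ H) (orthant (fun=> l - 2 * e)) (fun=> 0) +
    \sum_i (gform (scaled_delta eps) (fun k => (k == i)%:R) +
            gform D (fun k => (k == i)%:R)) / e ^+ 2.
  apply: gexp_orthant_compare => // c.
  rewrite !gform_cat (gform_aver _ VnuE) WE HE gform_scaled_delta DE qKD.
  have -> : \int[nu]_lam (energy t c lam * w lam) =
      \int[nu]_lam (energy t c lam * B lam) - \int[nu]_lam (energy t c lam * h2 lam).
    rewrite -RintegralB//.
    - by apply: eq_Rintegral => lam _; rewrite mulrBr.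
    - exact: (integrable_bounded_mul iB (measurable_energy t c) (normE c)).
    - exact: (integrable_bounded_mul h2nu (measurable_energy t c) (normE c)).
  rewrite -/B -/h2; ring.
rewrite P1E P2E -EFinD lee_fin; apply: le_trans step1 _; apply: le_trans key _.
rewrite lerD2l mulr_natl -sumr_const; apply: ler_sum => i _.
rewrite ler_wpM2r ?invr_ge0 ?sqr_ge0//.
have di : \sum_k ((k == i)%:R : R) ^+ 2 = 1.
  rewrite (bigD1 i)//= eqxx expr1n big1 ?addr0// => k /negbTE ->.
  by rewrite expr0n.
rewrite gform_scaled_delta DE qKD di mulr1.
have := small (fun k => (k == i)%:R); rewrite di mulr1 ler_norml => /andP[_]; lra.
Qed.

End finite_dimensional.

End comparison.

Lemma cos_lipschitz (R : realType) (u v : R) : `|cos u - cos v| <= `|u - v|.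
Proof.
wlog uv : u v / u <= v => [H|].
  have [/H//|/ltW vu] := leP u v.
  by rewrite distrC [leRHS]distrC; exact: H.
have [c _ E] := @MVT_segment R cos (fun x => - sin x) u v uv
  (fun x _ => is_derive_cos x) (continuous_subspaceT (@continuous_cos R)).
rewrite distrC E normrM normrN distrC ler_piMl//.
by rewrite ler_norml sin_geN1 sin_le1.
Qed.

Section spectral_density_quantiles.
Context (R : realType) (h : R -> R) (A : R).
Local Notation leb := (@lebesgue_measure R).
Hypotheses (ch : continuous h) (hge0 : forall x, 0 <= h x)
  (hev : forall x, h (- x) = h x) (ih : leb.-integrable setT (EFin \o h))
  (h0 : h 0 = 1) (A0 : 0 < A)
  (ft_ge0 : forall t, 0 <= cos_transform h t)
  (ft_supp : forall t, A < `|t| -> cos_transform h t = 0).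

Let k t := cos_transform h t / (2 * pi).

Let pi2 : 0 < 2 * pi :> R. Proof. by rewrite mulr_gt0// pi_gt0. Qed.

Let ck : continuous k.
Proof. by move=> t; apply: cvgMl; exact: continuous_cos_transform. Qed.

Let Rintegral_k c b : \int[leb]_(t in `[- A, A]) (k t * cos (c * t + b)) = h c * cos b.
Proof.
have cf : continuous (fun t => cos_transform h t * cos (c * t + b)).
  by move=> t; apply: cvgM; [exact: continuous_cos_transform|exact: continuous_cos_affine].
have := cos_transform_inversion ch hge0 ih c b hev ft_supp => E.
transitivity (\int[leb]_(t in `[- A, A])
    ((2 * pi)^-1 * (cos_transform h t * cos (c * t + b)))).
  by apply: eq_Rintegral => t _; rewrite /k; ring.
rewrite RintegralZl//; last exact: continuous_integrable_itv.
by rewrite E -mulrA mulKf// gt_eqF.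
Qed.

(** The average of cos (lam t + b) against k is h lam cos b, and the function of t is Lipschitz with
    constant |lam|. The phases b = 0 and b = - pi / 2 give the real and imaginary parts of the mean
    of exp (i lam x_j), with limits h lam and 0. *)
Lemma spectral_density_quantiles : exists x : nat -> nat -> R,
  (forall p j, - A <= x p j <= A) /\
  forall lam, energy (fun j : 'I_(2 ^ p) => x p j) (fun=> (2 ^ p)%:R^-1) lam
    @[p --> \oo] --> h lam ^+ 2.
Proof.
have k1 : \int[leb]_(t in `[- A, A]) k t = 1.
  rewrite -[RHS]h0 -[RHS]mulr1 -cos0 -Rintegral_k; apply: eq_Rintegral => t _.
  by rewrite mul0r add0r cos0 mulr1.
have kge0 t : 0 <= k t by rewrite divr_ge0// ltW.
have ex p := quantile_points A0 (expn_gt0 2 p : (0 < 2 ^ p)%N) ck kge0 k1.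
have [x xP] := choice ex.
exists x; split=> [p|lam]; first by have [] := xP p.
have avg b : (\sum_(0 <= j < (2 ^ p)%N) cos (lam * x p j + b)) / (2 ^ p)%:R
    @[p --> \oo] --> h lam * cos b.
  apply/subr_cvg0; apply: norm_cvg0.
  apply: (@squeeze_cvg0 _ _ (fun p => `|lam| * (2 * A) * 2^-1 ^+ p)).
    move=> p; rewrite normr_ge0/= distrC -Rintegral_k.
    have [_ /(_ (fun t => cos (lam * t + b)) `|lam|)] := xP p.
    rewrite exprVn -natrX; apply; first exact: continuous_cos_affine.
    move=> u v; apply: le_trans (cos_lipschitz _ _) _.
    rewrite (_ : lam * u + b - (lam * v + b) = lam * (u - v)); last by ring.
    by rewrite normrM.
  rewrite -[X in _ --> X](mulr0 (`|lam| * (2 * A))); apply: cvgMr.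
  by apply: cvg_expr; rewrite ger0_norm ?invr_ge0// invf_lt1// ltr1n.
have E p : energy (fun j : 'I_(2 ^ p) => x p j) (fun=> (2 ^ p)%:R^-1) lam =
    ((\sum_(0 <= j < (2 ^ p)%N) cos (lam * x p j + 0)) / (2 ^ p)%:R) ^+ 2 +
    ((\sum_(0 <= j < (2 ^ p)%N) cos (lam * x p j + - (pi / 2))) / (2 ^ p)%:R) ^+ 2.
  rewrite /energy /dot !big_mkord -!mulr_sumr ![_^-1 * _]mulrC.
  by congr ((_ / _) ^+ 2 + (_ / _) ^+ 2); apply: eq_bigr => j _;
    rewrite mulrC ?addr0// cosB cos_pihalf sin_pihalf mulr0 add0r mulr1.
under eq_fun do rewrite E.
rewrite (_ : h lam ^+ 2 = (h lam * cos 0) ^+ 2 + (h lam * cos (- (pi / 2))) ^+ 2); last first.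
  by rewrite cosN cos_pihalf cos0 mulr1 mulr0 expr0n addr0.
by apply: cvgD; rewrite expr2; under eq_fun do rewrite expr2; apply: cvgM; exact: avg.
Qed.

End spectral_density_quantiles.

(** Dominated convergence with majorant 1 + h^2: a mean of 2^p unit complex numbers has squared
    modulus at most 1. *)
Lemma energy_average_cvg (R : realType) (nu : {measure set R -> \bar R})
    (h : {mfun R >-> R}) (x : nat -> nat -> R) : (nu setT < +oo)%E ->
  nu.-integrable setT (fun x : R => ((h x) ^+ 2)%:E) ->
  (forall lam, energy (fun j : 'I_(2 ^ p) => x p j) (fun=> (2 ^ p)%:R^-1) lam
    @[p --> \oo] --> h lam ^+ 2) ->
  \int[nu]_lam `|energy (fun j : 'I_(2 ^ p) => x p j) (fun=> (2 ^ p)%:R^-1) lam -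
                 h lam ^+ 2| @[p --> \oo] --> 0.
Proof.
move=> nuF h2nu cv.
have mh2 : measurable_fun [set: R] (fun x => h x ^+ 2).
  by apply: measurable_funX; exact: measurable_funP.
have -> : 0 = \int[nu]_lam (0 : R) by rewrite Rintegral_cst// mul0r.
apply: (@dominated_Rintegral _ _ _ nu (fun p lam =>
  `|energy (fun j : 'I_(2 ^ p) => x p j) (fun=> (2 ^ p)%:R^-1) lam - h lam ^+ 2|)
  (fun=> 0) (fun lam => 1 + h lam ^+ 2)).
- move=> p; apply: measurableT_comp => //; apply: measurable_funB => //.
  exact: measurable_energy.
- move=> lam; have /subr_cvg0/cvg_norm := cv lam.
  by rewrite normr0.
- have i1 : nu.-integrable setT (EFin \o (fun=> 1 : R)).
    by apply: (integrable_le_bound (M := 1)) => // y; rewrite normr1.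
  exact: (integrableD measurableT i1 h2nu).
- move=> p lam; rewrite normr_id; apply: le_trans (ler_normB _ _) _.
  rewrite !ger0_norm ?energy_ge0 ?sqr_ge0// lerD2r.
  apply: le_trans (energy_le _ _ _) _.
  have q0 : (2 ^ p)%:R != 0 :> R by rewrite pnatr_eq0 expn_eq0.
  rewrite sumr_const !card_ord -[X in _ * X]mulr_natr; move: ((2 ^ p)%:R : R) q0 => q q0.
  by have -> : q * (q^-1 ^+ 2 * q) = 1 by field.
Qed.

(** * Continuous paths *)

Section dense_sequence.
Context (R : realType).

Definition clamp (T r : R) : R := Num.max 0 (Num.min T r).

Lemma clamp_itv T r : 0 <= T -> 0 <= clamp T r <= T.
Proof.
by move=> T0; rewrite /clamp le_max lexx/= ge_max T0 ge_min lexx.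
Qed.

Lemma clamp_dist T r t : 0 <= t <= T -> `|clamp T r - t| <= `|r - t|.
Proof.
case/andP=> t0 tT; rewrite /clamp minEle maxEle.
by case: (leP T r) => h1; case: ifP => h2; rewrite ler_norml; have := ler_norm (r - t);
  have := ler_norm (t - r); rewrite (distrC t r); lra.
Qed.

(** A dense sequence in [0, T] when T >= 0: the enumerated rationals, pushed into the interval.
    Codes of no rational default to 0. *)
Definition rat_clamp (T : R) (k : nat) : R := clamp T (ratr (odflt 0 (unpickle k : option rat))).

(** Clamping does not move a rational away from a point t of [0, T], so a rational close to t
    remains close to it. *)
Lemma rat_clamp_ge (T l : R) (g : R -> R) : continuous g ->
  (forall k, l <= g (rat_clamp T k)) -> forall t, 0 <= t <= T -> l <= g t.
Proof.
move=> cg lg t tT; rewrite leNgt; apply/negP => gtl.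
have e0 : 0 < l - g t by rewrite subr_gt0.
have /cvgrPdist_lt/(_ _ e0)[d /= d0 gd] := cg t.
have [|r] := @rat_in_itvoo R (t - d) (t + d); first by lra.
rewrite in_itv/= => /andP[r1 r2].
have rt : `|ratr r - t| < d by rewrite ltr_distl r1.
have := lg (pickle r); rewrite /rat_clamp pickleK/= leNgt => /negP; apply.
have /gd : `|t - clamp T (ratr r)| < d.
  by rewrite distrC; apply: le_lt_trans rt; exact: clamp_dist.
by rewrite distrC => /(le_lt_trans (ler_norm _)); rewrite ltrBlDr subrK.
Qed.

End dense_sequence.

Section paths.
Context d (Omega : measurableType d) (R : realType) (P : probability Omega R)
  (f : R -> {RV P >-> R}).
Hypothesis cf : {ae P, forall w, continuous (fun t : R => f t w)}.

(** A measurable substitute for [inf_above]; for a continuous path and T >= 0 it says that the path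
    is at least l on [0, T]. *)
Definition rat_above (T l : R) : set Omega :=
  [set w | forall k, l <= f (rat_clamp T k) w].

Lemma measurable_rv_ge (t l : R) : measurable [set w | l <= f t w].
Proof.
rewrite (_ : [set w | _] = f t @^-1` `[l, +oo[%classic).
  by rewrite -[X in measurable X]setTI; exact: measurable_funP.
by apply/seteqP; split => w /=; rewrite in_itv/= andbT.
Qed.

Lemma measurable_rat_above T l : measurable (rat_above T l).
Proof.
rewrite (_ : rat_above T l = \bigcap_k [set w | l <= f (rat_clamp T k) w]).
  by apply: bigcapT_measurable => k; exact: measurable_rv_ge.
by apply/seteqP; split => w h k; [move=> _|]; exact: h.
Qed.

Lemma inf_above_sub T l : 0 <= T ->
  inf_above f T l `<=` \bigcup_(q : nat) rat_above T (l + q.+1%:R^-1).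
Proof.
move=> T0 w; rewrite /inf_above /=; set S := [set _ | t in _] => lS.
have ub k : (ereal_inf S <= (f (rat_clamp T k) w)%:E)%E.
  apply: ereal_inf_lbound; exists (rat_clamp T k) => //.
  by rewrite /= in_itv/= clamp_itv.
have fin : ereal_inf S \is a fin_num.
  rewrite fin_real// (lt_trans _ lS) ?ltNyr//=.
  by rewrite (le_lt_trans (ub 0%N))// ltry.
move: lS ub; rewrite -(fineK fin) lte_fin; move: (fine _) => r lr ub.
have rl : 0 < r - l by rewrite subr_gt0.
(* For this index q, 1 / (q + 1) is below the gap r - l between the infimum r and the level. *)
exists (Num.truncn (r - l)^-1) => // k.
apply: le_trans (ub k : r <= _).
rewrite -lerBrDl -[leRHS]invrK lef_pV2 ?posrE ?invr_gt0//.
by apply: ltW; exact: truncnS_gt.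
Qed.

(** Discontinuous paths lie in a measurable null set, which subadditivity of the outer measure
    discards even if A is not measurable. *)
Lemma rat_above_le_outer (A : set Omega) (T l : R) :
  (forall w, continuous (fun t : R => f t w) -> rat_above T l w -> A w) ->
  (P (rat_above T l) <= mu_ext P A)%E.
Proof.
move=> hA; have [N [mN PN0 NP]] := cf.
have sub : rat_above T l `<=` A `|` N.
  move=> w hw; have [cw|ncw] := pselect (continuous (fun t : R => f t w)).
    by left; exact: hA.
  by right; apply: NP.
rewrite -(measurable_mu_extE P (measurable_rat_above T l)).
apply: le_trans (le_mu_ext P sub) _.
apply: le_trans (outer_measureU2 _ _ _) _.
have EN : mu_ext P N = 0%E by rewrite (measurable_mu_extE P mN).
by rewrite -[leRHS]adde0; apply: leeD => //; rewrite [leLHS]EN.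
Qed.

Lemma rat_above_le_measurable (A : set Omega) (T l : R) : measurable A ->
  (forall w, continuous (fun t : R => f t w) -> rat_above T l w -> A w) ->
  (P (rat_above T l) <= P A)%E.
Proof. by move=> mA hA; rewrite -(measurable_mu_extE P mA); exact: rat_above_le_outer. Qed.

Lemma rat_above_le_persistence (T l l' : R) : 0 <= T -> l < l' ->
  (P (rat_above T l') <= persistence f T l)%E.
Proof.
move=> T0 ll'; apply: rat_above_le_outer => w cw hw; rewrite /inf_above /=.
apply: (@lt_le_trans _ _ l'%:E); first by rewrite lte_fin.
apply: le_ereal_inf_tmp => _ [t /= + <-]; rewrite in_itv/= => tT.
by rewrite lee_fin; exact: (rat_clamp_ge cw hw).
Qed.

(** Continuity from below along the increasing events of [inf_above_sub]. *)
Lemma persistence_le (T l : R) (e : \bar R) : 0 <= T ->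
  (forall q : nat, P (rat_above T (l + q.+1%:R^-1)) <= e)%E ->
  (persistence f T l <= e)%E.
Proof.
move=> T0 He; pose F q := rat_above T (l + q.+1%:R^-1).
have mF q : measurable (F q) by exact: measurable_rat_above.
have mU : measurable (\bigcup_q F q) by exact: bigcup_measurable.
apply: (@le_trans _ _ (P (\bigcup_q F q))).
  rewrite -(measurable_mu_extE P mU); apply: le_mu_ext; exact: inf_above_sub.
have ndF : nondecreasing_seq F.
  move=> q r qr; apply/subsetPset => w hw k; apply: le_trans (hw k).
  by rewrite lerD2l lef_pV2 ?posrE// ler_nat ltnS.
have cv := @nondecreasing_cvg_mu _ _ _ P F mF mU ndF.
rewrite -(cvg_lim _ cv)//; apply: lime_le; first by apply/cvg_ex; eexists; exact: cv.
by apply: nearW => q; exact: He.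
Qed.

(** Continuity from above; it reduces the countable set of times to its finite initial segments. *)
Lemma le_rat_above (T l : R) (e : \bar R) :
  (forall K, e <= P [set w | forall i : 'I_K.+1, (l <= f (rat_clamp T i) w)%R])%E ->
  (e <= P (rat_above T l))%E.
Proof.
move=> He; pose F K := [set w | forall i : 'I_K.+1, l <= f (rat_clamp T i) w].
have FE K : F K = \bigcap_(k in [set k | (k <= K)%N]) [set w | l <= f (rat_clamp T k) w].
  apply/seteqP; split => w h.
    by move=> k kK; have := h (Ordinal (kK : (k < K.+1)%N)).
  by move=> i; apply: h; rewrite /= -ltnS.
have mF K : measurable (F K).
  by rewrite FE; apply: bigcap_measurable => [|k _]; [exists 0%N|exact: measurable_rv_ge].
have EF : rat_above T l = \bigcap_K F K.
  apply/seteqP; split => w h; first by move=> K _ i; exact: h.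
  by move=> k; exact: (h k I ord_max).
have niF : nonincreasing_seq F.
  move=> K L KL; apply/subsetPset => w hw i.
  by have := hw (widen_ord (KL : (K.+1 <= L.+1)%N) i).
have mcap : measurable (\bigcap_K F K) by rewrite -EF; exact: measurable_rat_above.
have F0 : (P (F 0%N) < +oo)%E by rewrite ltey_eq fin_num_measure.
have cv := @nonincreasing_cvg_mu _ _ _ P F F0 mF mcap niF.
rewrite EF -(cvg_lim _ cv)//; apply: lime_ge; first by apply/cvg_ex; eexists; exact: cv.
by apply: nearW => K; exact: He.
Qed.

End paths.

Lemma Re_fourier (R : realType) (h : R -> R) (t : R) :
  complex.Re (fourier h t) = cos_transform h t.
Proof.
rewrite /fourier /cintegral /= /cos_transform; apply: eq_Rintegral => x _ /=.
by rewrite cosN mulr0 subr0.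
Qed.

Theorem lemma1p2 (R : realType) (l a T : R) (ha : 0 < a) (hT : 0 < T)
    (h : {mfun R >-> R})
    (hdens : spectral_density h) (hcont : continuous (h : R -> R))
    (h0 : h 0 = 1)
    (hhat_ge0 : forall t : R, 0 <= fourier h t)
    (hhat_supp :
       closure [set t : R | fourier h t != 0] `<=` `[- (a / 2), a / 2])
    (mu nu : {measure set R -> \bar R})
    (hmu : class_L mu) (hnu : class_L nu)
    (h2nu : nu.-integrable setT (fun x : R => ((h x) ^+ 2)%:E))
    (d1 : measure_display) (Omega1 : measurableType d1)
    (P1 : probability Omega1 R) (f1 : R -> {RV P1 >-> R})
    (hf1 : process_with_spectral_measure (measure_add mu nu) f1)
    (d2 : measure_display) (Omega2 : measurableType d2)
    (P2 : probability Omega2 R) (f2 : R -> {RV P2 >-> R})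
    (hf2 : process_with_spectral_measure (measure_add mu (sq_weighted h nu)) f2) :
  (persistence f1 (T + a) l <= persistence f2 T l)%E.
Proof.
have [hge0 hev ih] := hdens.
have [[muF _] _] := hmu; have [[nuF _] _] := hnu.
have A0 : 0 < a / 2 by rewrite divr_gt0.
have ft_ge0 t : 0 <= cos_transform h t.
  by have := hhat_ge0 t; rewrite lecE => /andP[_]; rewrite Re_fourier.
have ft_supp t : a / 2 < `|t| -> cos_transform h t = 0.
  move=> at0; rewrite -Re_fourier.
  have [->//|tn0] := eqVneq (fourier h t) 0.
  have /hhat_supp : closure [set t : R | fourier h t != 0] t by exact: subset_closure.
  by rewrite /= in_itv/= -ler_norml leNgt at0.
have [x [xA xcv]] := spectral_density_quantiles hcont hge0 hev ih h0 A0 ft_ge0 ft_supp.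
have cvk := energy_average_cvg nuF h2nu xcv.
have cf1 : {ae P1, forall w, continuous (fun t : R => f1 t w)} by case: hf1.
have cf2 : {ae P2, forall w, continuous (fun t : R => f2 t w)} by case: hf2.
have T0 : 0 <= T by exact: ltW.
have Ta0 : 0 <= T + a by rewrite addr_ge0// ltW.
apply: persistence_le => // q.
(* The margin r is halved: the noise lowers the level by 2 e = r / 2, and the remaining r / 2 gives
   back a strict bound on the infimum. *)
set r := q.+1%:R^-1; have r0 : 0 < r :> R by rewrite invr_gt0.
apply: (@le_trans _ _ (P2 (rat_above f2 T (l + r / 2)))); last first.
  by apply: rat_above_le_persistence => //; rewrite ltrDl divr_gt0.
apply: le_rat_above => K; apply/lee_addgt0Pr => eta eta0.
pose t (i : 'I_K.+1) := rat_clamp T i.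
pose e := r / 4; have e0 : 0 < e by rewrite divr_gt0.
pose n : R := #|'I_K.+1|%:R.
have n0 : 0 < n by rewrite /n card_ord ltr0n.
(* Solves n (3 eps2 / e^2) = eta, the error term of [finite_dim_le]. *)
pose eps2 := eta * e ^+ 2 / (3 * n).
have eps20 : 0 < eps2 by rewrite divr_gt0 ?mulr_gt0// exprn_gt0.
have epsE : Num.sqrt eps2 ^+ 2 = eps2 by rewrite sqr_sqrtr// ltW.
(* The number n of times is already fixed, so p may depend on it. *)
have [p Hp] : exists p, n * \int[nu]_lam
    `|energy (fun j : 'I_(2 ^ p) => x p j) (fun=> (2 ^ p)%:R^-1) lam - h lam ^+ 2| <=
    Num.sqrt eps2 ^+ 2.
  have e2n : 0 < eps2 / n by rewrite divr_gt0.
  have /cvgrPdist_le/(_ _ e2n)[p _ /(_ p (leqnn p))] := cvk.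
  rewrite sub0r normrN => H; exists p; rewrite epsE mulrC -ler_pdivlMr//.
  exact: le_trans (ler_norm _) H.
(* The times t i + x p j range over [- a / 2, T + a / 2]; the shift by a / 2 moves them into
   [0, T + a]. *)
have := finite_dim_le muF nuF h2nu hf1 hf2 t (x := fun j : 'I_(2 ^ p) => x p j)
  (l + r) (a / 2) e0 Hp.
have -> : #|'I_K.+1|%:R * (3 * Num.sqrt eps2 ^+ 2 / e ^+ 2) = eta.
  rewrite epsE /eps2 -/n; field.
  by rewrite gt_eqF// gt_eqF.
have -> : l + r - 2 * e = l + r / 2 by rewrite /e; field.
(* The grid times need not occur in the dense sequence, so the two events are compared through
   continuity of the paths. *)
apply: le_trans; apply: (rat_above_le_measurable cf1).
  exact: (measurable_process_orthant f1 (fun q : 'I_K.+1 * 'I_(2 ^ p) => t q.1 + x p q.2 + a / 2)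
    (fun=> l + r)).
move=> w cw hw [i j] /=; apply: (rat_clamp_ge cw hw).
have /andP[t1 t2] := clamp_itv (ratr (odflt 0 (unpickle i : option rat))) T0.
have /andP[x1 x2] := xA p j.
rewrite -/(rat_clamp T i) -/(t i) in t1 t2 *.
by apply/andP; split; lra.
Qed.
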